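(* Suppose $\boldsymbol{\lambda}^n/\sqrt n\to\boldsymbol{\lambda}\ge0$ as $n\to\infty$ and $C$ is positive definite. Let $\hat{\boldsymbol u}_n=\sqrt n(\hat{\boldsymbol\beta}_n-\beta^0)$ and let $\hat{\boldsymbol u}=\operatorname{argmin}_{u\in\mathbb{R}^p}V(u)$, where $V(u)=\tfrac12u^TCu-u^TW+J'_{\boldsymbol\lambda}(\beta^0;u)$ with $W\sim\mathcal N(0,\sigma^2C)$. Then for any pattern $\mathfrak p\in\mathfrak P$, $$\mathbb P[\mathbf{patt}(\hat{\boldsymbol u}_n)=\mathfrak p]\xrightarrow[n\to\infty]{}\mathbb P[\mathbf{patt}(\hat{\boldsymbol u})=\mathfrak p].$$
   Context: Linear model: $p$ is fixed, $\beta^0\in\mathbb{R}^p$ is fixed, $X_1,X_2,\dots$ are i.i.d. centered random vectors in $\mathbb{R}^p$ with covariance matrix $C$, and $\varepsilon_1,\varepsilon_2,\dots$ are i.i.d. centered real random variables with (finite) variance $\sigma^2>0$, independent of the $X_i$. For each $n$ put $X=(X_1,\dots,X_n)^T\in\mathbb{R}^{n\times p}$, $\varepsilon=(\varepsilon_1,\dots,\varepsilon_n)^T$ and $y=X\beta^0+\varepsilon$. SLOPE norm: for $\boldsymbol{\lambda}=(\lambda_1,\dots,\lambda_p)$ with $\lambda_1\ge\dots\ge\lambda_p\ge0$, $J_{\boldsymbol{\lambda}}(\beta)=\sum_{i=1}^p\lambda_i|\beta|_{(i)}$, where $|\beta|_{(1)}\ge\dots\ge|\beta|_{(p)}$ are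 the absolute values of the coordinates of $\beta$ in decreasing order. $J'_{\boldsymbol\lambda}(\beta^0;u)$ denotes the directional derivative of $J_{\boldsymbol\lambda}$ at $\beta^0$ in direction $u$. For each $n$, $\boldsymbol{\lambda}^n$ is a deterministic vector with $\lambda^n_1\ge\dots\ge\lambda^n_p\ge0$, and the SLOPE estimator is $\hat{\boldsymbol\beta}_n=\operatorname{argmin}_{\beta\in\mathbb{R}^p}\ \tfrac12\|y-X\beta\|_2^2+J_{\boldsymbol{\lambda}^n}(\beta)$. SLOPE pattern: $\mathbf{patt}:\mathbb{R}^p\to\mathbb{Z}^p$, $\mathbf{patt}(u)_i=\mathrm{rank}(|u_i|)\,\mathrm{sgn}(u_i)$, where $\mathrm{rank}(|u_i|)$ is the rank of $|u_i|$ among the distinct values of $|u|$: value $0$ has rank $0$ and the $k$-th smallest distinct nonzero value of $|u_1|,\dots,|u_p|$ has rank $k$. $\mathfrak P=\mathbf{patt}(\mathbb{R}^p)$ is the finite set of patterns. *)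

(* Defs.v *)
From HB Require Import structures.
From mathcomp Require Import all_boot all_order all_algebra.
From mathcomp Require Import all_classical all_reals all_analysis.

Set Implicit Arguments.
Unset Strict Implicit.
Unset Printing Implicit Defensive.

Import Order.TTheory GRing.Theory Num.Theory.
Import numFieldNormedType.Exports.

Local Open Scope classical_set_scope.
Local Open Scope ring_scope.

(* R^p, i.e. 'cV[R]_p, carries the Borel sigma-algebra of the library's
   (product) topology on matrices, so that {RV P >-> 'cV[R]_p} is the type of
   random vectors. *)
Section borel_cV.
Context (R : realType) (p : nat).

Definition borel_cV : set (set 'cV[R]_p) := <<s @open 'cV[R]_p >>.

Let borel_cV0 : borel_cV set0. Proof. exact: sigma_algebra0. Qed.

Let borel_cVC (A : set 'cV[R]_p) : borel_cV A -> borel_cV (~` A).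
Proof. by move=> mA; rewrite -setTD; exact: sigma_algebraCD. Qed.

Let borel_cV_bigcup (F : (set 'cV[R]_p)^nat) :
  (forall i, borel_cV (F i)) -> borel_cV (\bigcup_i F i).
Proof. exact: sigma_algebra_bigcup. Qed.

HB.instance Definition _ := @isMeasurable.Build default_measure_display
  'cV[R]_p borel_cV borel_cV0 borel_cVC borel_cV_bigcup.

End borel_cV.

Section independence.
Context d (T : measurableType d) (R : realType) (P : probability T R).

(* Mutual independence of a family of classes of events (here always
   sigma-algebras): the product rule over every finite subfamily. *)
Definition mutually_independent (I : choiceType) (F : I -> set (set T)) :=
  forall (s : seq I) (A : I -> set T), uniq s ->
    {in s, forall i, F i (A i)} ->
    P (\bigcap_(i in [set` s]) A i) = (\prod_(i <- s) P (A i))%E.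

Definition independent_classes (F G : set (set T)) :=
  forall A B : set T, F A -> G B -> P (A `&` B) = (P A * P B)%E.

Definition sigma_seq d' (T' : measurableType d') (X : nat -> {RV P >-> T'}) :
    set (set T) :=
  <<s \bigcup_i g_sigma_algebra_preimage (X i) >>.

Definition iid d' (T' : measurableType d') (X : nat -> {RV P >-> T'}) :=
  mutually_independent (fun i => g_sigma_algebra_preimage (X i)) /\
  forall i (B : set T'), measurable B ->
    distribution P (X i) B = distribution P (X 0%N) B.

End independence.

Section random_vectors.
Context d (T : measurableType d) (R : realType) (P : probability T R).
Variable p : nat.

Definition centered_vec (X : {RV P >-> 'cV[R]_p}) :=
  forall j : 'I_p, ('E_P[fun w => (X w j 0)%R] = 0)%E.

(* As C j j is a real number, this entails that X has finite second moments. *)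
Definition has_covmx (X : {RV P >-> 'cV[R]_p}) (C : 'M[R]_p) :=
  forall j k : 'I_p,
    covariance P (fun w => X w j 0) (fun w => X w k 0) = (C j k)%:E.

(* W ~ N(m, S): almost surely W = A Z + m with A A^T = S and Z a vector of k
   independent standard normal variables. Leaving k free covers singular S
   (take k = rank S). *)
Definition normal_vec (W : {RV P >-> 'cV[R]_p}) (m : 'cV[R]_p)
    (S : 'M[R]_p) :=
  exists (k : nat) (A : 'M[R]_(p, k)) (Z : 'I_k -> {RV P >-> R}),
    [/\ mutually_independent P (fun i => g_sigma_algebra_preimage (Z i)),
        forall i (B : set R), measurable B ->
          distribution P (Z i) B = normal_prob 0 1 B,
        A *m A^T = S &
        {ae P, forall w, W w = A *m (\col_i Z i w) + m}].

End random_vectors.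

Section slope.
Context (R : realType).

Definition posdefmx p (C : 'M[R]_p) :=
  C^T = C /\ forall u : 'cV[R]_p, u != 0 -> 0 < (u^T *m C *m u) 0 0.

Definition sqnorm2 n (v : 'cV[R]_n) : R := \sum_i v i 0 ^+ 2.

Definition is_argmin (E : Type) (f : E -> R) (x : E) := forall y, f x <= f y.

Definition slope_weights p (lam : 'cV[R]_p) :=
  (forall i j : 'I_p, (i <= j)%N -> lam j 0 <= lam i 0) /\
  (forall i : 'I_p, 0 <= lam i 0).

Definition abs_sorted p (b : 'cV[R]_p) : seq R :=
  sort >=%R [seq `|b i 0| | i <- enum 'I_p].

Definition slope_norm p (lam b : 'cV[R]_p) : R :=
  \sum_(i < p) lam i 0 * (abs_sorted b)`_i.

(* One-sided: t decreases to 0. *)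
Definition dirderiv p (f : 'cV[R]_p -> R) (x u : 'cV[R]_p) : R :=
  lim ((f (x + t *: u) - f x) / t @[t --> 0^'+]).

Definition slope_objective n p (y : 'cV[R]_n) (X : 'M[R]_(n, p))
    (lam b : 'cV[R]_p) : R :=
  2^-1 * sqnorm2 (y - X *m b) + slope_norm lam b.

Definition limit_objective p (C : 'M[R]_p) (lam b0 W u : 'cV[R]_p) : R :=
  2^-1 * (u^T *m C *m u) 0 0 - (u^T *m W) 0 0
  + dirderiv (slope_norm lam) b0 u.

Definition nonzero_abs_values p (u : 'cV[R]_p) : seq R :=
  sort <=%R (undup [seq `|u i 0| | i <- enum 'I_p & u i 0 != 0]).

Definition abs_rank p (u : 'cV[R]_p) (i : 'I_p) : nat :=
  if u i 0 == 0 then 0%N else (index `|u i 0| (nonzero_abs_values u)).+1.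

Definition patt p (u : 'cV[R]_p) : 'cV[int]_p :=
  \col_i ((abs_rank u i)%:Z * sgz (u i 0)).

Definition patterns p : set 'cV[int]_p := range (@patt p).

End slope.

Section linear_model.
Context (R : realType) (T : Type) (p : nat).

(* Row i of the n x p design matrix is the transpose of the i-th regressor;
   sequences are indexed from 0. *)
Definition design (X : nat -> T -> 'cV[R]_p) (n : nat) (w : T) : 'M[R]_(n, p) :=
  \matrix_(i < n, j < p) X i w j 0.

Definition response (X : nat -> T -> 'cV[R]_p) (eps : nat -> T -> R)
    (b0 : 'cV[R]_p) (n : nat) (w : T) : 'cV[R]_n :=
  design X n w *m b0 + \col_(i < n) eps i w.

End linear_model.

(* Main.v *)
(* The rescaled error u_n minimises V_n(u) = 1/2 u^T C_n u - u^T W_n +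
   (increment of the SLOPE norm at b0 + u / sqrt n), where C_n -> C in
   probability and W_n -> W in law.  Patterns are constant on the cells of the
   arrangement of the hyperplanes u_i = 0 and u_i = +- u_j, and on each cell the
   increment of the norm near b0 is linear.  Strong convexity confines the
   minimiser of a small perturbation of V to a neighbourhood of the minimiser u
   of V, so its cell can only have cell(u) in its closure; stationarity of the
   perturbed objective along a strictly larger cell would put W close to one of
   finitely many affine hyperplanes, none of which W charges.  Hence, off a null
   set, the events patt(u) = q and patt(u) <> q are open conditions on W that
   force the same event for u_n once W_n is near W and C_n near C, and the
   portmanteau inequality for open sets, applied to both events, gives the
   limit.  The central limit theorem is proved by Lindeberg's replacement of the
   summands by Gaussian ones; replacing them by their constant mean instead
   yields the law of large numbers. *)
Require Import Defs.
From HB Require Import structures.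
From mathcomp Require Import all_boot all_order all_algebra.
From mathcomp Require Import all_classical all_reals all_analysis.
From mathcomp Require Import measurable_realfun ring lra.

Set Implicit Arguments.
Unset Strict Implicit.
Unset Printing Implicit Defensive.

Import Order.TTheory GRing.Theory Num.Theory.
Import numFieldNormedType.Exports.

Local Open Scope classical_set_scope.
Local Open Scope ring_scope.

(** * Borel measurability and independence of random vectors *)

(** The pattern is discontinuous, and the limit can charge cells with empty interior, so convergence
    in law of the rescaled error alone would not give the claim. The argument therefore works with
    the law of [W], where the events are open up to null sets. All weak convergence is used in one
    form: a strict bound [c < Q U] for an open [U] persists for large n. Only second moments are
    available, so Taylor remainders are kept as [|y|^r min(1, |y|)]; n times their mean at scale
    [s n] vanishes by dominated convergence. The choice r = 2, [s n = 1 / sqrt n] serves the central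
    limit theorem and r = 1, [s n = 1 / n] the law of large numbers. The increment of the norm at
    [b0 + u / sqrt n] is linear on cells only while u is small against [sqrt n]; beyond that,
    convexity alone must keep the minimiser from escaping. The tolerance under which the pattern is
    stable depends on the value of [W] with no measurable choice at hand; open unions of balls with
    radii bounded below replace such a choice. *)

Lemma measurable_forall d (T : measurableType d) (I : finType)
    (A : I -> set T) :
  (forall i, measurable (A i)) -> measurable [set x | forall i, A i x].
Proof.
move=> mA; have -> : [set x | forall i, A i x] = \bigcap_(i in setT) A i.
  by apply/seteqP; split => x /= h i => [_|]; exact: h.
by apply: fin_bigcap_measurable => // i _.
Qed.

Lemma measurable_fun_ltr d (T : measurableType d) (R : realType)
    (f : T -> R) (c : R) :
  measurable_fun setT f -> measurable [set x | f x < c].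
Proof.
move=> mf; have := mf measurableT `]-oo, c[%classic (measurable_itv _).
by rewrite setTI.
Qed.

Section vector_borel.
Context (R : realType) (p : nat).
Implicit Types (x y : 'cV[R]_p) (O : set 'cV[R]_p).

Lemma mx_norm_ltP x (e : R) : 0 < e ->
  `|x| < e <-> forall i, `|x i 0| < e.
Proof.
move=> e0; split=> [xe i|xe].
  have : ball (0 : 'cV[R]_p) e x by rewrite mx_norm_ball /ball_ /= sub0r normrN.
  by case=> _ /(_ i 0); rewrite /ball /= mxE sub0r normrN.
have : ball (0 : 'cV[R]_p) e x.
  split => // i j; rewrite (ord1 j) /ball /= mxE sub0r normrN; exact: xe.
by rewrite mx_norm_ball /ball_ /= sub0r normrN.
Qed.

Lemma mx_norm_leP x (e : R) : 0 <= e ->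
  `|x| <= e <-> forall i, `|x i 0| <= e.
Proof.
move=> e0; split=> [xe i|xe].
  apply/ler_addgt0Pr => d d0; apply/ltW.
  have /mx_norm_ltP : `|x| < e + d by rewrite (le_lt_trans xe)// ltrDl.
  by apply; rewrite ltr_wpDl.
apply/ler_addgt0Pr => d d0; apply/ltW/mx_norm_ltP; first by rewrite ltr_wpDl.
by move=> i; rewrite (le_lt_trans (xe i))// ltrDl.
Qed.

Lemma coord_le_norm x i : `|x i 0| <= `|x|.
Proof. by have [/(_ (lexx _)) h _] := mx_norm_leP x (normr_ge0 x); exact: h. Qed.

(** A countable base of the topology. Countability reduces Borel measurability of a vector to its
    coordinates, and later lets an open set be exhausted by finite products of bumps. *)
Definition rbox (c : 'cV[rat]_p * nat) : set 'cV[R]_p :=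
  [set x | forall i, `|x i 0 - ratr (c.1 i 0)| < c.2.+1%:R^-1].

Lemma open_rbox O x : open O -> O x -> exists2 c, rbox c x & rbox c `<=` O.
Proof.
move=> oO Ox; have /nbhs_ballP[e /= e0 eO] : nbhs x O by exact: open_nbhs_nbhs.
(* The box is centred near [x], not at [x]: two of its points differ by up to twice its radius. *)
have [k ke] : exists k : nat, k.+1%:R^-1 < e / 2.
  exists (Num.truncn (e / 2)^-1).
  rewrite invf_plt ?posrE ?divr_gt0 ?ltr0n//.
  by rewrite truncnS_gt.
have k0 : (0 : R) < k.+1%:R^-1 by rewrite invr_gt0 ltr0n.
have /choice[c cP] : forall i : 'I_p, exists q : rat, `|x i 0 - ratr q| < k.+1%:R^-1.
  move=> i; have /rat_in_itvoo[q] : x i 0 - k.+1%:R^-1 < x i 0 + k.+1%:R^-1.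
    by rewrite ltrD2l gtrN.
  rewrite in_itv/= => /andP[q1 q2]; exists q.
  by rewrite ltr_distlC q1 q2.
exists (\col_i c i, k) => [i|y yc]; first by rewrite /= mxE.
apply: eO; split => // i j; rewrite (ord1 j) /ball /=.
have := yc i; rewrite /= mxE distrC => yi.
rewrite -(subrKA (ratr (c i))) (le_lt_trans (ler_normD _ _))//.
by rewrite (splitr e) ltrD// (lt_trans _ ke).
Qed.

Lemma measurable_cV_open O : open O -> measurable O.
Proof. by move=> oO; exact: sub_sigma_algebra. Qed.

Lemma continuous_cV_measurable (f : 'cV[R]_p -> R) :
  continuous f -> measurable_fun setT f.
Proof.
move=> cf; apply: (measurability (@RGenOInfty.G R)).
  exact: RGenOInfty.measurableE.
move=> _ [_ [x ->] <-]; rewrite setTI; apply: measurable_cV_open.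
by move/continuousP : cf; apply; exact: interval_open.
Qed.

Lemma measurable_coord i : measurable_fun setT (fun x => x i 0).
Proof. by apply: continuous_cV_measurable => x; exact: coord_continuous. Qed.

Lemma measurable_cVP d (T : measurableType d) (f : T -> 'cV[R]_p) :
  (forall i, measurable_fun setT (fun w => f w i 0)) -> measurable_fun setT f.
Proof.
move=> mf; apply: (measurability (@open 'cV[R]_p)) => //.
move=> _ [U oU <-]; rewrite setTI.
have -> : f @^-1` U = \bigcup_c f @^-1` (if `[< rbox c `<=` U >] then rbox c else set0).
  apply/seteqP; split=> [w /= /(open_rbox oU)[c cw cU]|w [c _ /=]].
    by exists c => //=; case: asboolP.
  by case: asboolP => // + cw; exact.
apply: countable_bigcupT_measurable; first exact: countableP.
move=> c; case: asboolP => _; last by rewrite preimage_set0.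
apply: measurable_forall => i.
apply: measurable_fun_ltr; apply: measurableT_comp => //.
exact: measurable_funB.
Qed.

Lemma measurable_cV_add d (T : measurableType d) (f g : T -> 'cV[R]_p) :
  measurable_fun setT f -> measurable_fun setT g ->
  measurable_fun setT (fun w => f w + g w).
Proof.
move=> mf mg; apply: measurable_cVP => i.
under eq_fun do rewrite mxE.
apply: measurable_funD.
- exact: (measurableT_comp (measurable_coord i)).
- exact: (measurableT_comp (measurable_coord i)).
Qed.

Lemma measurable_cV_scale d (T : measurableType d) (s : T -> R)
    (f : T -> 'cV[R]_p) :
  measurable_fun setT s -> measurable_fun setT f ->
  measurable_fun setT (fun w => s w *: f w).
Proof.
move=> ms mf; apply: measurable_cVP => i.
under eq_fun do rewrite mxE.
apply: measurable_funM => //.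
exact: (measurableT_comp (measurable_coord i)).
Qed.

Lemma measurable_cV_sum d (T : measurableType d) (I : eqType) (s : seq I)
    (f : I -> T -> 'cV[R]_p) :
  (forall i, i \in s -> measurable_fun setT (f i)) ->
  measurable_fun setT (fun w => \sum_(i <- s) f i w).
Proof.
elim: s => [_|i s ih mf].
  under eq_fun do rewrite big_nil.
  exact: measurable_cst.
under eq_fun do rewrite big_cons.
apply: measurable_cV_add; first by apply: mf; rewrite mem_head.
by apply: ih => j js; apply: mf; rewrite in_cons js orbT.
Qed.

End vector_borel.

(** * Independence of generated sigma-algebras, product laws and expectations *)

Section block_independence.
Context d (T : measurableType d) (R : realType) (P : probability T R).

(** As functions of [A] both sides are finite measures, [P] restricted to [B] and [P] scaled by
    [P B], so their agreement on a pi-system passes to the generated sigma-algebra. *)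
Lemma indep_generated (G : set (set T)) (B : set T) :
  setI_closed G -> G setT -> G `<=` measurable -> measurable B ->
  (forall A, G A -> P (A `&` B) = (P A * P B)%E) ->
  forall A, <<s G >> A -> P (A `&` B) = (P A * P B)%E.
Proof.
move=> GI GT Gm mB h A sA.
have PB : P B = (fine (P B))%:E by rewrite fineK// fin_num_measure.
have r0 : 0 <= fine (P B) by rewrite fine_ge0.
have -> : (P A * P B)%E = mscale (NngNum r0) P A.
  by rewrite /mscale /= -PB muleC.
have -> : P (A `&` B) = mrestr P mB A by [].
apply: (@g_sigma_algebra_measure_unique _ _ _ G Gm (fun=> setT)) => //.
- by rewrite bigcup_const.
- move=> A' GA'; rewrite /= /mrestr/= /mscale/= -PB muleC; exact: h.
- move=> _; rewrite /= /mrestr/= setTI.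
  by rewrite (le_lt_trans (probability_le1 _ _))// ltry.
Qed.

(** When each [G i] is a pi-system containing the whole space, this is a pi-system generating the
    joint sigma-algebra of the indices in [s]. *)
Definition finite_inters (I : eqType) (G : I -> set (set T)) (s : seq I) :
    set (set T) :=
  [set E | exists2 A : I -> set T, (forall i, i \in s -> G i (A i)) &
    E = \bigcap_(i in [set` s]) A i].

Section finite_inters.
Context (I : choiceType) (G : I -> set (set T)).
Hypothesis GI : forall i, setI_closed (G i).
Hypothesis GT : forall i, G i setT.
Hypothesis Gm : forall i, G i `<=` measurable.

Lemma finite_intersI s : setI_closed (finite_inters G s).
Proof.
move=> _ _ [A GA ->] [B GB ->]; exists (fun i => A i `&` B i).
  by move=> i si; apply: GI; [exact: GA|exact: GB].
by rewrite bigcapI.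
Qed.

Lemma finite_intersT s : finite_inters G s setT.
Proof. by exists (fun=> setT) => //; rewrite bigcapT. Qed.

Lemma finite_inters_measurable s : finite_inters G s `<=` measurable.
Proof.
move=> _ [A GA ->]; apply: fin_bigcap_measurable => // i si.
by apply: Gm; exact: GA.
Qed.

Lemma sigma_finite_inters s i : i \in s -> <<s G i >> `<=` <<s finite_inters G s >>.
Proof.
move=> si; apply: smallest_sub; first exact: smallest_sigma_algebra.
move=> A GA; apply: sub_sigma_algebra; rewrite /finite_inters/=.
exists (fun j => if j == i then A else setT).
  by move=> j sj; case: eqP => [->|].
apply/seteqP; split => [x Ax j _|x /(_ i si)]; last by rewrite eqxx.
by case: eqP.
Qed.

(** The extension from generators is used twice: first for [B] with [E] fixed, then for [E] with [B]
    already a generator. *)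
Lemma block_indep s i (E B : set T) : mutually_independent P G ->
  uniq s -> i \notin s -> <<s finite_inters G s >> E -> <<s G i >> B ->
  P (E `&` B) = (P E * P B)%E.
Proof.
move=> indG us si sE sB.
rewrite setIC muleC.
have mE : measurable E.
  by apply: sE; split; [exact: sigma_algebra_measurable|exact: finite_inters_measurable].
apply: (indep_generated (G := G i)) => // {sB}B GB.
rewrite setIC muleC.
apply: (indep_generated (G := finite_inters G s)) => //.
- exact: finite_intersI.
- exact: finite_intersT.
- exact: finite_inters_measurable.
- exact: Gm GB.
move=> _ [A GA ->].
(* As [i] is not in [s], one family carries both [B] and the sets [A j]; the product rule is then
   read on [i :: s] and on [s]. *)
pose A' j := if j == i then B else A j.
have A's j : j \in s -> A' j = A j.
  by move=> sj; rewrite /A'; case: eqP => // ji; rewrite -ji sj in si.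
have -> : \bigcap_(j in [set` s]) A j = \bigcap_(j in [set` s]) A' j.
  by apply: eq_bigcapr => j /= /A's.
have -> : B = A' i by rewrite /A' eqxx.
have A'G : {in i :: s, forall j, G j (A' j)}.
  move=> j; rewrite in_cons /A'; case: eqP => [->//|_ /= sj]; exact: GA.
have := indG (i :: s) A' _ A'G; rewrite big_cons /= si us => /(_ isT).
have := indG s A' us; rewrite muleC => <-; last first.
  by move=> j sj; apply: A'G; rewrite in_cons sj orbT.
move=> <-; congr (P _); rewrite setIC.
apply/seteqP; split=> [x [xi xs] j|x xs].
  by rewrite /= in_cons => /predU1P[->//|]; exact: xs.
split; first by apply: xs; rewrite /= mem_head.
by move=> j /= sj; apply: xs; rewrite /= in_cons sj orbT.
Qed.

End finite_inters.

Lemma indep_pushforward d1 d2 (T1 : measurableType d1) (T2 : measurableType d2)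
    (A : {RV P >-> T1}) (B : {RV P >-> T2}) :
  (forall D F, measurable D -> measurable F ->
    P (A @^-1` D `&` B @^-1` F) = (P (A @^-1` D) * P (B @^-1` F))%E) ->
  forall X, measurable X ->
  (distribution P A \x distribution P B)%E X =
  pushforward P (fun w => (A w, B w)) X.
Proof.
move=> indAB X mX.
have mAB : measurable_fun setT (fun w => (A w, B w)).
  exact: measurable_fun_pair.
apply: (product_measure_unique (m' := distribution P (mfun_Sub (mem_set mAB)))) => //.
Qed.

Lemma ge0_indep_integral d1 d2 (T1 : measurableType d1)
    (T2 : measurableType d2) (A : {RV P >-> T1}) (B : {RV P >-> T2})
    (f : T1 * T2 -> \bar R) :
  (forall D F, measurable D -> measurable F ->
    P (A @^-1` D `&` B @^-1` F) = (P (A @^-1` D) * P (B @^-1` F))%E) ->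
  measurable_fun setT f -> (forall x, (0 <= f x)%E) ->
  (\int[P]_w f (A w, B w) = \int[P]_w \int[P]_w' f (A w, B w'))%E.
Proof.
move=> indAB mf f0.
have mAB : measurable_fun setT (fun w => (A w, B w)).
  exact: measurable_fun_pair.
transitivity (\int[pushforward P (fun w => (A w, B w))]_z f z)%E.
  by rewrite ge0_integral_pushforward.
transitivity (\int[(distribution P A \x distribution P B)%E]_z f z)%E.
  apply: (@eq_measure_integral _ _ _ _ (distribution P A \x distribution P B)%E
    (distribution P (mfun_Sub (mem_set mAB)))).
  by move=> X mX _; first [exact: indep_pushforward|exact/esym/indep_pushforward].
rewrite fubini_tonelli1// ge0_integral_distribution//=.
- apply: eq_integral => w _; rewrite /fubini_F /= ge0_integral_distribution//.
  by apply: measurableT_comp => //; exact: pair1_measurable.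
- exact: measurable_fun_fubini_tonelli_F.
- by move=> x; apply: integral_ge0.
Qed.

(** Tonelli for the absolute value of the product yields its integrability, which then permits
    Fubini for the signed product. *)
Lemma indep_integralM (U V : {RV P >-> R}) :
  (forall D F, measurable D -> measurable F ->
    P (U @^-1` D `&` V @^-1` F) = (P (U @^-1` D) * P (V @^-1` F))%E) ->
  P.-integrable setT (EFin \o U) -> P.-integrable setT (EFin \o V) ->
  P.-integrable setT (EFin \o (fun w => U w * V w)) /\
  (\int[P]_w (U w * V w)%:E = \int[P]_w (U w)%:E * \int[P]_w (V w)%:E)%E.
Proof.
move=> indUV iU iV.
have mUV : measurable_fun setT (fun w => (U w, V w)).
  exact: measurable_fun_pair.
pose f (x : R * R) := (x.1 * x.2)%:E.
have mf : measurable_fun setT f.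
  apply/measurable_EFinP; apply: measurable_funM.
    exact: measurable_fst.
  exact: measurable_snd.
have maf : measurable_fun setT (abse \o f) by exact: measurableT_comp.
have EU : (\int[P]_w (U w)%:E)%E \is a fin_num by exact: integrable_fin_num.
have EV : (\int[P]_w (V w)%:E)%E \is a fin_num by exact: integrable_fin_num.
have iUV : P.-integrable setT (EFin \o (fun w => U w * V w)).
  apply/integrableP; split.
    by apply/measurable_EFinP; exact: measurable_funM.
  have -> : (\int[P]_w `|(EFin \o (fun w => (U w * V w)%R)) w| =
      \int[P]_w (abse \o f) (U w, V w))%E by [].
  rewrite (ge0_indep_integral (f := abse \o f))//; last first.
    by move=> x; exact: abse_ge0.
  have mn (W : {RV P >-> R}) : measurable_fun setT (fun w => `|W w|%:E).
    by apply/measurable_EFinP; exact: measurableT_comp.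
  rewrite (eq_integral (fun w => (`|U w|%R)%:E * \int[P]_w' (`|V w'|%R)%:E)%E); last first.
    move=> w _; rewrite -ge0_integralZl//=.
    by apply: eq_integral => w' _; rewrite /f /= normrM EFinM.
  rewrite ge0_integralZr//=; last exact: integral_ge0.
  move/integrableP : iU => [_ iU]; move/integrableP : iV => [_ iV].
  by rewrite lte_mul_pinfty ?integral_ge0// ge0_fin_numE ?integral_ge0.
split => //.
have if' : (distribution P U \x distribution P V)%E.-integrable setT f.
  apply/integrableP; split => //.
  rewrite (@eq_measure_integral _ _ _ _
    (distribution P (mfun_Sub (mem_set mUV)))); last first.
    by move=> X mX _; first [exact: indep_pushforward|exact/esym/indep_pushforward].
  have := ge0_integral_distribution (P := P) (mfun_Sub (mem_set mUV)) maf (fun x => abse_ge0 _).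
  move=> /= ->; by move/integrableP : iUV => [].
transitivity (\int[pushforward P (fun w => (U w, V w))]_z f z)%E.
  by rewrite integral_pushforward.
transitivity (\int[(distribution P U \x distribution P V)%E]_z f z)%E.
  apply: (@eq_measure_integral _ _ _ _ (distribution P U \x distribution P V)%E
    (distribution P (mfun_Sub (mem_set mUV)))).
  by move=> X mX _; first [exact: indep_pushforward|exact/esym/indep_pushforward].
rewrite -integral12_prod_meas1//= /fubini_F /f /=.
have dE (W : {RV P >-> R}) : P.-integrable setT (EFin \o W) ->
    (\int[distribution P W]_x x%:E = \int[P]_w (W w)%:E)%E.
  by move=> iW; rewrite (integral_distribution (f := EFin)).
have iD (W : {RV P >-> R}) : P.-integrable setT (EFin \o W) ->
    (distribution P W).-integrable setT EFin.
  move=> /integrableP[_ iW]; apply/integrableP; split => //.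
  by rewrite ge0_integral_distribution//; apply: measurableT_comp.
under eq_integral => x _.
  under eq_integral => y _ do rewrite EFinM.
  rewrite integralZl//=; last exact: iD.
  rewrite dE//.
  over.
rewrite -(fineK EV) integralZr//=; last exact: iD.
by rewrite dE.
Qed.

End block_independence.

(** * Convolution with the law of a random vector *)

Section convolution.
Context (R : realType) (p : nat).
Local Open Scope ereal_scope.

(** Adding an independent vector becomes composition of such operators, so two sequences living on
    different probability spaces can be compared without a joint construction. *)
Definition conve d (T : measurableType d) (P : {measure set T -> \bar R})
    (Y : T -> 'cV[R]_p) (f : 'cV[R]_p -> \bar R) (x : 'cV[R]_p) : \bar R :=
  \int[P]_w f (x + Y w)%R.

Lemma measurable_add_cV : measurable_fun setT
  (fun z : 'cV[R]_p * 'cV[R]_p => z.1 + z.2)%R.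
Proof. by apply: measurable_cV_add; [exact: measurable_fst|exact: measurable_snd]. Qed.

Section one_measure.
Context d (T : measurableType d) (P : probability T R) (Y : T -> 'cV[R]_p).
Hypothesis mY : measurable_fun setT Y.
Implicit Types f g : 'cV[R]_p -> \bar R.

Lemma measurable_shift f x : measurable_fun setT f ->
  measurable_fun setT (fun w => f (x + Y w)%R).
Proof.
by move=> mf; apply: measurableT_comp => //; exact: measurable_cV_add.
Qed.

Lemma conve_ge0 f : (forall x, 0 <= f x) -> forall x, 0 <= conve P Y f x.
Proof. by move=> f0 x; exact: integral_ge0. Qed.

Lemma measurable_conve f : measurable_fun setT f -> (forall x, 0 <= f x) ->
  measurable_fun setT (conve P Y f).
Proof.
move=> mf f0.
apply: (measurable_fun_fubini_tonelli_F (m2 := P)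
  (fun z : 'cV[R]_p * T => f (z.1 + Y z.2)%R)) => //.
apply: measurableT_comp => //; apply: measurable_cV_add.
  exact: measurable_fst.
exact: (measurableT_comp mY measurable_snd).
Qed.

Lemma le_conve f g : measurable_fun setT f -> measurable_fun setT g ->
  (forall x, 0 <= f x) -> (forall x, f x <= g x) ->
  forall x, conve P Y f x <= conve P Y g x.
Proof.
move=> mf mg f0 fg x; apply: ge0_le_integral => //.
- exact: measurable_shift.
- exact: measurable_shift.
Qed.

Lemma conveD_cst f (e : R) : measurable_fun setT f -> (forall x, 0 <= f x) ->
  (0 <= e)%R -> forall x, conve P Y (fun y => f y + e%:E) x = conve P Y f x + e%:E.
Proof.
move=> mf f0 e0 x; rewrite /conve ge0_integralD//; last exact: measurable_shift.
by rewrite integral_cst//= probability_setT mule1.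
Qed.

End one_measure.

Lemma conveC d (T : measurableType d) (P : probability T R) (Y : T -> 'cV[R]_p)
    d' (T' : measurableType d') (Q : probability T' R) (Z : T' -> 'cV[R]_p) f :
  measurable_fun setT Y -> measurable_fun setT Z -> measurable_fun setT f ->
  (forall x, 0 <= f x) ->
  conve P Y (conve Q Z f) = conve Q Z (conve P Y f).
Proof.
move=> mY mZ mf f0; apply/funext => x.
rewrite /conve (fubini_tonelli (m1 := P) (m2 := Q)
  (fun z : T * T' => f (x + Y z.1 + Z z.2)%R))//=; last first.
  apply: measurableT_comp => //; apply: measurable_cV_add.
    apply: measurable_cV_add => //.
    exact: (measurableT_comp mY measurable_fst).
  exact: (measurableT_comp mZ measurable_snd).
apply: eq_integral => w _; apply: eq_integral => w' _.
by rewrite addrAC.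
Qed.

Lemma conve_law d (T : measurableType d) (P : probability T R)
    (Y : T -> 'cV[R]_p) d' (T' : measurableType d') (Q : probability T' R)
    (Z : T' -> 'cV[R]_p) f :
  measurable_fun setT Y -> measurable_fun setT Z ->
  (forall A, measurable A -> P (Y @^-1` A) = Q (Z @^-1` A)) ->
  measurable_fun setT f -> (forall x, 0 <= f x) ->
  conve P Y f = conve Q Z f.
Proof.
move=> mY mZ YZ mf f0; apply/funext => x.
pose Y' : {RV P >-> 'cV[R]_p} := mfun_Sub (mem_set mY).
pose Z' : {RV Q >-> 'cV[R]_p} := mfun_Sub (mem_set mZ).
have mfx : measurable_fun setT (fun y => f (x + y)%R).
  by apply: measurableT_comp => //; exact: measurable_cV_add.
rewrite /conve -(ge0_integral_distribution Y' mfx)// -(ge0_integral_distribution Z' mfx)//.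
by apply: eq_measure_integral => A mA _; first [exact: YZ|exact/esym/YZ].
Qed.

Lemma conve_indep d (T : measurableType d) (P : probability T R)
    (Y Z : T -> 'cV[R]_p) f :
  measurable_fun setT Y -> measurable_fun setT Z ->
  (forall D F, measurable D -> measurable F ->
    P (Y @^-1` D `&` Z @^-1` F) = P (Y @^-1` D) * P (Z @^-1` F)) ->
  measurable_fun setT f -> (forall x, 0 <= f x) ->
  conve P (fun w => Y w + Z w)%R f = conve P Y (conve P Z f).
Proof.
move=> mY mZ iYZ mf f0; apply/funext => x.
pose Y' : {RV P >-> 'cV[R]_p} := mfun_Sub (mem_set mY).
pose Z' : {RV P >-> 'cV[R]_p} := mfun_Sub (mem_set mZ).
have := @ge0_indep_integral _ T R P _ _ _ _ Y' Z'
  (fun z => f (x + (z.1 + z.2))%R) iYZ.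
rewrite /conve => ->//=.
  by apply: eq_integral => w _; apply: eq_integral => w' _; rewrite addrA.
apply: measurableT_comp => //; apply: measurable_cV_add => //.
exact: measurable_add_cV.
Qed.

Section iteration.
Context d (T : measurableType d) (P : probability T R) (Y : T -> 'cV[R]_p).
Context d' (T' : measurableType d') (Q : probability T' R) (Z : T' -> 'cV[R]_p).
Hypothesis mY : measurable_fun setT Y.
Hypothesis mZ : measurable_fun setT Z.
Implicit Types f g : 'cV[R]_p -> \bar R.

Lemma measurable_iter_conve n f : measurable_fun setT f -> (forall x, 0 <= f x) ->
  measurable_fun setT (iter n (conve P Y) f) /\
  forall x, 0 <= iter n (conve P Y) f x.
Proof.
move=> mf f0; elim: n => //= n [mn n0]; split; first exact: measurable_conve.
exact: conve_ge0.
Qed.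

Lemma iter_conveC n f : measurable_fun setT f -> (forall x, 0 <= f x) ->
  iter n (conve P Y) (conve Q Z f) = conve Q Z (iter n (conve P Y) f).
Proof.
move=> mf f0; elim: n => //= n ->; rewrite conveC//.
- by case: (measurable_iter_conve n mf f0).
- by case: (measurable_iter_conve n mf f0).
Qed.

End iteration.

(* Replacing one factor of the convolution power at a time; since all the
   convolutions commute, the error is always incurred on [f] itself. *)
Lemma lindeberg_le d (T : measurableType d) (P : probability T R) (Y : T -> 'cV[R]_p)
    d' (T' : measurableType d') (Q : probability T' R) (Z : T' -> 'cV[R]_p)
    (f : 'cV[R]_p -> \bar R) (e : R) :
  measurable_fun setT Y -> measurable_fun setT Z ->
  measurable_fun setT f -> (forall x, 0 <= f x) -> (0 <= e)%R ->
  (forall x, conve P Y f x <= conve Q Z f x + e%:E) ->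
  forall n x, iter n (conve P Y) f x <= iter n (conve Q Z) f x + (n%:R * e)%:E.
Proof.
move=> mY mZ mf f0 e0 fe; elim=> [x|n ih x]; first by rewrite mul0r adde0.
have [mn n0] := measurable_iter_conve Q mZ n mf f0.
have [mn' n0'] := measurable_iter_conve P mY n mf f0.
rewrite iterS.
apply: (@le_trans _ _ (conve P Y (fun y => iter n (conve Q Z) f y + (n%:R * e)%:E) x)).
  apply: le_conve => //; apply: emeasurable_funD => //.
rewrite conveD_cst//; last by rewrite mulr_ge0.
rewrite -iter_conveC// iterSr.
rewrite mulrSr mulrDl mul1r EFinD addeA -[leRHS]addeAC leeD2r//.
have ne : (0 <= n%:R * e)%R by rewrite mulr_ge0.
have step : forall m y, iter m (conve Q Z) (conve P Y f) y <=
    iter m (conve Q Z) (conve Q Z f) y + e%:E.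
  elim=> [|m ihm y]; first exact: fe.
  have mPf := measurable_conve P mY mf f0.
  have Pf0 := conve_ge0 P Y f0.
  have mQf := measurable_conve Q mZ mf f0.
  have Qf0 := conve_ge0 Q Z f0.
  have [m1 p1] := measurable_iter_conve Q mZ m mPf Pf0.
  have [m2 p2] := measurable_iter_conve Q mZ m mQf Qf0.
  rewrite !iterS -conveD_cst//.
  by apply: le_conve => //; apply: emeasurable_funD.
exact: step.
Qed.

End convolution.

(** * Standard normal variables *)

Section standard_normal.
Context (R : realType).
Local Notation mu := (@lebesgue_measure R).
Local Notation N := (@normal_prob R 0 1).
Local Notation phi := (@normal_pdf R 0 1).
Implicit Type h : R -> \bar R.

Lemma integral_std_normal h : measurable_fun setT h -> (forall x, (0 <= h x)%E) ->
  (\int[N]_x h x = \int[mu]_x (h x * (phi x)%:E))%E.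
Proof.
move=> mh h0.
have dom := @normal_prob_dominates R 0 1.
rewrite -(Radon_Nikodym_SigmaFinite.change_of_variables dom)//=.
have mRN : measurable_fun setT (Radon_Nikodym_SigmaFinite.f N mu).
  exact: (measurable_int mu (Radon_Nikodym_SigmaFinite.f_integrable dom)).
have mphi : measurable_fun setT (fun x => (phi x)%:E).
  by apply/measurable_EFinP; exact: measurable_normal_pdf.
apply: ae_eq_integral => //.
- exact: emeasurable_funM.
- exact: emeasurable_funM.
- apply: ae_eqe_mul2l; apply: integral_ae_eq => //=.
    exact: Radon_Nikodym_SigmaFinite.f_integrable.
  by move=> E _ mE; rewrite -Radon_Nikodym_SigmaFinite.f_integral.
Qed.

(** By uniqueness of Lebesgue measure: the pushforward under the affine map, scaled by [|a|], is
    right on half-open intervals. For negative [a] the preimage of such an interval is closed at its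
    other end, hence the two cases. *)
Lemma lebesgue_affine (a b : R) h : a != 0 -> measurable_fun setT h ->
  (forall x, (0 <= h x)%E) ->
  (\int[mu]_x h x = (`|a|%R)%:E * \int[mu]_x h (a * x + b)%R)%E.
Proof.
move=> a0 mh h0.
have mf : measurable_fun setT (fun x : measurableTypeR R => a * x + b : measurableTypeR R).
  by apply: measurable_funD => //; apply: measurable_funM.
pose m := mscale (NngNum (normr_ge0 a))
  (measure_function_pushforward__canonical__measure_function_Measure mu mf).
have mE A : measurable A -> mu A = m A.
  apply: lebesgue_measure_unique => _ [[u v] _ <-] /=.
  rewrite /m /mscale /= /pushforward /=.
  move: a0; rewrite neq_lt => /orP[a0|a0].
  - rewrite (_ : _ @^-1` _ = `[(v - b) / a, (u - b) / a[%classic); last first.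
      apply/seteqP; split => x /=; rewrite !in_itv/= ?ler_ndivrMr ?ltr_ndivlMr//;
        rewrite ltrBlDr lerBrDr andbC mulrC//.
    rewrite !lebesgue_measure_itv/= !lte_fin ltr_nM2r ?invr_lt0// ltrD2r.
    case: ifPn => uv; rewrite ?mule0//.
    rewrite -!EFinD -EFinM; congr EFin; rewrite ltr0_norm//; field.
    by rewrite lt_eqF.
  - rewrite (_ : _ @^-1` _ = `](u - b) / a, (v - b) / a]%classic); last first.
      apply/seteqP; split => x /=; rewrite !in_itv/= ?ler_pdivlMr ?ltr_pdivrMr//;
        rewrite ltrBlDr lerBrDr mulrC//.
    rewrite !lebesgue_measure_itv/= !lte_fin ltr_pM2r ?invr_gt0// ltrD2r.
    case: ifPn => uv; rewrite ?mule0//.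
    rewrite -!EFinD -EFinM; congr EFin; rewrite gtr0_norm//; field.
    by rewrite gt_eqF.
rewrite (@eq_measure_integral _ _ _ _ m); last by move=> A mA _; exact/mE.
rewrite ge0_integral_mscale//; congr *%E.
by rewrite ge0_integral_pushforward.
Qed.

Lemma std_normal_pdfE x : phi x = normal_peak 1 * expR (- x ^+ 2 / 2).
Proof. by rewrite normal_pdfE// /normal_fun subr0 expr1n. Qed.

(* Completing the square: the joint density of [(u, z)] where
   [r u = s z + t z'] splits into the marginal of [u] and the conditional law
   of [z]. *)
Lemma std_normal_pdf_split (s t r u z : R) : 0 < s -> 0 < t -> 0 < r ->
  r ^+ 2 = s ^+ 2 + t ^+ 2 ->
  r / t * (phi z * phi (r / t * u - s / t * z)) =
  phi u * normal_pdf (s * u / r) (t / r) z.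
Proof.
move=> s0 t0 r0 rst; rewrite !std_normal_pdfE normal_pdfE ?gt_eqF ?divr_gt0// /normal_fun.
have peak : r / t * normal_peak 1 = normal_peak (t / r).
  rewrite /normal_peak -mulrnAr -[in RHS]mulrnAr [in RHS]sqrtrM ?sqr_ge0//.
  by rewrite sqrtr_sqr gtr0_norm ?divr_gt0// invfM invf_div expr1n mul1r.
rewrite -peak.
rewrite [LHS](_ : _ = normal_peak 1 * (r / t * normal_peak 1) *
  (expR (- z ^+ 2 / 2) * expR (- (r / t * u - s / t * z) ^+ 2 / 2))); last by ring.
rewrite [RHS](_ : _ = normal_peak 1 * (r / t * normal_peak 1) *
  (expR (- u ^+ 2 / 2) * expR (- (z - s * u / r) ^+ 2 / ((t / r) ^+ 2 *+ 2)))); last by ring.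
congr (_ * _); rewrite -!expRD; congr expR.
have r2 : s ^+ 2 = r ^+ 2 - t ^+ 2 by rewrite rst addrK.
have rn0 : r != 0 by rewrite gt_eqF.
have tn0 : t != 0 by rewrite gt_eqF.
rewrite -mulr_natr.
rewrite [LHS](_ : _ = - ((t ^+ 2 + s ^+ 2) * z ^+ 2 - 2 * r * s * u * z + r ^+ 2 * u ^+ 2)
   / (2 * t ^+ 2)); last by field.
rewrite [RHS](_ : _ = - (r ^+ 2 * z ^+ 2 - 2 * r * s * u * z + (t ^+ 2 + s ^+ 2) * u ^+ 2)
   / (2 * t ^+ 2)); last by field; rewrite rn0 tn0.
by rewrite (addrC (t ^+ 2)) -rst.
Qed.

(** For fixed [z] substitute [z' = r/t u - s/t z], so that [s z + t z' = r u]. The density then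
    splits by [std_normal_pdf_split], and after exchanging the integrals the conditional density of
    [z] integrates to 1. *)
Lemma std_normal_stable h (s t r : R) : 0 < s -> 0 < t -> 0 < r ->
  r ^+ 2 = s ^+ 2 + t ^+ 2 ->
  measurable_fun setT h -> (forall x, (0 <= h x)%E) ->
  (\int[N]_z \int[N]_z' h (s * z + t * z')%R = \int[N]_z h (r * z)%R)%E.
Proof.
move=> s0 t0 r0 rst mh h0.
have rt0 : 0 < r / t by rewrite divr_gt0.
have mphi : measurable_fun setT (fun x => (phi x)%:E).
  by apply/measurable_EFinP; exact: measurable_normal_pdf.
have mlin (a b : R) : measurable_fun setT (fun x : R => a * x + b).
  by apply: measurable_funD => //; exact: measurable_funM.
have mhlin (a b : R) : measurable_fun setT (fun x : R => h (a * x + b)).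
  by apply: measurableT_comp => //; exact: mlin.
have phi0 x : (0 <= (phi x)%:E)%E by rewrite lee_fin normal_pdf_ge0.
pose F (z u : R) := (h (r * u)%R * (phi u * normal_pdf (s * u / r) (t / r) z)%:E)%E.
have mF : measurable_fun setT (fun zu : R * R => F zu.1 zu.2).
  apply: emeasurable_funM.
    apply: (measurableT_comp mh); apply: measurable_funM => //.
  rewrite (_ : (fun x => _) = (fun zu : R * R =>
      (r / t * (phi zu.1 * phi (r / t * zu.2 - s / t * zu.1)))%:E)); last first.
    by apply/funext => -[z u] /=; rewrite std_normal_pdf_split.
  apply/measurable_EFinP; apply: measurable_funM => //; apply: measurable_funM.
    exact: (measurableT_comp (measurable_normal_pdf _ _) measurable_fst).
  apply: (measurableT_comp (measurable_normal_pdf _ _)).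
  by apply: measurable_funB; apply: measurable_funM.
have F0 zu : (0 <= F zu.1 zu.2)%E.
  by rewrite /F mule_ge0// lee_fin mulr_ge0// normal_pdf_ge0.
transitivity (\int[mu]_z \int[mu]_u F z u)%E.
  rewrite integral_std_normal//; last 2 first.
  - apply: (measurable_fun_fubini_tonelli_F (m2 := N)
      (fun z : R * R => h (s * z.1 + t * z.2)%R)) => //.
    apply: (measurableT_comp mh).
    by apply: measurable_funD; apply: measurable_funM.
  - by move=> x; apply: integral_ge0.
  apply: eq_integral => z _.
  have mhz : measurable_fun setT (fun z' => h (s * z + t * z')).
    by under eq_fun do rewrite addrC; exact: mhlin.
  rewrite integral_std_normal//.
  rewrite (lebesgue_affine (a := r / t) (- (s / t * z)))//; last 3 first.
  - by rewrite gt_eqF.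
  - by apply: emeasurable_funM.
  - by move=> x; rewrite mule_ge0.
  rewrite gtr0_norm// muleC muleA -ge0_integralZl//; last 3 first.
  - apply: emeasurable_funM.
      exact: (measurableT_comp mhz (mlin _ _)).
    exact: (measurableT_comp mphi (mlin _ _)).
  - by move=> x _; rewrite mule_ge0.
  - by rewrite mule_ge0// lee_fin ltW.
  apply: eq_integral => u _.
  rewrite /F -std_normal_pdf_split// muleA -muleA muleC.
  rewrite (_ : s * z + t * (r / t * u - s / t * z) = r * u); last first.
    by field; rewrite gt_eqF.
  rewrite -muleA; congr (_ * _)%E; rewrite -!EFinM; congr EFin; ring.
rewrite (fubini_tonelli (m1 := mu) (m2 := mu) (fun zu : R * R => F zu.1 zu.2))//=.
rewrite [RHS]integral_std_normal//; last first.
  by apply: measurableT_comp => //; exact: measurable_funM.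
apply: eq_integral => u _; rewrite /F.
under eq_integral do rewrite EFinM muleA.
rewrite ge0_integralZl//.
- by rewrite integral_normal_pdf mule1.
- by apply/measurable_EFinP; exact: measurable_normal_pdf.
- by move=> x _; rewrite lee_fin normal_pdf_ge0.
- by rewrite mule_ge0.
Qed.

Lemma std_normal_mgf t :
  (\int[N]_z (expR (t * z))%:E = (expR (t ^+ 2 / 2))%:E)%E.
Proof.
have me : measurable_fun setT (fun z => (expR (t * z))%:E).
  by apply/measurable_EFinP; apply: measurableT_comp => //; apply: measurable_funM.
rewrite (integral_std_normal me); last by move=> x; rewrite lee_fin expR_ge0.
transitivity (\int[mu]_z ((expR (t ^+ 2 / 2))%:E * (normal_pdf t 1 z)%:E))%E.
  apply: eq_integral => z _; rewrite -!EFinM; congr EFin.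
  rewrite std_normal_pdfE normal_pdfE// /normal_fun mulrCA [RHS]mulrCA.
  by congr (_ * _); rewrite -!expRD; congr expR; rewrite expr1n -mulr_natr; field.
rewrite ge0_integralZl//.
- by rewrite integral_normal_pdf mule1.
- by apply/measurable_EFinP; exact: measurable_normal_pdf.
- by move=> x _; rewrite lee_fin normal_pdf_ge0.
Qed.

Lemma integrable_std_normal_exp t :
  N.-integrable setT (fun z => (expR (t * z))%:E).
Proof.
apply/integrableP; split.
  by apply/measurable_EFinP; apply: measurableT_comp => //; apply: measurable_funM.
under eq_integral do rewrite gee0_abs ?lee_fin ?expR_ge0//.
by rewrite std_normal_mgf ltry.
Qed.

Lemma expR_quotient_cvg (x : R) (u : nat -> R) : (forall n, u n != 0) ->
  u n @[n --> \oo] --> 0 -> (expR (x * u n) - 1) / u n @[n --> \oo] --> x.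
Proof.
move=> u0 cu.
have df : is_derive (0 : R) 1 (fun y => expR (x * y)) x.
  apply: is_derive_eq.
  by rewrite mulr0 expR0 mul1r /GRing.scale/= mulr1.
have := @derive_val _ _ _ _ _ _ _ df.
have /= := @ex_derive _ _ _ _ _ _ _ df.
rewrite /derivable /derive => /[swap] dE /cvg_ex[l cl].
have lx : l = x by rewrite -dE; apply/esym/cvg_lim.
move: cl; rewrite lx => /cvgr_dnbhsP/(_ u)/(_ (conj u0 cu)).
apply: cvg_trans; apply: near_eq_cvg; apply: nearW => n /=.
by rewrite addr0 mulr0 expR0 [_ *: 1]mulr1 [LHS]mulrC.
Qed.

(** The square of [2^(n+1) sinh(z / 2^(n+1))], which decreases to [z^2]. Its mean is explicit from
    the moment generating function and [qexp 0] dominates, so the second moment follows by dominated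
    convergence instead of an integration by parts. *)
Let qexp n (z : R) : R :=
  (2 ^+ n * (expR (z / 2 ^+ n.+1) - expR (- (z / 2 ^+ n.+1)))) ^+ 2.

Let qexpE n z : qexp n z =
  4 ^+ n * (expR ((2 ^+ n)^-1 * z) + expR (- (2 ^+ n)^-1 * z) - 2).
Proof.
rewrite /qexp exprMn -exprM mulnC exprM -[2 ^+ 2]/(2 * 2 : R) -natrM.
congr (_ * _); set h := z / _.
have -> : (2 ^+ n)^-1 * z = h + h.
  by rewrite /h exprS; field; rewrite expf_neq0.
have -> : - (2 ^+ n)^-1 * z = - h + - h.
  by rewrite /h exprS; field; rewrite expf_neq0.
rewrite !expRD expRN; field.
by rewrite expR_eq0.
Qed.

(** Double angle formula for sinh: the left side gains the factor cosh squared, which is at least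
    1. *)
Let qexp_le n z : qexp n.+1 z <= qexp n z.
Proof.
rewrite /qexp; set h := z / 2 ^+ n.+2.
have -> : z / 2 ^+ n.+1 = h + h.
  by rewrite /h !exprS; field; rewrite expf_neq0.
rewrite !opprD !expRD expRN; set a := expR h.
have a0 : 0 < a by exact: expR_gt0.
have -> : 2 ^+ n * (a * a - a^-1 * a^-1) = (a + a^-1) / 2 * (2 ^+ n.+1 * (a - a^-1)).
  by rewrite exprS; field; rewrite gt_eqF.
rewrite [leRHS]exprMn ler_peMl ?sqr_ge0// exprn_ege1//.
rewrite ler_pdivlMr// mul1r -subr_ge0.
have -> : a + a^-1 - 2 = (a - 1) ^+ 2 / a by field; rewrite gt_eqF.
by rewrite divr_ge0 ?sqr_ge0// ltW.
Qed.

Let qexp_cvg z : qexp n z @[n --> \oo] --> z ^+ 2.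
Proof.
have u0 n : (2 ^+ n.+1 : R)^-1 != 0 by rewrite invr_eq0 expf_neq0.
have cu : (2 ^+ n.+1 : R)^-1 @[n --> \oo] --> 0.
  rewrite (_ : (fun n => _) = (fun n => (2^-1 : R) ^+ n.+1)); last first.
    by apply/funext => n; rewrite exprVn.
  rewrite (cvg_shiftS (fun n => (2^-1 : R) ^+ n)).
  by apply: cvg_expr; rewrite ger0_norm ?invr_ge0// invf_lt1// ltr1n.
have c1 := expR_quotient_cvg (x := z) u0 cu.
have c2 := expR_quotient_cvg (x := - z) u0 cu.
have c3 : (expR (z * (2 ^+ n.+1)^-1) - 1) / (2 ^+ n.+1)^-1 -
  (expR (- z * (2 ^+ n.+1)^-1) - 1) / (2 ^+ n.+1)^-1 @[n --> \oo] --> z - - z.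
  by apply: cvgB.
have c4 : 2^-1 * ((expR (z * (2 ^+ n.+1)^-1) - 1) / (2 ^+ n.+1)^-1 -
  (expR (- z * (2 ^+ n.+1)^-1) - 1) / (2 ^+ n.+1)^-1) @[n --> \oo] --> 2^-1 * (z - - z).
  by apply: cvgM => //; exact: cvg_cst.
have -> : z ^+ 2 = (2^-1 * (z - - z)) * (2^-1 * (z - - z)) by field.
rewrite (_ : qexp ^~ z = (fun n => (2^-1 * ((expR (z * (2 ^+ n.+1)^-1) - 1) / (2 ^+ n.+1)^-1 -
  (expR (- z * (2 ^+ n.+1)^-1) - 1) / (2 ^+ n.+1)^-1)) * (2^-1 * ((expR (z * (2 ^+ n.+1)^-1) - 1) / (2 ^+ n.+1)^-1 -
  (expR (- z * (2 ^+ n.+1)^-1) - 1) / (2 ^+ n.+1)^-1)))); last first.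
  apply/funext => n; rewrite /qexp expr2 mulNr invrK.
  by congr (_ * _); rewrite exprS; field.
by apply: cvgM.
Qed.

Let integrable_qexp n : N.-integrable setT (EFin \o qexp n) /\
  (\int[N]_z (qexp n z)%:E = (4 ^+ n * (2 * expR ((4 ^+ n)^-1 / 2) - 2))%:E)%E.
Proof.
have i1 := integrable_std_normal_exp (2 ^+ n)^-1.
have i2 := integrable_std_normal_exp (- (2 ^+ n)^-1).
have i3 : N.-integrable setT (fun=> (2 : R)%:E).
  by apply: finite_measure_integrable_cst.
have i12 := integrableD measurableT i1 i2.
have i123 := integrableB measurableT i12 i3.
have qE : (fun z => (qexp n z)%:E) = (fun z => (4 ^+ n)%:E * (((expR ((2 ^+ n)^-1 * z))%:E +
   (expR (- (2 ^+ n)^-1 * z))%:E) - 2%:E))%E.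
  by apply/funext => z; rewrite qexpE.
split.
  rewrite /comp qE; exact: integrableZl.
rewrite qE integralZl// integralB// integralD// !std_normal_mgf.
rewrite integral_cst//= probability_setT mule1 sqrrN exprVn -exprM mulnC exprM.
rewrite -[2 ^+ 2]/(2 * 2 : R) -natrM.
apply: (congr1 EFin (x := 4 ^+ n * (expR (4 ^- n / 2) + expR (4 ^- n / 2) - 2))).
by rewrite mulr_natl mulr2n.
Qed.

Lemma std_normal_moment2 : N.-integrable setT (fun z => (z ^+ 2)%:E) /\
  (\int[N]_z (z ^+ 2)%:E = 1)%E.
Proof.
have mq n : measurable_fun setT (EFin \o qexp n).
  by case: (integrable_qexp n) => /measurable_int.
have [] := @dominated_convergence _ _ _ N setT measurableT (fun n => EFin \o qexp n)
  (fun z => (z ^+ 2)%:E) (EFin \o qexp 0) mq.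
- by apply/measurable_EFinP; exact: measurable_funX.
- apply: aeW => z _; apply: cvg_EFin; first by apply: nearW.
  exact: qexp_cvg.
- by case: (integrable_qexp 0).
- apply: aeW => z n _; rewrite /= lee_fin ger0_norm ?sqr_ge0//.
  by elim: n => // n; apply: le_trans; exact: qexp_le.
move=> iz2 _ cv; split => //.
apply: (cvg_unique _ cv) => //.
(* The mean of [qexp n] is a difference quotient of exp at 0 with step [4^-n / 2], hence tends to
   1. *)
rewrite (_ : [sequence _]_n = (fun n =>
  ((expR (1 * ((4 ^+ n)^-1 / 2)) - 1) / ((4 ^+ n)^-1 / 2))%:E)); last first.
  apply/funext => n; rewrite /= (integrable_qexp n).2; congr EFin; rewrite mul1r; field.
  by rewrite expf_neq0.
apply: cvg_EFin; first exact: nearW.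
apply: expR_quotient_cvg => [n|].
  by rewrite mulf_neq0// ?invr_eq0 ?expf_neq0.
rewrite -(mul0r (2^-1)); apply: cvgM; last exact: cvg_cst.
rewrite (_ : (fun n => _) = (fun n => (4^-1 : R) ^+ n)); last first.
  by apply/funext => n; rewrite exprVn.
by apply: cvg_expr; rewrite ger0_norm ?invr_ge0// invf_lt1// ltr1n.
Qed.

Lemma std_normal_sym h : measurable_fun setT h -> (forall x, (0 <= h x)%E) ->
  (\int[N]_z h (- z)%R = \int[N]_z h z)%E.
Proof.
move=> mh h0.
have mphi : measurable_fun setT (fun x => (phi x)%:E).
  by apply/measurable_EFinP; exact: measurable_normal_pdf.
rewrite integral_std_normal//; last exact: measurableT_comp.
rewrite [RHS]integral_std_normal//.
rewrite [RHS](lebesgue_affine 0 (a := -1)) ?oppr_eq0//.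
- rewrite normrN1 mul1e; apply: eq_integral => x _.
  by rewrite addr0 mulN1r !std_normal_pdfE sqrrN.
- exact: emeasurable_funM.
- by move=> x; rewrite mule_ge0// lee_fin normal_pdf_ge0.
Qed.

Lemma std_normal_moment1 : N.-integrable setT (fun z => z%:E) /\
  (\int[N]_z z%:E = 0)%E.
Proof.
have [iz2 _] := std_normal_moment2.
have iz : N.-integrable setT (fun z => z%:E).
  apply: (@le_integrable _ _ _ N _ measurableT _ (fun z => (z ^+ 2)%:E + 1%:E)%E).
  - by apply/measurable_EFinP.
  - move=> z _; rewrite /= lee_fin [leRHS]ger0_norm; last by rewrite addr_ge0// sqr_ge0.
    have [z1|z1] := leP `|z| 1; first by rewrite (le_trans z1)// lerDr sqr_ge0.
    rewrite -real_normK ?num_real// expr2 ler_wpDr//.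
    by rewrite ler_peMl// ltW.
  - apply: integrableD => //; exact: finite_measure_integrable_cst.
split=> //.
rewrite integralE.
have -> : (\int[N]_x ((fun z : R => z%:E)^\- x) = \int[N]_x ((fun z : R => z%:E)^\+ x))%E.
  rewrite -(std_normal_sym (h := (fun z : R => z%:E)^\+%E)).
  - by apply: eq_integral => z _; rewrite funeneg.unlock funepos.unlock.
  - by apply: measurable_funepos; apply/measurable_EFinP.
  - by move=> x; exact: funepos_ge0.
rewrite subee// integrable_pos_fin_num//.
Qed.

End standard_normal.

(** * Lindeberg's replacement argument *)

Section smooth_test_functions.
Context (R : realType).

(** The cube makes the second derivative Lipschitz, just enough for a cubic Taylor remainder. Below,
    [bump1] is the derivative and [bump2] half the second derivative. *)
Definition bumpf (s : R) : R := (Num.max 0 (1 - s ^+ 2)) ^+ 3.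
Let bump1 (s : R) : R := - 6 * s * (Num.max 0 (1 - s ^+ 2)) ^+ 2.
Let bump2 (s : R) : R := - 3 * (Num.max 0 (1 - s ^+ 2)) ^+ 2
  + 12 * s ^+ 2 * Num.max 0 (1 - s ^+ 2).

(** A step that leaves the support must have length comparable to [1 - s^2]; every term of the
    expansion is then of cubic order in [z]. *)
Let crossing (s z : R) : s ^+ 2 <= 1 -> 1 <= (s + z) ^+ 2 ->
  1 - s ^+ 2 <= 3 * `|z|.
Proof.
move=> s1 sz1.
have [z1|z1] := leP `|z| 1; last first.
  by rewrite (@le_trans _ _ 1)// ?gerBl ?sqr_ge0//; have := ltW z1; lra.
have s1' : `|s| <= 1 by rewrite -(@expr_le1 _ 2)// real_normK ?num_real.
rewrite (@le_trans _ _ ((s + z) ^+ 2 - s ^+ 2))// ?lerB//.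
rewrite (_ : _ - _ = (2 * s + z) * z); last by ring.
rewrite (le_trans (ler_norm _))// normrM ler_wpM2r//.
rewrite (le_trans (ler_normD _ _))// normrM ger0_norm//.
by move: s1' z1; lra.
Qed.

Lemma bump_ge0 s : 0 <= bumpf s.
Proof. by rewrite exprn_ge0// le_max lexx. Qed.

Lemma bump_le1 s : bumpf s <= 1.
Proof.
rewrite exprn_ile1// ?le_max ?lexx// ge_max ler01/=.
by rewrite gerBl sqr_ge0.
Qed.

Lemma bump_gt0 s : `|s| < 1 -> 0 < bumpf s.
Proof.
move=> s1; rewrite exprn_gt0// lt_max subr_gt0 -(real_normK (num_real s)).
by rewrite expr_lt1 ?s1 ?orbT.
Qed.

Lemma bump_neq0 s : bumpf s != 0 -> `|s| < 1.
Proof.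
rewrite expf_eq0/= => m0; rewrite -(@expr_lt1 _ 2)// real_normK ?num_real//.
rewrite ltNge; apply: contra m0 => s1; apply/eqP/max_idPl.
by rewrite subr_le0.
Qed.

Let bump_in (s : R) : s ^+ 2 <= 1 -> Num.max 0 (1 - s ^+ 2) = 1 - s ^+ 2.
Proof. by move=> s1; apply/max_idPr; rewrite subr_ge0. Qed.

Let bump_out (s : R) : 1 <= s ^+ 2 -> Num.max 0 (1 - s ^+ 2) = 0.
Proof. by move=> s1; apply/max_idPl; rewrite subr_le0. Qed.

Lemma normM_le (x y a b : R) :
  `|x|%R <= a -> `|y|%R <= b -> `|x * y|%R <= a * b.
Proof. by move=> xa yb; rewrite normrM ler_pM. Qed.

Let sqr_norm1 (s : R) : s ^+ 2 <= 1 -> `|s| <= 1.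
Proof. by move=> s1; rewrite -(@expr_le1 _ 2)// real_normK ?num_real. Qed.

Let bump12_le s : `|bump1 s| <= 6 /\ `|bump2 s| <= 15.
Proof.
rewrite /bump1 /bump2; have [s1|s1] := leP (s ^+ 2) 1; last first.
  by rewrite (bump_out (ltW s1)) expr0n/= !mulr0 addr0 normr0; split; lra.
rewrite bump_in//; have s2 := sqr_ge0 s; have := sqr_norm1 s1.
move: s1 s2; set q := s ^+ 2 => q1 q0 s1; split.
  rewrite -[6 in leRHS]mulr1; apply: normM_le.
    by rewrite normrM normrN (ger0_norm (ler0n _ 6)) ler_piMr.
  by rewrite ger0_norm ?exprn_ge0 ?exprn_ile1 ?subr_ge0// gerBl.
by rewrite ler_norml; apply/andP; split; nra.
Qed.

Lemma bump_taylor : exists b1 b2 : R -> R, exists2 M : R, 0 <= M &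
  (forall s, `|b1 s| <= M /\ `|b2 s| <= M) /\
  forall s z, `|bumpf (s + z) - bumpf s - b1 s * z - b2 s * z ^+ 2| <= M * `|z| ^+ 3.
Proof.
(* The constant is [27 + 54 + 9 + 36], the sum of the four terms when [s] is inside the support and
   [s + z] outside; the other cases need less. *)
exists bump1, bump2, 126 => //; split.
  move=> s; have [h1 h2] := bump12_le s.
  by split; [apply: le_trans h1 _|apply: le_trans h2 _]; lra.
move=> s z; rewrite /bumpf /bump1 /bump2.
have [s1|s1] := leP (s ^+ 2) 1; have [sz1|sz1] := leP ((s + z) ^+ 2) 1.
- rewrite !bump_in//.
  have s1' := sqr_norm1 s1; have sz1' := sqr_norm1 sz1.
  rewrite [X in `|X|](_ : _ = (3 * (1 - s ^+ 2) * (3 * s + (s + z)) -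
     (s + (s + z)) ^+ 3) * z ^+ 3); last by ring.
  rewrite normrM normrX ler_wpM2r// (le_trans (ler_normB _ _))//.
  have -> : (126 : R) = 12 + 114 by ring.
  apply: lerD.
    rewrite (_ : 12 = (3 * 1) * (3 * 1 + 1)); last by ring.
    apply: normM_le; first apply: normM_le.
    + by rewrite ger0_norm.
    + by rewrite ger0_norm ?subr_ge0// gerBl sqr_ge0.
    + rewrite (le_trans (ler_normD _ _))// lerD// normM_le//.
      by rewrite ger0_norm.
  rewrite normrX (@le_trans _ _ (2 ^+ 3))//; last by lra.
  rewrite lerXn2r ?nnegrE// (le_trans (ler_normD _ _))//.
  by move: s1' sz1'; lra.
- rewrite (bump_in s1) (bump_out (ltW sz1)).
  have c := crossing s1 (ltW sz1); have s1' := sqr_norm1 s1.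
  have m1 : 1 - s ^+ 2 <= 1 by rewrite gerBl sqr_ge0.
  have m0 : 0 <= 1 - s ^+ 2 by rewrite subr_ge0.
  have q0 := sqr_ge0 s.
  move: c m1 m0; set m := 1 - s ^+ 2 => c m1 m0.
  rewrite expr0n/= sub0r.
  have -> : - m ^+ 3 - - 6 * s * m ^+ 2 * z - (- 3 * m ^+ 2 + 12 * s ^+ 2 * m) * z ^+ 2
     = - m ^+ 3 + (6 * s * z * m ^+ 2 + (3 * m ^+ 2 * z ^+ 2 - 12 * s ^+ 2 * m * z ^+ 2)) by ring.
  rewrite (_ : 126 * _ = 27 * `|z| ^+ 3 + (54 * `|z| ^+ 3 + (9 * `|z| ^+ 3 + 36 * `|z| ^+ 3))); last by ring.
  have t0 := normr_ge0 z; have z2 : z ^+ 2 = `|z| ^+ 2 by rewrite real_normK ?num_real.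
  have m2 : m ^+ 2 <= 9 * `|z| ^+ 2.
    by rewrite (_ : 9 * _ = (3 * `|z|) ^+ 2) ?lerXn2r ?nnegrE ?mulr_ge0//; ring.
  apply: le_trans (ler_normD _ _) _; apply: lerD.
    rewrite normrN ger0_norm ?exprn_ge0//.
    by rewrite (_ : 27 * _ = (3 * `|z|) ^+ 3) ?lerXn2r ?nnegrE ?mulr_ge0//; ring.
  apply: le_trans (ler_normD _ _) _; apply: lerD.
    rewrite normrM (ger0_norm (exprn_ge0 2 m0)) !normrM (ger0_norm (ler0n _ 6)).
    rewrite (_ : 54 * _ = 6 * 1 * `|z| * (9 * `|z| ^+ 2)); last by ring.
    by rewrite ler_pM ?(sqr_ge0, mulr_ge0)// ler_wpM2r// ler_wpM2l.
  apply: le_trans (ler_normB _ _) _; apply: lerD.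
    rewrite z2 ger0_norm ?(sqr_ge0, mulr_ge0)// exprS -!mulrA [leRHS](_ : _ = 3 * (3 * `|z| * `|z| ^+ 2)); last by ring.
    rewrite ler_wpM2l// mulrA ler_wpM2r ?sqr_ge0//.
    by rewrite (le_trans _ c)// expr1 ler_piMr.
  rewrite z2 ger0_norm ?(sqr_ge0, mulr_ge0)//.
  rewrite [leRHS](_ : _ = 12 * 1 * (3 * `|z|) * `|z| ^+ 2); last by ring.
  rewrite ler_wpM2r ?sqr_ge0//; apply: ler_pM => //; first by rewrite mulr_ge0.
  by rewrite ler_wpM2l.
- rewrite (bump_out (ltW s1)) (bump_in sz1) !expr0n/= !mulr0 !mul0r addr0 mul0r !subr0.
  (* Only the value at [s + z] survives here, and the crossing bound is read backwards from that
     point. *)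
  have := @crossing (s + z) (- z) sz1; rewrite addrK normrN => /(_ (ltW s1)) c.
  have m0 : 0 <= 1 - (s + z) ^+ 2 by rewrite subr_ge0.
  rewrite ger0_norm ?exprn_ge0// (@le_trans _ _ ((3 * `|z|) ^+ 3))//.
    by rewrite lerXn2r ?nnegrE ?mulr_ge0.
  by rewrite exprMn ler_wpM2r ?exprn_ge0//; lra.
- rewrite (bump_out (ltW s1)) (bump_out (ltW sz1)) !expr0n/= !mulr0 !mul0r addr0 mul0r !subr0.
  by rewrite normr0 mulr_ge0 ?exprn_ge0.
Qed.

End smooth_test_functions.

(** * Functions with uniform second-order Taylor expansions *)

Section taylor2.
Context (R : realType) (p : nat).
Implicit Types (f g : 'cV[R]_p -> R) (x y D : 'cV[R]_p) (H : 'M[R]_p).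

Definition lin D y : R := \sum_i D i 0 * y i 0.
(** There is no factor one half: [H] stands for half the Hessian. *)
Definition quad H y : R := \sum_i \sum_j H i j * (y i 0 * y j 0).

Lemma lin_le D y M : 0 <= M -> (forall i, `|D i 0| <= M) ->
  `|lin D y| <= p%:R * M * `|y|.
Proof.
move=> M0 DM; rewrite (le_trans (ler_norm_sum _ _ _))//.
rewrite -mulrA mulr_natl -[X in _ *+ X]card_ord -sumr_const.
by apply: ler_sum => i _; rewrite normM_le// coord_le_norm.
Qed.

Lemma quad_le H y M : 0 <= M -> (forall i j, `|H i j| <= M) ->
  `|quad H y| <= p%:R * p%:R * M * `|y| ^+ 2.
Proof.
move=> M0 HM; rewrite (le_trans (ler_norm_sum _ _ _))//.
rewrite -!mulrA mulr_natl -[X in _ *+ X]card_ord -sumr_const.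
apply: ler_sum => i _; rewrite (le_trans (ler_norm_sum _ _ _))//.
rewrite mulr_natl -[X in _ *+ X]card_ord -sumr_const.
by apply: ler_sum => j _; rewrite expr2; do !apply: normM_le => //; exact: coord_le_norm.
Qed.

(* Stating the expansion rather than bounds on derivatives makes stability
   under products plain algebra. *)
Definition taylor2 f := exists D : 'cV[R]_p -> 'cV[R]_p,
  exists H : 'cV[R]_p -> 'M[R]_p, exists2 M : R, 0 <= M &
  forall x, [/\ `|f x| <= M, forall i, `|D x i 0| <= M,
    forall i j, `|H x i j| <= M &
    forall y, `|y| <= 1 ->
      `|f (x + y) - (f x + lin (D x) y + quad (H x) y)| <= M * `|y| ^+ 3].

Lemma taylor2_cst (c : R) : taylor2 (fun=> c).
Proof.
exists (fun=> 0), (fun=> 0), `|c| => // x; split => //.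
- by move=> i; rewrite mxE normr0.
- by move=> i j; rewrite mxE normr0.
- move=> y _; rewrite /lin /quad !big1 ?addr0 ?subrr ?normr0 ?mulr_ge0 ?exprn_ge0//.
    by move=> i _; rewrite big1// => j _; rewrite mxE mul0r.
  by move=> i _; rewrite mxE mul0r.
Qed.

(** The letters are terms of order 0 to 3 in [t]. Of the sixteen products, ten have total order at
    least 3, and each is at most [K^2 t^3] because [t <= 1]. *)
Let mul_remainder (a u q r b v s w K t : R) : 0 <= K -> 0 <= t <= 1 ->
  `|a| <= K -> `|u| <= K * t -> `|q| <= K * t ^+ 2 -> `|r| <= K * t ^+ 3 ->
  `|b| <= K -> `|v| <= K * t -> `|s| <= K * t ^+ 2 -> `|w| <= K * t ^+ 3 ->
  `|(a + u + q + r) * (b + v + s + w) -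
    (a * b + (a * v + b * u) + (a * s + u * v + b * q))| <= 10 * K ^+ 2 * t ^+ 3.
Proof.
move=> K0 /andP[t0 t1] ha hu hq hr hb hv hs hw.
have le m n (x y : R) : (3 <= m + n)%N -> `|x| <= K * t ^+ m -> `|y| <= K * t ^+ n ->
    `|x * y| <= K ^+ 2 * t ^+ 3.
  move=> mn xm yn; apply: (le_trans (normM_le xm yn)).
  rewrite mulrACA -expr2 -exprD ler_wpM2l ?exprn_ge0//.
  by rewrite ler_wiXn2l.
rewrite -(expr1 t) in hu hv; rewrite -(mulr1 K) -(expr0 t) in ha hb.
rewrite [X in `|X|](_ : _ = a * w + (u * s + (u * w + (q * v + (q * s + (q * w +
  (r * b + (r * v + (r * s + r * w))))))))); last by ring.
rewrite (_ : 10 * K ^+ 2 * t ^+ 3 = K ^+ 2 * t ^+ 3 + (K ^+ 2 * t ^+ 3 +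
  (K ^+ 2 * t ^+ 3 + (K ^+ 2 * t ^+ 3 + (K ^+ 2 * t ^+ 3 + (K ^+ 2 * t ^+ 3 +
  (K ^+ 2 * t ^+ 3 + (K ^+ 2 * t ^+ 3 + (K ^+ 2 * t ^+ 3 + K ^+ 2 * t ^+ 3)))))))));
  last by ring.
have ler2 (x y c d : R) : `|x| <= c -> `|y| <= d -> `|x + y| <= c + d.
  by move=> xc yd; rewrite (le_trans (ler_normD _ _))// lerD.
apply: (ler2); first exact: (le 0%N 3%N _ _ isT ha hw).
apply: (ler2); first exact: (le 1%N 2%N _ _ isT hu hs).
apply: (ler2); first exact: (le 1%N 3%N _ _ isT hu hw).
apply: (ler2); first exact: (le 2%N 1%N _ _ isT hq hv).
apply: (ler2); first exact: (le 2%N 2%N _ _ isT hq hs).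
apply: (ler2); first exact: (le 2%N 3%N _ _ isT hq hw).
apply: (ler2); first exact: (le 3%N 0%N _ _ isT hr hb).
apply: (ler2); first exact: (le 3%N 1%N _ _ isT hr hv).
apply: (ler2); first exact: (le 3%N 2%N _ _ isT hr hs).
exact: (le 3%N 3%N _ _ isT hr hw).
Qed.

Lemma taylor2M f g : taylor2 f -> taylor2 g -> taylor2 (fun x => f x * g x).
Proof.
move=> [D [H [M M0 fP]]] [D' [H' [M' M'0 gP]]].
(* Dominates both the factor [p] of [lin_le] and the factor [p * p] of [quad_le]. *)
pose c : R := 1 + p%:R * p%:R + p%:R.
pose K := c * (M + M').
have c1 : 1 <= c by rewrite /c -addrA lerDl addr_ge0 ?mulr_ge0.
have K0 : 0 <= K by rewrite mulr_ge0 ?addr_ge0// (le_trans _ c1).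
have cK e m : 0 <= e <= c -> 0 <= m <= M + M' -> e * m <= K.
  by move=> /andP[e0 ec] /andP[m0 mM]; rewrite ler_pM.
have MM : 0 <= M <= M + M' by rewrite M0 lerDl.
have MM' : 0 <= M' <= M + M' by rewrite M'0 lerDr.
have c0 : 0 <= (1 : R) <= c by rewrite ler01 c1.
have cp : 0 <= (p%:R : R) <= c by rewrite ler0n /c lerDr addr_ge0 ?mulr_ge0.
have cpp : 0 <= (p%:R * p%:R : R) <= c.
  by rewrite mulr_ge0//= /c addrAC lerDr addr_ge0.
have MK : M <= K by rewrite -(mul1r M) cK.
have MK' : M' <= K by rewrite -(mul1r M') cK.
exists (fun x => f x *: D' x + g x *: D x).
exists (fun x => \matrix_(i, j) (f x * H' x i j + D x i 0 * D' x j 0 + g x * H x i j)).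
have KK : K ^+ 2 <= 10 * K ^+ 2 by rewrite ler_peMl ?exprn_ge0//; lra.
have KK2 : K ^+ 2 + K ^+ 2 <= 10 * K ^+ 2.
  by have := exprn_ge0 2 K0; move: (K ^+ 2) => ? ?; lra.
have KK3 : K ^+ 2 + K ^+ 2 + K ^+ 2 <= 10 * K ^+ 2.
  by have := exprn_ge0 2 K0; move: (K ^+ 2) => ? ?; lra.
have KM (x y : R) : `|x| <= K -> `|y| <= K -> `|x * y| <= K ^+ 2.
  by move=> xK yK; rewrite expr2 normM_le.
exists (10 * K ^+ 2) => [|x]; first by rewrite mulr_ge0 ?exprn_ge0.
have [fM DM HM fx] := fP x; have [gM DM' HM' gx] := gP x.
have fK := le_trans fM MK; have gK := le_trans gM MK'.
have DK i := le_trans (DM i) MK; have DK' i := le_trans (DM' i) MK'.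
have HK i j := le_trans (HM i j) MK; have HK' i j := le_trans (HM' i j) MK'.
split.
- by rewrite (le_trans _ KK)// KM.
- move=> i; rewrite !mxE (le_trans _ KK2)// (le_trans (ler_normD _ _))//.
  by rewrite lerD// KM.
- move=> i j; rewrite !mxE (le_trans _ KK3)// (le_trans (ler_normD _ _))//.
  rewrite lerD ?KM// (le_trans (ler_normD _ _))//.
  by rewrite lerD// KM.
move=> y y1; have y0 := normr_ge0 y.
have := @mul_remainder (f x) (lin (D x) y) (quad (H x) y)
  (f (x + y) - (f x + lin (D x) y + quad (H x) y))
  (g x) (lin (D' x) y) (quad (H' x) y)
  (g (x + y) - (g x + lin (D' x) y + quad (H' x) y)) K `|y| K0.
rewrite y0 y1 !subrKC => /(_ isT fK).
have le1 : `|lin (D x) y| <= K * `|y|.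
  by rewrite (le_trans (lin_le _ M0 _))// ler_wpM2r// cK.
have le2 : `|lin (D' x) y| <= K * `|y|.
  by rewrite (le_trans (lin_le _ M'0 _))// ler_wpM2r// cK.
have le3 : `|quad (H x) y| <= K * `|y| ^+ 2.
  by rewrite (le_trans (quad_le _ M0 _))// ler_wpM2r ?exprn_ge0// cK.
have le4 : `|quad (H' x) y| <= K * `|y| ^+ 2.
  by rewrite (le_trans (quad_le _ M'0 _))// ler_wpM2r ?exprn_ge0// cK.
move=> /(_ le1 le3) /(_ (le_trans (fx _ y1) (ler_wpM2r (exprn_ge0 3 y0) MK))).
move=> /(_ gK le2 le4 (le_trans (gx _ y1) (ler_wpM2r (exprn_ge0 3 y0) MK'))).
congr (`|_ - (_ + _ + _)| <= _).
- rewrite /lin !mulr_sumr -big_split/=; apply: eq_bigr => i _.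
  by rewrite !mxE; ring.
- rewrite /lin big_distrlr /= /quad !mulr_sumr -!big_split/=; apply: eq_bigr => i _.
  rewrite !mulr_sumr -!big_split/=; apply: eq_bigr => j _.
  by rewrite !mxE; ring.
Qed.

Lemma taylor2_onem f : taylor2 f -> taylor2 (fun x => 1 - f x).
Proof.
move=> [D [H [M M0 fP]]]; exists (fun x => - D x), (fun x => - H x), (1 + M).
  by rewrite addr_ge0.
move=> x; have [fM DM HM fx] := fP x.
have M1 : M <= 1 + M by rewrite lerDr.
split.
- by rewrite (le_trans (ler_normB _ _))// normr1 lerD2l.
- by move=> i; rewrite mxE normrN (le_trans _ M1).
- by move=> i j; rewrite mxE normrN (le_trans _ M1).
move=> y y1; rewrite (le_trans _ (ler_wpM2r (exprn_ge0 3 (normr_ge0 y)) M1))//.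
rewrite (le_trans _ (fx y y1))// -[leRHS]normrN.
rewrite [X in _ <= `|X|](_ : _ = 1 - f (x + y) - (1 - f x + lin (- D x) y + quad (- H x) y))//.
have -> : lin (- D x) y = - lin (D x) y.
  by rewrite /lin -sumrN; apply: eq_bigr => i _; rewrite mxE mulNr.
have -> : quad (- H x) y = - quad (H x) y.
  rewrite /quad -sumrN; apply: eq_bigr => i _; rewrite -sumrN; apply: eq_bigr => j _.
  by rewrite mxE mulNr.
ring.
Qed.

Lemma taylor2_prod (I : Type) (s : seq I) (F : I -> 'cV[R]_p -> R) :
  (forall i, taylor2 (F i)) -> taylor2 (fun x => \prod_(i <- s) F i x).
Proof.
move=> tF; elim: s => [|i s ih].
  by under eq_fun do rewrite big_nil; exact: taylor2_cst.
by under eq_fun do rewrite big_cons; exact: taylor2M.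
Qed.

Lemma taylor2_bump (i : 'I_p) (k c : R) : taylor2 (fun x => bumpf (k * (x i 0 - c))).
Proof.
have [b1 [b2 [M M0 [bM bP]]]] := bump_taylor R.
have k0 := normr_ge0 k.
pose K := 1 + M + M * `|k| + M * `|k| ^+ 2 + M * `|k| ^+ 3.
have [h1 h2 h3] : [/\ 0 <= M * `|k|, 0 <= M * `|k| ^+ 2 & 0 <= M * `|k| ^+ 3].
  by rewrite !mulr_ge0 ?exprn_ge0.
exists (fun x => \col_j (if j == i then b1 (k * (x i 0 - c)) * k else 0)).
exists (fun x => \matrix_(j, l) (if (j == i) && (l == i)
  then b2 (k * (x i 0 - c)) * k ^+ 2 else 0)).
exists K => [|x]; first by rewrite /K; lra.
have [b1M b2M] := bM (k * (x i 0 - c)).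
split.
- rewrite ger0_norm ?bump_ge0// (le_trans (bump_le1 _))// /K; lra.
- move=> j; rewrite mxE; case: eqP => _; last by rewrite normr0 /K; lra.
  by rewrite normrM (@le_trans _ _ (M * `|k|)) ?ler_wpM2r// /K; lra.
- move=> j l; rewrite mxE; case: ifP => _; last by rewrite normr0 /K; lra.
  by rewrite normrM normrX (@le_trans _ _ (M * `|k| ^+ 2)) ?ler_wpM2r ?exprn_ge0// /K; lra.
move=> y _.
rewrite /lin (bigD1 i)//= big1 ?addr0; last first.
  by move=> j /negPf ji; rewrite mxE ji mul0r.
rewrite /quad (bigD1 i)//= [X in _ + (_ + X)]big1 ?addr0; last first.
  by move=> j /negPf ji; rewrite big1// => l _; rewrite mxE ji/= mul0r.
rewrite (bigD1 i)//= [X in _ + (_ + X)]big1 ?addr0; last first.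
  by move=> j /negPf ji; rewrite mxE ji andbF mul0r.
rewrite !mxE eqxx/=.
have := bP (k * (x i 0 - c)) (k * y i 0).
rewrite -mulrDr (_ : x i 0 - c + y i 0 = x i 0 + y i 0 - c); last by ring.
set b := bumpf _; set b' := bumpf _ => h.
rewrite [X in `|X|](_ : _ = b - b' - b1 (k * (x i 0 - c)) * (k * y i 0) -
  b2 (k * (x i 0 - c)) * (k * y i 0) ^+ 2); last by ring.
apply: (le_trans h); rewrite normrM exprMn mulrA ler_pM ?mulr_ge0 ?exprn_ge0//.
  by rewrite /K; lra.
by rewrite lerXn2r ?nnegrE// coord_le_norm.
Qed.

End taylor2.

(** * One replacement step and the total error of n of them *)

Section lindeberg.
Context (R : realType) (p : nat).
Implicit Types (x y D : 'cV[R]_p) (H : 'M[R]_p).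

(** Of order [r + 1] near 0 but only of order [r] at infinity, hence integrable under a moment of
    order [r] alone. *)
Definition rho (r : nat) y : R := `|y| ^+ r * Num.min 1 `|y|.

Lemma rho_ge0 r y : 0 <= rho r y.
Proof. by rewrite mulr_ge0 ?exprn_ge0// le_min ler01/=. Qed.

Lemma measurable_norm_cV d (T : measurableType d) (Y : T -> 'cV[R]_p) :
  measurable_fun setT Y -> measurable_fun setT (fun w => `|Y w|).
Proof.
move=> mY; apply: (measurableT_comp _ mY).
by apply: continuous_cV_measurable => x; exact: norm_continuous.
Qed.

Lemma measurable_rho r d (T : measurableType d) (Y : T -> 'cV[R]_p) :
  measurable_fun setT Y -> measurable_fun setT (fun w => rho r (Y w)).
Proof.
move=> /measurable_norm_cV mY; apply: measurable_funM.
  exact: measurable_funX.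
exact: measurable_minr.
Qed.

(** The order [r] selects what the two laws must share: means for [r = 1], means and second moments
    for [r = 2]. *)
Definition tpoly (r : nat) D H y : R :=
  lin D y + (if r == 2%N then quad H y else 0).

(** Where [|y| > 1], boundedness of [f] and of the coefficients suffices: [K] collects 2 for two
    values of [f], then [p] and [p * p] for the linear and quadratic parts. Elsewhere the cubic
    remainder is used, and for [r = 1] the quadratic part joins the error. *)
Lemma taylor2_tpoly r (f : 'cV[R]_p -> R) : (0 < r <= 2)%N -> taylor2 f ->
  exists2 M : R, 0 <= M & forall x, exists D H, forall y,
    `|f (x + y) - (f x + tpoly r D H y)| <= M * rho r y.
Proof.
move=> r12 [D [H [M M0 fP]]].
pose K : R := 2 + p%:R + p%:R * p%:R.
have p0 : (0 : R) <= p%:R by [].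
have pp0 : (0 : R) <= p%:R * p%:R by rewrite mulr_ge0.
exists (K * M) => [|x]; first by rewrite mulr_ge0// /K; lra.
exists (D x), (H x) => y.
have [fM DM HM fx] := fP x; have [fM' _ _ _] := fP (x + y).
have t0 := normr_ge0 y.
have l1 := lin_le y M0 DM; have q1 := quad_le y M0 HM.
have far : 1 < `|y| -> `|f (x + y) - (f x + tpoly r (D x) (H x) y)| <= K * M * rho r y.
  move=> y1; have y1' := ltW y1; rewrite /rho min_l// mulr1.
  rewrite (le_trans (ler_normB _ _))//.
  rewrite (@le_trans _ _ (M + (M + (p%:R * M * `|y| ^+ r + p%:R * p%:R * M * `|y| ^+ r))))//.
    rewrite lerD// (le_trans (ler_normD _ _))// lerD// (le_trans (ler_normD _ _))// lerD//.
      rewrite (le_trans l1)// ler_wpM2l ?mulr_ge0// -[leLHS]expr1.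
      by rewrite ler_weXn2l//; case/andP: r12.
    case: eqP => [->//|_]; rewrite normr0 mulr_ge0 ?exprn_ge0//.
    by rewrite mulr_ge0.
  have yr1 : 1 <= `|y| ^+ r by rewrite exprn_ege1.
  have MMr : M <= M * `|y| ^+ r by rewrite ler_peMr.
  rewrite (_ : K * M * `|y| ^+ r = M * `|y| ^+ r + (M * `|y| ^+ r +
     (p%:R * M * `|y| ^+ r + p%:R * p%:R * M * `|y| ^+ r))); last by rewrite /K; ring.
  by rewrite lerD// lerD.
have [y1|/far//] := leP `|y| 1.
rewrite /rho min_r// -exprSr.
have K1 : M <= K * M by rewrite ler_peMl// /K; lra.
have fy := fx _ y1.
move: r12 => /andP[r0]; rewrite leq_eqVlt => /predU1P[->|]; last first.
  rewrite ltnS leq_eqVlt ltnNge r0 orbF => /eqP r1.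
  rewrite /tpoly r1/= addr0.
  rewrite (_ : _ - _ = (f (x + y) - (f x + lin (D x) y + quad (H x) y)) + quad (H x) y); last by ring.
  rewrite (le_trans (ler_normD _ _))//.
  rewrite (@le_trans _ _ ((1 + p%:R * p%:R) * M * `|y| ^+ 2))//.
    rewrite mulrDl mul1r mulrDl lerD// (le_trans fy)// ler_wpM2l//.
    by rewrite exprS ler_piMl// sqr_ge0.
  by rewrite !ler_wpM2r ?exprn_ge0// /K; lra.
rewrite /tpoly/= addrA (le_trans fy)//.
by rewrite ler_wpM2r ?exprn_ge0.
Qed.

Section compare.
Context d (T : measurableType d) (P : probability T R) (Y : T -> 'cV[R]_p).
Context d' (T' : measurableType d') (Q : probability T' R) (Z : T' -> 'cV[R]_p).
Hypothesis mY : measurable_fun setT Y.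
Hypothesis mZ : measurable_fun setT Z.

(** The approximation [A] has the same mean under both laws, so passing through it costs only the
    two mean remainders. *)
Lemma conve_compare (f A e : 'cV[R]_p -> R) (M : R) x :
  measurable_fun setT f -> (forall y, 0 <= f y) -> 0 <= M ->
  (forall y, 0 <= e y) -> (forall y, `|f (x + y) - A y| <= M * e y) ->
  P.-integrable setT (EFin \o (A \o Y)) -> Q.-integrable setT (EFin \o (A \o Z)) ->
  P.-integrable setT (EFin \o (e \o Y)) -> Q.-integrable setT (EFin \o (e \o Z)) ->
  (\int[P]_w (A (Y w))%:E = \int[Q]_w (A (Z w))%:E)%E ->
  (conve P Y (EFin \o f) x <= conve Q Z (EFin \o f) x +
   (M * (fine (\int[P]_w (e (Y w))%:E) + fine (\int[Q]_w (e (Z w))%:E)))%:E)%E.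
Proof.
move=> mf f0 M0 e0 fA iAY iAZ ieY ieZ AYZ.
have eYf := integrable_fin_num measurableT ieY.
have eZf := integrable_fin_num measurableT ieZ.
have iMY : P.-integrable setT (fun w => M%:E * (e (Y w))%:E)%E by exact: integrableZl.
have iMZ : Q.-integrable setT (fun w => M%:E * (e (Z w))%:E)%E by exact: integrableZl.
have hZ : Q.-integrable setT (fun w => (f (x + Z w))%:E).
  apply: (le_integrable measurableT _ _ (integrableD measurableT (integrable_abse iAZ) iMZ)).
    apply/measurable_EFinP; apply: (measurableT_comp mf).
    exact: measurable_cV_add.
  move=> w _ /=; rewrite lee_fin.
  rewrite [leRHS]ger0_norm ?addr_ge0 ?mulr_ge0//.
  rewrite -[X in `|X|](subrK (A (Z w))) (le_trans (ler_normD _ _))// [leRHS]addrC lerD2r.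
  exact: fA.
have leY : (conve P Y (EFin \o f) x <= \int[P]_w ((A (Y w))%:E + M%:E * (e (Y w))%:E))%E.
  apply: ge0_le_integral => //.
  - by move=> w _; rewrite lee_fin.
  - by apply/measurable_EFinP; apply: (measurableT_comp mf); exact: measurable_cV_add.
  - by apply: (measurable_int P); exact: integrableD.
  - move=> w _; rewrite -EFinM -EFinD lee_fin -lerBlDl.
    exact: le_trans (ler_norm _) (fA _).
apply: (le_trans leY).
rewrite integralD// integralZl// AYZ mulrDr EFinD !EFinM !fineK//.
rewrite addeA addeAC leeD2r// -integralZl//.
rewrite /conve -integralD//.
apply: le_integral => //; first exact: integrableD.
move=> w _ /=; rewrite lee_fin -lerBlDl.
by rewrite (le_trans (ler_norm _))// distrC.
Qed.

End compare.

(** The factor n is absorbed by [s n ^+ r]; what is left, [|Y|^r min(1, s n |Y|)], is dominated by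
    [|Y|^r] and tends to 0 pointwise. *)
Lemma rho_rate (r : nat) d (T : measurableType d) (P : probability T R)
    (Y : T -> 'cV[R]_p) (s : nat -> R) :
  measurable_fun setT Y ->
  P.-integrable setT (fun w => (`|Y w| ^+ r)%:E) ->
  (forall n, 0 <= s n) -> s n @[n --> \oo] --> 0 ->
  (forall n, n%:R * s n ^+ r <= 1) ->
  (forall n, P.-integrable setT (fun w => (rho r (s n *: Y w))%:E)) /\
  n%:R * fine (\int[P]_w (rho r (s n *: Y w))%:E) @[n --> \oo] --> 0.
Proof.
move=> mY iY s0 cs sr.
have msY n : measurable_fun setT (fun w => s n *: Y w).
  exact: measurable_cV_scale.
have mYr := measurable_norm_cV mY.
have irho n : P.-integrable setT (fun w => (rho r (s n *: Y w))%:E).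
  apply: (le_integrable measurableT _ _ (integrableZl measurableT (s n ^+ r) iY)).
    by apply/measurable_EFinP; exact: measurable_rho.
  move=> w _; rewrite /= lee_fin !ger0_norm ?rho_ge0 ?mulr_ge0 ?exprn_ge0//.
  by rewrite /rho mx_normZ (ger0_norm (s0 n)) exprMn ler_piMr ?mulr_ge0 ?exprn_ge0// ge_min lexx.
split=> //.
pose g n w : R := `|Y w| ^+ r * Num.min 1 (s n * `|Y w|).
have g0 n w : 0 <= g n w.
  by rewrite mulr_ge0 ?exprn_ge0// le_min ler01 mulr_ge0.
have mg n : measurable_fun setT (EFin \o g n).
  apply/measurable_EFinP; apply: measurable_funM; first exact: measurable_funX.
  by apply: measurable_minr => //; exact: measurable_funM.
have [] := @dominated_convergence _ _ _ P setT measurableT (fun n => EFin \o g n)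
  (fun=> 0%E) (fun w => (`|Y w| ^+ r)%:E) mg.
- exact: measurable_cst.
- apply: aeW => w _; apply: cvg_EFin; first exact: nearW.
  apply: (@squeeze_cvgr _ _ _ _ (fun=> 0) (fun n => `|Y w| ^+ r * (s n * `|Y w|))).
  + by apply: nearW => n; rewrite g0/= ler_wpM2l ?exprn_ge0// ge_min lexx orbT.
  + exact: cvg_cst.
  + rewrite -[X in _ --> X](mulr0 (`|Y w| ^+ r)); apply: cvgM; first exact: cvg_cst.
    by rewrite -[X in _ --> X](mul0r `|Y w|); apply: cvgM => //; exact: cvg_cst.
- exact: iY.
- apply: aeW => w n _; rewrite /= lee_fin ger0_norm//.
  by rewrite ler_piMr ?exprn_ge0// ge_min lexx.
move=> _ _; rewrite integral0 => cg.
have ig n : P.-integrable setT (EFin \o g n).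
  apply: (le_integrable measurableT _ _ iY) => // w _.
  rewrite /= lee_fin !ger0_norm ?exprn_ge0//.
  by rewrite ler_piMr ?exprn_ge0// ge_min lexx.
have /fine_cvgP[_ cg'] := cg.
apply: (@squeeze_cvgr _ _ _ _ (fun=> 0) _ _ _ _ _ cg'); last exact: cvg_cst.
apply: nearW => n /=; rewrite mulr_ge0/= ?fine_ge0 ?integral_ge0//; last first.
  by move=> w _; rewrite lee_fin rho_ge0.
rewrite -lee_fin EFinM !fineK ?integrable_fin_num//.
have mr : measurable_fun setT (fun w => (rho r (s n *: Y w))%:E).
  by apply/measurable_EFinP; exact: measurable_rho.
have r0 w : [set: T] w -> (0 <= (rho r (s n *: Y w))%:E)%E.
  by rewrite lee_fin rho_ge0.
rewrite -(ge0_integralZl P measurableT mr r0) ?lee_fin//.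
apply: ge0_le_integral => //.
- by move=> w _; rewrite -EFinM lee_fin mulr_ge0// rho_ge0.
- by apply: emeasurable_funM => //; apply/measurable_EFinP; exact: measurable_rho.
- exact: mg.
- move=> w _; rewrite -EFinM lee_fin /rho mx_normZ (ger0_norm (s0 n)) exprMn !mulrA.
  rewrite ler_wpM2r ?le_min ?ler01 ?mulr_ge0//.
  by rewrite ler_piMl// exprn_ge0.
exact: ig.
Qed.

(** The replacing law is one whose n-fold scaled sum does not depend on n, which is why its iterates
    equal a constant [c]. Replacement in both directions squeezes the iterates of [Y] around [c]. *)
Lemma lindeberg_cvg (r : nat) d (T : measurableType d) (P : probability T R)
    (Y : T -> 'cV[R]_p) d' (T' : measurableType d') (Q : probability T' R)
    (Z : T' -> 'cV[R]_p) (s : nat -> R) (f : 'cV[R]_p -> R) (c : R) :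
  (0 < r <= 2)%N -> measurable_fun setT Y -> measurable_fun setT Z ->
  P.-integrable setT (fun w => (`|Y w| ^+ r)%:E) ->
  Q.-integrable setT (fun w => (`|Z w| ^+ r)%:E) ->
  (forall D H, [/\ P.-integrable setT (fun w => (tpoly r D H (Y w))%:E),
     Q.-integrable setT (fun w => (tpoly r D H (Z w))%:E) &
     (\int[P]_w (tpoly r D H (Y w))%:E = \int[Q]_w (tpoly r D H (Z w))%:E)%E]) ->
  (forall n, 0 <= s n) -> s n @[n --> \oo] --> 0 ->
  (forall n, n%:R * s n ^+ r <= 1) ->
  taylor2 f -> measurable_fun setT f -> (forall x, 0 <= f x) ->
  (forall n, (0 < n)%N ->
     iter n (conve Q (fun w => s n *: Z w)) (EFin \o f) 0 = c%:E) ->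
  iter n (conve P (fun w => s n *: Y w)) (EFin \o f) 0 @[n --> \oo] --> c%:E.
Proof.
move=> r12 mY mZ iY iZ match_ s0 cs sr tf mf f0 fc.
have [iYr cY] := rho_rate mY iY s0 cs sr.
have [iZr cZ] := rho_rate mZ iZ s0 cs sr.
have msY n : measurable_fun setT (fun w => s n *: Y w) by exact: measurable_cV_scale.
have msZ n : measurable_fun setT (fun w => s n *: Z w) by exact: measurable_cV_scale.
have [M M0 fM] := taylor2_tpoly r12 tf.
have mF : measurable_fun setT (EFin \o f) by exact/measurable_EFinP.
have F0 x : (0 <= (EFin \o f) x)%E by rewrite lee_fin.
pose eY n := fine (\int[P]_w (rho r (s n *: Y w))%:E).
pose eZ n := fine (\int[Q]_w (rho r (s n *: Z w))%:E).
have eY0 n : 0 <= eY n.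
  by rewrite fine_ge0// integral_ge0// => w _; rewrite lee_fin rho_ge0.
have eZ0 n : 0 <= eZ n.
  by rewrite fine_ge0// integral_ge0// => w _; rewrite lee_fin rho_ge0.
(* The scale moves into the coefficients, so that moment matching of the unscaled vectors
   applies. *)
have tpolyZ D H (k : R) y : tpoly r D H (k *: y) = tpoly r (k *: D) (k ^+ 2 *: H) y.
  rewrite /tpoly /lin /quad; congr (_ + _).
    by apply: eq_bigr => i _; rewrite !mxE mulrCA mulrA.
  case: ifP => // _; apply: eq_bigr => i _; apply: eq_bigr => j _.
  by rewrite !mxE; ring.
have cmp n x :
    (conve P (fun w => s n *: Y w) (EFin \o f) x <=
     conve Q (fun w => s n *: Z w) (EFin \o f) x + (M * (eY n + eZ n))%:E /\
     conve Q (fun w => s n *: Z w) (EFin \o f) x <=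
     conve P (fun w => s n *: Y w) (EFin \o f) x + (M * (eY n + eZ n))%:E)%E.
  have [D [H fDH]] := fM x.
  have [m1 m2 m3] := match_ (s n *: D) (s n ^+ 2 *: H).
  pose A y := f x + tpoly r D H y.
  have iA d0 (T0 : measurableType d0) (P0 : probability T0 R) (Y0 : T0 -> 'cV[R]_p) :
     P0.-integrable setT (fun w => (tpoly r (s n *: D) (s n ^+ 2 *: H) (Y0 w))%:E) ->
     P0.-integrable setT (EFin \o (A \o (fun w => s n *: Y0 w))) /\
     (\int[P0]_w (A (s n *: Y0 w))%:E = (f x)%:E +
       \int[P0]_w (tpoly r (s n *: D) (s n ^+ 2 *: H) (Y0 w))%:E)%E.
    move=> i0; have ic : P0.-integrable setT (fun=> (f x)%:E).
      exact: finite_measure_integrable_cst.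
    have -> : EFin \o (A \o (fun w => s n *: Y0 w)) =
        (fun w => (f x)%:E + (tpoly r (s n *: D) (s n ^+ 2 *: H) (Y0 w))%:E)%E.
      by apply/funext => w; rewrite /= /A tpolyZ.
    split; first exact: integrableD.
    under eq_integral do rewrite /A tpolyZ EFinD.
    by rewrite integralD// integral_cst//= probability_setT mule1.
  have [iAY EAY] := iA _ _ _ _ m1; have [iAZ EAZ] := iA _ _ _ _ m2.
  have EA : (\int[P]_w (A (s n *: Y w))%:E = \int[Q]_w (A (s n *: Z w))%:E)%E.
    by rewrite EAY EAZ m3.
  split.
    exact: (conve_compare (msY n) (msZ n) mf f0 M0 (@rho_ge0 r) fDH iAY iAZ (iYr n) (iZr n) EA).
  rewrite (addrC (eY n)).
  exact: (conve_compare (msZ n) (msY n) mf f0 M0 (@rho_ge0 r) fDH iAZ iAY (iZr n) (iYr n) (esym EA)).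
pose e n := n%:R * (M * (eY n + eZ n)).
have ce : e n @[n --> \oo] --> 0.
  rewrite (_ : e = fun n => M * (n%:R * eY n + n%:R * eZ n)); last first.
    by apply/funext => n; rewrite /e mulrCA mulrDr.
  rewrite -[X in _ --> X](mulr0 M) -[X in M * X](addr0 0).
  by apply: cvgM; [exact: cvg_cst|exact: cvgD].
have e0 n : 0 <= M * (eY n + eZ n) by rewrite mulr_ge0// addr_ge0.
have up n : (0 < n)%N -> (iter n (conve P (fun w => s n *: Y w)) (EFin \o f) 0%R <= (c + e n)%:E)%E.
  move=> n0; rewrite EFinD -(fc _ n0); apply: lindeberg_le => // x.
  by case: (cmp n x).
have lo n : (0 < n)%N -> ((c - e n)%:E <= iter n (conve P (fun w => s n *: Y w)) (EFin \o f) 0%R)%E.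
  move=> n0; rewrite EFinB leeBlDr// -(fc _ n0); apply: lindeberg_le => // x.
  by case: (cmp n x).
apply: (@squeeze_cvge _ _ _ _ (fun n => (c - e n)%:E) _ (fun n => (c + e n)%:E)).
- by near=> n; rewrite lo ?up//; near: n; exact: nbhs_infty_gt.
- apply: cvg_EFin; first exact: nearW.
  by rewrite -[X in _ --> X](subr0 c); apply: cvgB => //; exact: cvg_cst.
- apply: cvg_EFin; first exact: nearW.
  by rewrite -[X in _ --> X](addr0 c); apply: cvgD => //; exact: cvg_cst.
Unshelve. all: by end_near.
Qed.

End lindeberg.

(** * Open sets and weak convergence *)

Section portmanteau.
Context (R : realType) (p : nat).
Implicit Types (x : 'cV[R]_p) (U : set 'cV[R]_p).

(** Nonzero exactly on [rbox c], so that sums and products of these functions can detect membership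
    in an open set. *)
Definition box_bump (c : 'cV[rat]_p * nat) x : R :=
  \prod_(i <- enum 'I_p) bumpf ((c.2.+1%:R : R) * (x i 0 - ratr (c.1 i 0))).

Let scaled_lt (k : nat) (z : R) : (`|(k.+1%:R : R) * z| < 1) = (`|z| < k.+1%:R^-1).
Proof. by rewrite normrM ger0_norm// -ltr_pdivlMl ?ltr0n// mulr1. Qed.

Lemma box_bump_gt0 c x : rbox c x -> 0 < box_bump c x.
Proof.
move=> cx; apply: prodr_gt0 => i _; apply: bump_gt0.
by rewrite scaled_lt; exact: cx.
Qed.

Lemma box_bump_neq0 c x : box_bump c x != 0 -> rbox c x.
Proof.
move=> c0 i; rewrite -scaled_lt; apply: bump_neq0; apply: contra c0 => b0.
by rewrite /box_bump (big_rem i) ?mem_enum//= (eqP b0) mul0r.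
Qed.

Lemma box_bump_01 c x : 0 <= box_bump c x <= 1.
Proof.
rewrite prodr_ge0/= => [|i _]; last exact: bump_ge0.
by apply: prodr_ile1 => i _; rewrite bump_ge0 bump_le1.
Qed.

Lemma taylor2_box_bump c : taylor2 (box_bump c).
Proof. by apply: taylor2_prod => i; exact: taylor2_bump. Qed.

Lemma measurable_bump : measurable_fun setT (@bumpf R).
Proof.
apply: measurable_funX; apply: measurable_maxr => //.
by apply: measurable_funB => //; exact: measurable_funX.
Qed.

Lemma measurable_box_bump c : measurable_fun setT (box_bump c).
Proof.
apply: measurable_prod => i _; apply: (measurableT_comp measurable_bump).
apply: measurable_funM => //; apply: measurable_funB => //.
exact: measurable_coord.
Qed.

Variable U : set 'cV[R]_p.
Hypothesis oU : open U.

(** Boxes are enumerated by their codes; a number that codes no box contained in [U] contributes the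
    neutral factor 1. *)
Let void (k : nat) x : R :=
  if pickle_inv k is Some c then
    if `[< rbox (R := R) c `<=` U >] then 1 - box_bump c x else 1
  else 1.

(** Vanishes off [U] and tends to 1 on [U]. The inner product is a power [n]: a bump is merely
    positive on its box, so a single factor [1 - box_bump] need not be small. *)
Let approx (n : nat) x : R :=
  1 - \prod_(k <- iota 0 n) \prod_(j <- iota 0 n) void k x.

Let void01 k x : 0 <= void k x <= 1.
Proof.
rewrite /void; case: pickle_inv => [c|]; last by rewrite ler01 lexx.
case: ifP => _; last by rewrite ler01 lexx.
by have /andP[b0 b1] := box_bump_01 c x; rewrite subr_ge0 b1 gerBl.
Qed.

Let prod01 (s : seq nat) (F : nat -> R) : (forall k, 0 <= F k <= 1) ->
  0 <= \prod_(k <- s) F k <= 1.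
Proof.
move=> F01; rewrite prodr_ge0/= => [|k _]; last by case/andP: (F01 k).
by apply: prodr_ile1 => k _.
Qed.

Let approx01 n x : 0 <= approx n x <= 1.
Proof.
have /andP[h0 h1] : 0 <= \prod_(k <- iota 0 n) \prod_(j <- iota 0 n) void k x <= 1.
  by apply: prod01 => k; exact: prod01.
by rewrite /approx subr_ge0 h1 gerBl.
Qed.

Let void_taylor2 k : taylor2 (void k).
Proof.
rewrite /void; case: pickle_inv => [c|]; last exact: taylor2_cst.
case: (asboolP (rbox c `<=` U)) => _; last exact: taylor2_cst.
by apply: taylor2_onem; exact: taylor2_box_bump.
Qed.

Let approx_taylor2 n : taylor2 (approx n).
Proof.
apply: taylor2_onem; apply: taylor2_prod => k; apply: taylor2_prod => j.
exact: void_taylor2.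
Qed.

Let measurable_void k : measurable_fun setT (void k).
Proof.
rewrite /void; case: pickle_inv => [c|] //.
by case: (asboolP (rbox c `<=` U)) => // _; apply: measurable_funB => //; exact: measurable_box_bump.
Qed.

Let measurable_approx n : measurable_fun setT (approx n).
Proof.
apply: measurable_funB => //; apply: measurable_prod => k _.
by apply: measurable_prod => j _.
Qed.

Let approx_out n x : ~ U x -> approx n x = 0.
Proof.
move=> Ux; rewrite /approx big1 ?subrr// => k _; rewrite big1// => j _.
rewrite /void; case: pickle_inv => [c|] //; case: asboolP => // cU.
have [->|/box_bump_neq0/cU//] := eqVneq (box_bump c x) 0.
by rewrite subr0.
Qed.

Let approx_in x : U x -> approx n x @[n --> \oo] --> (1 : R).
Proof.
move=> Ux; have [c cx cU] := open_rbox oU Ux.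
have b0 := box_bump_gt0 cx; have /andP[_ b1] := box_bump_01 c x.
pose k := pickle c.
have vk : void k x = 1 - box_bump c x.
  by rewrite /void /k pickleK_inv; case: asboolP.
have ub n : (k < n)%N -> \prod_(k <- iota 0 n) \prod_(j <- iota 0 n) void k x <=
    (1 - box_bump c x) ^+ n.
  move=> kn; rewrite (big_rem k) ?mem_iota//= -[leRHS]mulr1.
  have /andP[h0 h1] := @prod01 (rem k (iota 0 n))
    (fun k => \prod_(j <- iota 0 n) void k x) (fun k => prod01 _ (fun=> void01 k x)).
  apply: ler_pM => //; first by case/andP: (prod01 (iota 0 n) (fun=> void01 k x)).
  by rewrite big_const_seq count_predT size_iota iter_mulr_1 vk.
rewrite -[X in _ --> X](subr0 1); apply: cvgB; first exact: cvg_cst.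
apply: (@squeeze_cvgr _ _ _ _ (fun=> 0) (fun n => (1 - box_bump c x) ^+ n)).
- near=> n; rewrite ub ?andbT; last by near: n; exact: nbhs_infty_gt.
  by case/andP: (@prod01 (iota 0 n) (fun k => \prod_(j <- iota 0 n) void k x)
    (fun k => prod01 _ (fun=> void01 k x))).
- exact: cvg_cst.
- by apply: cvg_expr; rewrite ger0_norm ?subr_ge0// gtrBl.
Unshelve. all: by end_near.
Qed.

(** Some fixed [approx n] already has mean above [c] under the limit law; convergence is applied to
    that one test function, which lies below the indicator of [U]. *)
Lemma portmanteau_open d (T : measurableType d) (P : probability T R)
    (S : nat -> T -> 'cV[R]_p) d' (T' : measurableType d')
    (Q : probability T' R) (W : T' -> 'cV[R]_p) (c : R) :
  (forall n, measurable_fun setT (S n)) -> measurable_fun setT W ->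
  (forall f : 'cV[R]_p -> R, taylor2 f -> measurable_fun setT f ->
    (forall x, 0 <= f x <= 1) ->
    (\int[P]_w (f (S n w))%:E @[n --> \oo] --> \int[Q]_w (f (W w))%:E)%E) ->
  (c%:E < Q (W @^-1` U))%E -> \forall n \near \oo, (c%:E < P (S n @^-1` U))%E.
Proof.
move=> mS mW SW cU.
have mU : measurable U by exact: measurable_cV_open.
have mWU : measurable (W @^-1` U) by rewrite -[X in measurable X]setTI; exact: mW.
have mSU n : measurable (S n @^-1` U) by rewrite -[X in measurable X]setTI; exact: mS.
have [] := @dominated_convergence _ _ _ Q setT measurableT
  (fun n w => (approx n (W w))%:E) (fun w => (\1_(W @^-1` U) w)%:E) (fun=> 1%:E).
- by move=> n; apply/measurable_EFinP; exact: measurableT_comp.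
- by apply/measurable_EFinP; exact: measurable_indic.
- apply: aeW => w _; apply: cvg_EFin; first exact: nearW.
  rewrite indicE; case: (boolP (w \in _)); rewrite ?inE ?notin_setE => Uw.
    exact: approx_in.
  by under eq_fun do rewrite approx_out//; exact: cvg_cst.
- exact: finite_measure_integrable_cst.
- by apply: aeW => w n _; rewrite /= lee_fin; case/andP: (approx01 n (W w)) => ? ?; rewrite ger0_norm.
move=> _ _; rewrite integral_indic// setIT => cv.
have [n cn] : exists n, (c%:E < \int[Q]_w (approx n (W w))%:E)%E.
  have h := cv [set x | (c%:E < x)%E].
  have : \forall n \near \oo, (c%:E < \int[Q]_w (approx n (W w))%:E)%E.
    by apply: h; apply: open_nbhs_nbhs; split => //; exact: open_ereal_gt_ereal.
  by move=> [n _ /(_ n (leqnn n)) ?]; exists n.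
have := SW _ (approx_taylor2 n) (measurable_approx n) (approx01 n).
move=> /(_ [set x | (c%:E < x)%E]) h.
have {}h : \forall m \near \oo, (c%:E < \int[P]_w (approx n (S m w))%:E)%E.
  by apply: h; apply: open_nbhs_nbhs; split => //; exact: open_ereal_gt_ereal.
apply: filterS h => m /lt_le_trans; apply.
rewrite -(setIT (S m @^-1` U)) -integral_indic//.
apply: ge0_le_integral => //.
- by move=> w _; rewrite lee_fin; case/andP: (approx01 n (S m w)).
- by apply/measurable_EFinP; apply: measurableT_comp.
- by apply/measurable_EFinP; exact: measurable_indic.
- move=> w _; rewrite lee_fin indicE.
  case: (boolP (w \in _)); rewrite ?inE ?notin_setE => Uw.
    by case/andP: (approx01 n (S m w)).
  by rewrite approx_out.
Qed.

End portmanteau.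

(** * Sums of independent vectors *)

Section independent_sums.
Context (R : realType) (p : nat).
Context d (T : measurableType d) (P : probability T R).

Section family.
Context (I : choiceType) (G : I -> set (set T)) (Y : I -> T -> 'cV[R]_p).
Hypothesis GI : forall i, setI_closed (G i).
Hypothesis GT : forall i, G i setT.
Hypothesis Gm : forall i, G i `<=` measurable.
Hypothesis indG : mutually_independent P G.
Hypothesis YG : forall i A, measurable A -> <<s G i >> (Y i @^-1` A).

Lemma generated_measurable i : <<s G i >> `<=` measurable.
Proof.
apply: smallest_sub; last exact: Gm.
exact: sigma_algebra_measurable.
Qed.

Lemma family_measurable i : measurable_fun setT (Y i).
Proof. by move=> _ A mA; rewrite setTI; apply: generated_measurable; exact: YG. Qed.

Lemma conve_sum (s : seq I) (f : 'cV[R]_p -> \bar R) : uniq s ->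
  measurable_fun setT f -> (forall x, (0 <= f x)%E) ->
  conve P (fun w => \sum_(i <- s) Y i w) f =
  foldr (fun i h => conve P (Y i) h) f s.
Proof.
move=> + mf f0; elim: s => [_|i s ih /=/andP[si us]].
  apply/funext => x; rewrite /conve /=.
  under eq_integral do rewrite big_nil addr0.
  by rewrite integral_cst//= probability_setT mule1.
rewrite -ih//.
have -> : (fun w => \sum_(j <- i :: s) Y j w) =
    (fun w => Y i w + \sum_(j <- s) Y j w).
  by apply/funext => w; rewrite big_cons.
apply: conve_indep => //.
- exact: family_measurable.
- by apply: measurable_cV_sum => j _; exact: family_measurable.
move=> D F mD mF; rewrite setIC muleC.
apply: (block_indep GI GT Gm indG us si); last exact: YG.
(* The sample space is re-equipped with the sigma-algebra of the remaining indices, so that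
   measurability of the partial sum says its events lie in that block. *)
have := @measurable_cV_sum R p _ (g_sigma_algebraType (finite_inters G s)) I s Y.
move=> /(_ _ measurableT F mF); rewrite setTI; apply => j js _ A mA.
rewrite setTI; apply: (sigma_finite_inters GT js); exact: YG.
Qed.

End family.

Lemma preimage_scale (k : R) (Y : T -> 'cV[R]_p) (G : set (set T)) :
  (forall A, measurable A -> <<s G >> (Y @^-1` A)) ->
  forall A, measurable A -> <<s G >> ((fun w => k *: Y w) @^-1` A).
Proof.
move=> YG A mA; rewrite (_ : _ @^-1` A = Y @^-1` ((fun x => k *: x) @^-1` A))//.
apply: YG; rewrite -[X in measurable X]setTI.
by apply: (measurable_cV_scale (s := fun=> k) (f := id)).
Qed.

Lemma conve_sum_iid (G : nat -> set (set T)) (Y : nat -> T -> 'cV[R]_p)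
    (k : R) (f : 'cV[R]_p -> \bar R) n :
  (forall i, setI_closed (G i)) -> (forall i, G i setT) ->
  (forall i, G i `<=` measurable) -> mutually_independent P G ->
  (forall i A, measurable A -> <<s G i >> (Y i @^-1` A)) ->
  (forall i A, measurable A -> P (Y i @^-1` A) = P (Y 0%N @^-1` A)) ->
  measurable_fun setT f -> (forall x, (0 <= f x)%E) ->
  conve P (fun w => k *: \sum_(i < n) Y i w) f =
  iter n (conve P (fun w => k *: Y 0%N w)) f.
Proof.
move=> GI GT Gm indG YG YL mf f0.
pose Y' i w := k *: Y i w.
have Y'G i A : measurable A -> <<s G i >> (Y' i @^-1` A).
  exact: preimage_scale (YG i) A.
have mY' := family_measurable Gm Y'G.
have -> : (fun w => k *: \sum_(i < n) Y i w) = (fun w => \sum_(i <- iota 0 n) Y' i w).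
  by apply/funext => w; rewrite scaler_sumr -(big_mkord xpredT (fun i => k *: Y i w)) /index_iota subn0.
rewrite (conve_sum GI GT Gm indG Y'G (iota_uniq 0 n) mf f0).
have law i g : measurable_fun setT g -> (forall x, (0 <= g x)%E) ->
    conve P (Y' i) g = conve P (Y' 0%N) g.
  move=> mg g0; apply: conve_law => // A mA.
  have mkA : measurable ((fun x : 'cV[R]_p => k *: x) @^-1` A).
    rewrite -[X in measurable X]setTI.
    by apply: (measurable_cV_scale (s := fun=> k) (f := id)).
  exact: (YL i _ mkA).
suff : forall m, foldr (fun i h => conve P (Y' i) h) f (iota m n) =
    iter n (conve P (Y' 0%N)) f by apply.
elim: n => //= n ih m; rewrite ih law//.
- by case: (measurable_iter_conve P (mY' 0%N) n mf f0).
- by case: (measurable_iter_conve P (mY' 0%N) n mf f0).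
Qed.

Section pairs.
Context (X : nat -> {RV P >-> 'cV[R]_p}) (eps : nat -> {RV P >-> R}).
Hypothesis X_iid : iid X.
Hypothesis eps_iid : iid eps.
Hypothesis X_eps_indep : independent_classes P (sigma_seq X) (sigma_seq eps).

(** A pi-system generating the sigma-algebra of the pair of regressor and noise; rectangles are the
    form in which the separate independence hypotheses can be combined. *)
Definition pair_events (i : nat) : set (set T) :=
  [set E | exists A B, [/\ g_sigma_algebra_preimage (X i) A,
    g_sigma_algebra_preimage (eps i) B & E = A `&` B]].

Let preimage_setI d' (T' : measurableType d') (Z : T -> T') :
  setI_closed (g_sigma_algebra_preimage Z).
Proof.
move=> _ _ [A mA <-] [B mB <-]; exists (A `&` B); first exact: measurableI.
by rewrite !setTI.
Qed.

Let preimage_setT d' (T' : measurableType d') (Z : T -> T') :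
  g_sigma_algebra_preimage Z setT.
Proof. by exists setT => //; rewrite setTI. Qed.

Let preimage_measurable d' (T' : measurableType d') (Z : {RV P >-> T'}) :
  g_sigma_algebra_preimage Z `<=` measurable.
Proof. by move=> _ [A mA <-]; exact: measurable_funP. Qed.

Lemma pair_eventsI i : setI_closed (pair_events i).
Proof.
move=> _ _ [A [B [XA eB ->]]] [A' [B' [XA' eB' ->]]].
exists (A `&` A'), (B `&` B'); split; last by rewrite setIACA.
- exact: preimage_setI.
- exact: preimage_setI.
Qed.

Lemma pair_eventsT i : pair_events i setT.
Proof.
by exists setT, setT; split; [exact: preimage_setT|exact: preimage_setT|rewrite setIT].
Qed.

Lemma pair_events_measurable i : pair_events i `<=` measurable.
Proof.
move=> _ [A [B [XA eB ->]]]; apply: measurableI.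
- exact: preimage_measurable XA.
- exact: preimage_measurable eB.
Qed.

Let sigma_seq_preimage d' (T' : measurableType d') (Z : nat -> {RV P >-> T'}) i A :
  g_sigma_algebra_preimage (Z i) A -> sigma_seq Z A.
Proof. by move=> ZA; apply: sub_sigma_algebra; exists i. Qed.

Lemma pair_indep i A B : g_sigma_algebra_preimage (X i) A ->
  g_sigma_algebra_preimage (eps i) B -> P (A `&` B) = (P A * P B)%E.
Proof.
move=> XA eB; apply: X_eps_indep.
- exact: (sigma_seq_preimage XA).
- exact: (sigma_seq_preimage eB).
Qed.

Let sigma_seq_bigcap d' (T' : measurableType d') (Z : nat -> {RV P >-> T'})
    (s : seq nat) (A : nat -> set T) :
  (forall i, i \in s -> g_sigma_algebra_preimage (Z i) (A i)) ->
  sigma_seq Z (\bigcap_(i in [set` s]) A i).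
Proof.
move=> ZA.
have : (forall i, i \in s -> sigma_seq Z (A i)).
  by move=> i si; apply: sigma_seq_preimage; exact: ZA.
rewrite /sigma_seq => {}ZA.
have := @fin_bigcap_measurable _ (g_sigma_algebraType
  (\bigcup_i g_sigma_algebra_preimage (Z i))) nat [set` s] A (finite_seq s).
by apply => i /= si; exact: ZA.
Qed.

(** Independence of the two sequences separates regressors from noise, independence within each
    sequence factors both parts, and the factors are regrouped index by index. *)
Lemma pair_events_mutually_independent : mutually_independent P pair_events.
Proof.
move=> s E us EG.
have /choice[AB ABP] : forall i, exists AB : set T * set T, i \in s ->
    [/\ g_sigma_algebra_preimage (X i) AB.1,
      g_sigma_algebra_preimage (eps i) AB.2 & E i = AB.1 `&` AB.2].
  move=> i; have [si|_] := boolP (i \in s); last by exists (set0, set0).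
  by have [A [B ABE]] := EG i si; exists (A, B).
have -> : \bigcap_(i in [set` s]) E i = (\bigcap_(i in [set` s]) (AB i).1) `&`
    (\bigcap_(i in [set` s]) (AB i).2).
  by rewrite -bigcapI; apply: eq_bigcapr => i /= /ABP[].
rewrite X_eps_indep; last 2 first.
- by apply: sigma_seq_bigcap => i /ABP[].
- by apply: sigma_seq_bigcap => i /ABP[].
rewrite (X_iid.1 s (fun i => (AB i).1) us); last by move=> i /ABP[].
rewrite (eps_iid.1 s (fun i => (AB i).2) us); last by move=> i /ABP[].
rewrite -big_split/= big_seq [RHS]big_seq; apply: eq_bigr => i /ABP[XA eB ->].
by rewrite (pair_indep XA eB).
Qed.

Context (Phi : 'cV[R]_p * R -> 'cV[R]_p).
Hypothesis mPhi : measurable_fun setT Phi.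

Lemma pair_events_preimage i A : measurable A ->
  <<s pair_events i >> ((fun w => Phi (X i w, eps i w)) @^-1` A).
Proof.
move=> mA.
have : @measurable_fun _ _ (g_sigma_algebraType (pair_events i)) _ setT
    (fun w => (X i w, eps i w)).
  apply: measurable_fun_pair => _ B mB; rewrite setTI; apply: sub_sigma_algebra.
  - exists (X i @^-1` B), setT; split; [|exact: preimage_setT|by rewrite setIT].
    by exists B => //; rewrite setTI.
  - exists setT, (eps i @^-1` B); split; [exact: preimage_setT| |by rewrite setTI].
    by exists B => //; rewrite setTI.
move=> /(measurableT_comp mPhi) /(_ measurableT A mA).
by rewrite setTI.
Qed.

Lemma pair_rectangle i A B : measurable A -> measurable B ->
  P (X i @^-1` A `&` eps i @^-1` B) = (P (X i @^-1` A) * P (eps i @^-1` B))%E.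
Proof.
by move=> mA mB; apply: (@pair_indep i); [exists A|exists B] => //; rewrite setTI.
Qed.

(** Independence makes the law of each pair a product measure, determined by its marginals. *)
Lemma pair_law i A : measurable A ->
  P ((fun w => Phi (X i w, eps i w)) @^-1` A) =
  P ((fun w => Phi (X 0%N w, eps 0%N w)) @^-1` A).
Proof.
move=> mA.
have mPA : measurable (Phi @^-1` A) by rewrite -[X in measurable X]setTI; exact: mPhi.
have h j := indep_pushforward (@pair_rectangle j) mPA.
transitivity ((distribution P (X i) \x distribution P (eps i))%E (Phi @^-1` A)).
  by rewrite h.
transitivity ((distribution P (X 0%N) \x distribution P (eps 0%N))%E (Phi @^-1` A)).
  apply: (product_measure_unique (m' :=
    (distribution P (X 0%N) \x distribution P (eps 0%N))%E)) => //.
  move=> D F mD mF.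
  apply: (etrans (product_measure1E (distribution P (X 0%N)) (distribution P (eps 0%N)) mD mF)).
  by congr (_ * _)%E; apply/esym; [exact: X_iid.2|exact: eps_iid.2].
by rewrite h.
Qed.

Lemma conve_pair_sum (k : R) (f : 'cV[R]_p -> \bar R) n :
  measurable_fun setT f -> (forall x, (0 <= f x)%E) ->
  conve P (fun w => k *: \sum_(i < n) Phi (X i w, eps i w)) f =
  iter n (conve P (fun w => k *: Phi (X 0%N w, eps 0%N w))) f.
Proof.
move=> mf f0.
apply: (conve_sum_iid (G := pair_events) (Y := fun i w => Phi (X i w, eps i w))) => //.
- exact: pair_eventsI.
- exact: pair_eventsT.
- exact: pair_events_measurable.
- exact: pair_events_mutually_independent.
- exact: pair_events_preimage.
- exact: pair_law.
Qed.

End pairs.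

End independent_sums.

(** * Gaussian vectors *)

Section gaussian_convolution.
Context (R : realType) (p : nat).
Local Notation N := (@normal_prob R 0 1).
Implicit Types (a b : 'cV[R]_p) (f : 'cV[R]_p -> \bar R).

(** Gaussian convolution along the line of [a]. A Gaussian vector is an independent sum along the
    columns of its matrix, so multivariate stability reduces to the scalar one on each line. *)
Definition gconv (s : R) a f := conve N (fun z : R => (s * z) *: a) f.

Lemma measurable_line (s : R) a : measurable_fun setT (fun z : R => (s * z) *: a).
Proof. by apply: measurable_cV_scale => //; exact: measurable_funM. Qed.

Lemma measurable_gconv s a f : measurable_fun setT f -> (forall x, (0 <= f x)%E) ->
  measurable_fun setT (gconv s a f).
Proof. by apply: measurable_conve; exact: measurable_line. Qed.

Lemma gconv_ge0 s a f : (forall x, (0 <= f x)%E) -> forall x, (0 <= gconv s a f x)%E.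
Proof. exact: conve_ge0. Qed.

Lemma gconvC s a t b f : measurable_fun setT f -> (forall x, (0 <= f x)%E) ->
  gconv s a (gconv t b f) = gconv t b (gconv s a f).
Proof. by move=> mf f0; apply: conveC => //; exact: measurable_line. Qed.

Lemma gconv_stable (s t r : R) a f : 0 < s -> 0 < t -> 0 < r ->
  r ^+ 2 = s ^+ 2 + t ^+ 2 -> measurable_fun setT f -> (forall x, (0 <= f x)%E) ->
  gconv s a (gconv t a f) = gconv r a f.
Proof.
move=> s0 t0 r0 rst mf f0; apply/funext => x.
rewrite /gconv /conve.
have mh : measurable_fun setT (fun u : R => f (x + u *: a)).
  apply: measurableT_comp => //; apply: measurable_cV_add => //.
  exact: measurable_cV_scale.
rewrite -(std_normal_stable s0 t0 r0 rst mh)//.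
apply: eq_integral => z _; apply: eq_integral => z' _.
by rewrite scalerDl addrA.
Qed.

Definition gconvs (s : R) (l : seq 'cV[R]_p) f := foldr (gconv s) f l.

Lemma measurable_gconvs s l f : measurable_fun setT f -> (forall x, (0 <= f x)%E) ->
  measurable_fun setT (gconvs s l f) /\ forall x, (0 <= gconvs s l f x)%E.
Proof.
move=> mf f0; elim: l => //= a l [ml l0]; split; first exact: measurable_gconv.
exact: gconv_ge0.
Qed.

Lemma gconv_gconvs s a t l f : measurable_fun setT f -> (forall x, (0 <= f x)%E) ->
  gconv s a (gconvs t l f) = gconvs t l (gconv s a f).
Proof.
move=> mf f0; elim: l => //= b l <-.
by have [ml l0] := measurable_gconvs t l mf f0; exact: gconvC.
Qed.

Lemma gconvs_stable (s t r : R) l f : 0 < s -> 0 < t -> 0 < r ->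
  r ^+ 2 = s ^+ 2 + t ^+ 2 -> measurable_fun setT f -> (forall x, (0 <= f x)%E) ->
  gconvs s l (gconvs t l f) = gconvs r l f.
Proof.
move=> s0 t0 r0 rst mf f0; elim: l => //= a l <-.
have [ml l0] := measurable_gconvs t l mf f0.
have [ml' l0'] := measurable_gconvs s l ml l0.
by rewrite -gconv_gconvs// (gconv_stable _ s0 t0 r0 rst).
Qed.

(** Variances add along every line, and n of them of size [1 / n] give 1. The induction starts at
    one factor because stability asks for positive scales. *)
Lemma iter_gconvs n l f : measurable_fun setT f -> (forall x, (0 <= f x)%E) ->
  (0 < n)%N -> iter n (gconvs (Num.sqrt n%:R)^-1 l) f = gconvs 1 l f.
Proof.
move=> mf f0 n0; pose s : R := (Num.sqrt n%:R)^-1.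
have sn0 : (0 : R) < Num.sqrt n%:R by rewrite sqrtr_gt0 ltr0n.
have s0 : 0 < s by rewrite invr_gt0.
have iterE m : iter m.+1 (gconvs s l) f = gconvs (Num.sqrt m.+1%:R * s) l f.
  elim: m => [|m ihm]; first by rewrite /= sqrtr1 mul1r.
  rewrite iterS ihm; apply: gconvs_stable => //.
  - by rewrite mulr_gt0// sqrtr_gt0.
  - by rewrite mulr_gt0// sqrtr_gt0.
  - by rewrite !exprMn !sqr_sqrtr// -[in LHS]natr1; ring.
by have := iterE n.-1; rewrite prednK// divff// gt_eqF.
Qed.

End gaussian_convolution.

(** * Linear images of independent standard normals *)

Section gaussian_vector.
Context (R : realType) (p k : nat) d (T : measurableType d) (P : probability T R).
Variables (A : 'M[R]_(p, k)) (Z : 'I_k -> {RV P >-> R}).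
Hypothesis indZ : mutually_independent P (fun i => g_sigma_algebra_preimage (Z i)).
Hypothesis lawZ : forall i (B : set R), measurable B ->
  distribution P (Z i) B = normal_prob 0 1 B.
Local Notation N := (@normal_prob R 0 1).

Definition gvec w : 'cV[R]_p := A *m (\col_i Z i w).

Lemma gvecE w : gvec w = \sum_(i <- enum 'I_k) Z i w *: col i A.
Proof.
rewrite big_enum/=; apply/colP => j; rewrite mxE summxE; apply: eq_bigr => i _.
by rewrite !mxE mulrC.
Qed.

Let GI i : setI_closed (g_sigma_algebra_preimage (Z i)).
Proof.
move=> _ _ [B mB <-] [B' mB' <-]; exists (B `&` B'); first exact: measurableI.
by rewrite !setTI.
Qed.

Let GT i : g_sigma_algebra_preimage (Z i) setT.
Proof. by exists setT => //; rewrite setTI. Qed.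

Let Gm i : g_sigma_algebra_preimage (Z i) `<=` measurable.
Proof. by move=> _ [B mB <-]; exact: measurable_funP. Qed.

Let Y (s : R) i w : 'cV[R]_p := (s * Z i w) *: col i A.

Let YG s i B : measurable B -> <<s g_sigma_algebra_preimage (Z i) >> (Y s i @^-1` B).
Proof.
move=> mB; apply: sub_sigma_algebra; exists ((fun z => (s * z) *: col i A) @^-1` B).
  by rewrite -[X in measurable X]setTI; exact: measurable_line.
by rewrite setTI.
Qed.

Let YE s w : s *: gvec w = \sum_(i <- enum 'I_k) Y s i w.
Proof. by rewrite gvecE scaler_sumr; apply: eq_bigr => i _; rewrite scalerA. Qed.

Lemma measurable_gvec : measurable_fun setT gvec.
Proof.
rewrite (_ : gvec = fun w => \sum_(i <- enum (ordinal k)) Z i w *: col i A); last first.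
  by apply/funext => w; exact: gvecE.
by apply: measurable_cV_sum => i _; exact: measurable_cV_scale.
Qed.

Lemma conve_coord (s : R) i (a : 'cV[R]_p) f :
  measurable_fun setT f -> (forall x, (0 <= f x)%E) ->
  conve P (fun w => (s * Z i w) *: a) f = gconv s a f.
Proof.
move=> mf f0; apply: conve_law => //.
- by apply: measurable_cV_scale => //; exact: measurable_funM.
- exact: measurable_line.
- move=> B mB; rewrite -[RHS](lawZ i)//.
  by rewrite -[X in measurable X]setTI; exact: measurable_line.
Qed.

Lemma conve_gvec (s : R) f : measurable_fun setT f -> (forall x, (0 <= f x)%E) ->
  conve P (fun w => s *: gvec w) f = gconvs s [seq col i A | i <- enum 'I_k] f.
Proof.
move=> mf f0.
under [X in conve P X]eq_fun do rewrite YE.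
rewrite (conve_sum GI GT Gm indZ (YG s) (enum_uniq _) mf f0).
elim: (enum _) => //= i l ->; apply: conve_coord.
- by case: (measurable_gconvs s [seq col i A | i <- l] mf f0).
- by case: (measurable_gconvs s [seq col i A | i <- l] mf f0).
Qed.

Lemma iter_conve_gvec n f : measurable_fun setT f -> (forall x, (0 <= f x)%E) ->
  (0 < n)%N ->
  iter n (conve P (fun w => (Num.sqrt n%:R)^-1 *: gvec w)) f = conve P gvec f.
Proof.
move=> mf f0 n0; pose l := [seq col i A | i <- enum 'I_k].
transitivity (gconvs 1 l f); last first.
  by rewrite -conve_gvec//; under eq_fun do rewrite scale1r.
rewrite -(iter_gconvs l mf f0 n0); move: (_ ^-1) => s.
have : forall m, iter m (conve P (fun w => s *: gvec w)) f = iter m (gconvs s l) f /\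
   measurable_fun setT (iter m (gconvs s l) f) /\
   forall x, (0 <= iter m (gconvs s l) f x)%E.
  elim=> [//|m [ih [mm m0]]]; rewrite !iterS ih conve_gvec//; split=> //.
  by have [] := measurable_gconvs s l mm m0.
by move=> /(_ n)[].
Qed.

(* Condition on all the coordinates but one that the hyperplane sees. *)
Lemma gvec_hyperplane (v : 'cV[R]_p) (c : R) : A^T *m v != 0 ->
  P [set w | (v^T *m gvec w) 0 0 = c] = 0%E.
Proof.
move=> /matrix0Pn[i [j Avi]]; rewrite (ord1 j) {j} in Avi.
set b := (A^T *m v) i 0 in Avi.
have bE : b = (v^T *m col i A) 0 0.
  rewrite /b !mxE; apply: eq_bigr => j _; by rewrite !mxE mulrC.
pose s := rem i (enum 'I_k).
have us : uniq s by rewrite rem_uniq// enum_uniq.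
have si : i \notin s by rewrite mem_rem_uniqF// enum_uniq.
have mL : measurable_fun setT (fun x : 'cV[R]_p => (v^T *m x) 0 0).
  rewrite (_ : (fun x => _) = (fun x : 'cV[R]_p => \sum_j v j 0 * x j 0)); last first.
    by apply/funext => x; rewrite mxE; apply: eq_bigr => j _; rewrite mxE.
  apply: measurable_sum => j; apply: measurable_funM => //.
  exact: measurable_coord.
pose H : set 'cV[R]_p := [set x | (v^T *m x) 0 0 = c].
have mH : measurable H.
  by rewrite -[X in measurable X]setTI; exact: (mL measurableT [set c] (measurable_set1 c)).
pose f (x : 'cV[R]_p) : \bar R := (\1_H x)%:E.
have mf : measurable_fun setT f by exact/measurable_EFinP/measurable_indic.
have f0 x : (0 <= f x)%E by rewrite lee_fin.
have : conve P (fun w => \sum_(j <- i :: s) Y 1 j w) f 0 = 0%E.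
  have uis : uniq (i :: s) by rewrite /= si us.
  rewrite (conve_sum GI GT Gm indZ (YG 1) uis mf f0).
  (* Convolutions commute, so coordinate [i] can be integrated first; a line parallel to [col i A]
     meets the hyperplane in a single point because [b] is nonzero. *)
  have -> : foldr (fun j h => conve P (Y 1 j) h) f (i :: s) =
      foldr (fun j h => conve P (Y 1 j) h) (conve P (Y 1 i) f) s.
    have mYj j : measurable_fun setT (Y 1 j) by exact: (family_measurable Gm (YG 1) j).
    have mfold l : measurable_fun setT (foldr (fun j h => conve P (Y 1 j) h) f l) /\
        forall x, (0 <= foldr (fun j h => conve P (Y 1 j) h) f l x)%E.
      elim: l => //= j l [ml l0]; split; last exact: conve_ge0.
      exact: (measurable_conve P (mYj j) ml l0).
    rewrite /=; elim: (s) => //= j l <-; have [ml l0] := mfold l.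
    exact: (conveC P P (mYj i) (mYj j) ml l0).
  have -> : conve P (Y 1 i) f = fun=> 0%E.
    rewrite conve_coord//; apply/funext => x; rewrite /gconv /conve.
    rewrite (_ : (fun z => _) = (fun z => (\1_[set (c - (v^T *m x) 0 0) / b] z)%:E)); last first.
      apply/funext => z; rewrite /f !indicE mul1r.
      have lE : (v^T *m (x + z *: col i A)) 0 0 = (v^T *m x) 0 0 + z * b.
        by rewrite bE mulmxDr -scalemxAr [LHS]mxE [X in _ + X = _]mxE.
      congr ((_ : bool)%:R)%:E.
      apply/idP/idP; rewrite !inE /H /= lE.
      - by move=> <-; rewrite addrAC subrr add0r mulfK.
      - by move=> ->; rewrite divfK// addrC subrK.
    rewrite integral_indic//= setIT.
    have /null_content_dominatesP -> // := @normal_prob_dominates R 0 1.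
    exact: lebesgue_measure_set1.
  suff -> : foldr (fun j h => conve P (Y 1 j) h) (fun=> 0%E) s = fun=> 0%E by [].
  elim: (s) => //= j l ->; apply/funext => x; rewrite /conve.
  exact: integral0.
rewrite /conve.
have -> : (\int[P]_w f (0 + \sum_(j <- i :: s) Y 1 j w)%R =
    P [set w | ((v^T *m gvec w) 0 0 = c)%R])%E.
  rewrite -[X in P X]setIT -integral_indic//; last first.
    by rewrite -[X in measurable X]setTI; exact: (measurable_gvec measurableT mH).
  apply: eq_integral => w _; rewrite add0r; congr EFin.
  rewrite (_ : \sum_(j <- i :: s) Y 1 j w = gvec w).
    by rewrite !indicE; congr ((_ : bool)%:R); apply/idP/idP; rewrite !inE.
  rewrite -[RHS]scale1r YE; apply: perm_big.
  by rewrite perm_sym perm_to_rem// mem_enum.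
by [].
Qed.

End gaussian_vector.

(** * Means of Taylor polynomials *)

Section means.
Context (R : realType) d (T : measurableType d) (P : probability T R).

Definition has_mean (f : T -> R) (m : R) :=
  P.-integrable setT (EFin \o f) /\ (\int[P]_w (f w)%:E = m%:E)%E.

Lemma has_meanD f g a b : has_mean f a -> has_mean g b ->
  has_mean (fun w => f w + g w) (a + b).
Proof.
move=> [jf Ef] [jg Eg]; split; first exact: (integrableD measurableT jf jg).
under eq_integral do rewrite EFinD.
by rewrite integralD// Ef Eg.
Qed.

Lemma has_meanZ f a k : has_mean f a -> has_mean (fun w => k * f w) (k * a).
Proof.
move=> [jf Ef]; split; first exact: (integrableZl measurableT k jf).
under eq_integral do rewrite EFinM.
by rewrite integralZl// Ef.
Qed.

Lemma has_mean_cst k : has_mean (fun=> k) k.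
Proof.
split; first exact: finite_measure_integrable_cst.
by rewrite integral_cst//= probability_setT mule1.
Qed.

Lemma has_mean_sum (I : Type) (s : seq I) (f : I -> T -> R) (a : I -> R) :
  (forall i, has_mean (f i) (a i)) ->
  has_mean (fun w => \sum_(i <- s) f i w) (\sum_(i <- s) a i).
Proof.
move=> fa; elim: s => [|i s ih].
  rewrite big_nil (_ : (fun w => _) = fun=> 0); first exact: has_mean_cst.
  by apply/funext => w; rewrite big_nil.
rewrite big_cons (_ : (fun w => _) = fun w => f i w + \sum_(j <- s) f j w).
  exact: has_meanD.
by apply/funext => w; rewrite big_cons.
Qed.

Lemma sqr_integrable (f : T -> R) : measurable_fun setT f ->
  P.-integrable setT (fun w => (f w ^+ 2)%:E) -> P.-integrable setT (EFin \o f).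
Proof.
move=> mf if2.
have ic : P.-integrable setT (fun=> 1%:E) by exact: finite_measure_integrable_cst.
apply: (le_integrable measurableT _ _ (integrableD measurableT if2 ic)).
  exact/measurable_EFinP.
move=> w _; rewrite /= lee_fin [leRHS]ger0_norm; last by rewrite addr_ge0// sqr_ge0.
have [w1|w1] := leP `|f w| 1; first by rewrite (le_trans w1)// lerDr sqr_ge0.
by rewrite -real_normK ?num_real// expr2 ler_wpDr// ler_peMl// ltW.
Qed.

Lemma sqr_integrableM (f g : T -> R) : measurable_fun setT f -> measurable_fun setT g ->
  P.-integrable setT (fun w => (f w ^+ 2)%:E) ->
  P.-integrable setT (fun w => (g w ^+ 2)%:E) ->
  P.-integrable setT (EFin \o (fun w => f w * g w)).
Proof.
move=> mf mg if2 ig2.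
apply: (le_integrable measurableT _ _ (integrableD measurableT if2 ig2)).
  by apply/measurable_EFinP; exact: measurable_funM.
move=> w _; rewrite /= lee_fin [leRHS]ger0_norm; last by rewrite addr_ge0// sqr_ge0.
rewrite normrM -(real_normK (num_real (f w))) -(real_normK (num_real (g w))).
move: (normr_ge0 (f w)) (normr_ge0 (g w)); move: `|f w| `|g w| => a b a0 b0.
by rewrite (@le_trans _ _ (a * b *+ 2)) ?mulr2n ?lerDr ?mulr_ge0// -mulr2n -subr_ge0 addrAC -sqrrB sqr_ge0.
Qed.

Section tpoly_means.
Context (p : nat) (Y : T -> 'cV[R]_p).
Hypothesis mY : measurable_fun setT Y.

Lemma tpoly1_mean (m : 'cV[R]_p) :
  (forall i, has_mean (fun w => Y w i 0) (m i 0)) ->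
  (forall D H, has_mean (fun w => tpoly 1 D H (Y w)) (lin D m)) /\
  P.-integrable setT (fun w => (`|Y w| ^+ 1)%:E).
Proof.
move=> Ym; split=> [D H|].
  rewrite /tpoly/=; under eq_fun do rewrite addr0.
  by apply: has_mean_sum => i; exact: has_meanZ.
have iY : P.-integrable setT (fun w => (\sum_(i <- enum 'I_p) `|(Y w i 0)%:E|)%E).
  apply: integrable_sum => // i _; apply: integrable_abse; exact: (Ym i).1.
apply: (le_integrable measurableT _ _ iY).
  by apply/measurable_EFinP; under eq_fun do rewrite expr1; exact: measurable_norm_cV.
move=> w _ /=; rewrite sumEFin /= lee_fin expr1 normr_id ger0_norm ?sumr_ge0//.
apply/mx_norm_leP => [|i]; first by rewrite sumr_ge0.
by rewrite (big_rem i) ?mem_enum//= lerDl sumr_ge0.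
Qed.

(** The value depends on the law only through [S]: two centred vectors with equal covariance match
    for every choice of coefficients. *)
Lemma tpoly2_mean (S : 'M[R]_p) :
  (forall i, has_mean (fun w => Y w i 0) 0) ->
  (forall i j, has_mean (fun w => Y w i 0 * Y w j 0) (S i j)) ->
  (forall D H, has_mean (fun w => tpoly 2 D H (Y w)) (\sum_i \sum_j H i j * S i j)) /\
  P.-integrable setT (fun w => (`|Y w| ^+ 2)%:E).
Proof.
move=> Y0 YS; split=> [D H|].
  rewrite /tpoly/= -[X in has_mean _ X]add0r; apply: has_meanD.
    rewrite [X in has_mean _ X](_ : 0 = \sum_i D i 0 * 0).
      by apply: has_mean_sum => i; exact: has_meanZ.
    by rewrite big1// => i _; rewrite mulr0.
  by apply: has_mean_sum => i; apply: has_mean_sum => j; exact: has_meanZ.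
have iY : P.-integrable setT (fun w => (\sum_(i <- enum 'I_p) (Y w i 0 * Y w i 0)%:E)%E).
  by apply: integrable_sum => // i _; exact: (YS i i).1.
apply: (le_integrable measurableT _ _ iY).
  by apply/measurable_EFinP; apply: measurable_funX; exact: measurable_norm_cV.
move=> w _ /=; rewrite sumEFin /= lee_fin ger0_norm ?exprn_ge0// ger0_norm; last first.
  by rewrite sumr_ge0// => i _; rewrite -expr2 sqr_ge0.
have [->|Yw] := eqVneq (Y w) 0.
  by rewrite normr0 expr0n sumr_ge0// => i _; rewrite -expr2 sqr_ge0.
have [] := @mx_norm_neq0 _ _ _ (Y w); first by rewrite -[mx_norm _]/(`|Y w|) normr_eq0.
move=> [i j] /= Yij; rewrite -[`|Y w|]/(mx_norm (Y w)) Yij (ord1 j).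
rewrite real_normK ?num_real// (big_rem i) ?mem_enum//= -expr2 lerDl.
by rewrite sumr_ge0// => l _; rewrite -expr2 sqr_ge0.
Qed.

End tpoly_means.
End means.

Lemma has_mean_law (R : realType) d (T : measurableType d) (P : probability T R)
    d' (T' : measurableType d') (Q : probability T' R)
    d1 (S : measurableType d1) (Y : T -> S) (Z : T' -> S) (g : S -> R) (m : R) :
  measurable_fun setT Y -> measurable_fun setT Z ->
  (forall B, measurable B -> P (Y @^-1` B) = Q (Z @^-1` B)) ->
  measurable_fun setT g ->
  has_mean Q (fun w => g (Z w)) m -> has_mean P (fun w => g (Y w)) m.
Proof.
move=> mY mZ YZ mg [ig Eg].
have mEg : measurable_fun setT (EFin \o g) by exact/measurable_EFinP.
pose Y' : {RV P >-> S} := mfun_Sub (mem_set mY).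
pose Z' : {RV Q >-> S} := mfun_Sub (mem_set mZ).
have Elaw (h : S -> \bar R) : (\int[distribution P Y']_z h z = \int[distribution Q Z']_z h z)%E.
  by apply: eq_measure_integral => B mB _; first [exact: YZ|exact/esym/YZ].
have mag : measurable_fun setT (abse \o (EFin \o g)) by exact: measurableT_comp.
have iP : P.-integrable setT (EFin \o (fun w => g (Y w))).
  apply/integrableP; split; first by apply/measurable_EFinP; exact: measurableT_comp.
  have := ge0_integral_distribution Y' mag (fun x => abse_ge0 _).
  rewrite /= => <-; rewrite Elaw.
  have := ge0_integral_distribution Z' mag (fun x => abse_ge0 _).
  by rewrite /= => ->; case/integrableP : ig.
split => //; rewrite -Eg.
have /= <- := integral_distribution (X := Y') mEg iP.
by have /= <- := integral_distribution (X := Z') mEg ig.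
Qed.

Section gaussian_means.
Context (R : realType) (p k : nat) d (T : measurableType d) (P : probability T R).
Variables (A : 'M[R]_(p, k)) (Z : 'I_k -> {RV P >-> R}).
Hypothesis indZ : mutually_independent P (fun i => g_sigma_algebra_preimage (Z i)).
Hypothesis lawZ : forall i (B : set R), measurable B ->
  distribution P (Z i) B = normal_prob 0 1 B.
Local Notation N := (@normal_prob R 0 1).

Lemma has_mean_std (g : R -> R) (m : R) i : measurable_fun setT g ->
  has_mean N g m -> has_mean P (fun w => g (Z i w)) m.
Proof.
move=> mg gm; apply: (has_mean_law (S := R) (Q := N) (Z := id)) => //.
by move=> B mB; rewrite -[RHS](lawZ i).
Qed.

Lemma std_pair i j : has_mean P (fun w => Z i w * Z j w) (i == j)%:R.
Proof.
have [<-|ij] := eqVneq i j.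
  have [i2 E2] := std_normal_moment2 R.
  apply: (has_mean_std (g := fun z => z * z)); last by split.
  exact: measurable_funM.
have [i1 E1] := std_normal_moment1 R.
have h1 l : has_mean P (Z l) 0 by apply: (has_mean_std (g := id)) => //; split.
have [] := indep_integralM (U := Z i) (V := Z j) _ (h1 i).1 (h1 j).1.
  move=> D F mD mF.
  have := indZ (s := [:: i; j]) (A := fun l => if l == i then Z i @^-1` D else Z j @^-1` F).
  rewrite !big_cons big_nil mule1 /= inE ij eqxx (negbTE (_ : j != i)) ?[j == i]eq_sym//.
  move=> /(_ isT) <-.
    congr (P _); apply/seteqP; split => [w [wi wj] l /=|w h].
      by rewrite !inE => /orP[] /eqP ->; rewrite ?eqxx// eq_sym (negbTE ij).
    split; first by have := h i; rewrite /= !inE eqxx; exact.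
    by have := h j; rewrite /= !inE eqxx orbT eq_sym (negbTE ij); exact.
  move=> l; rewrite !inE => /orP[] /eqP ->; rewrite ?eqxx.
    by exists D => //; rewrite setTI.
  by rewrite eq_sym (negbTE ij); exists F => //; rewrite setTI.
by move=> iZ EZ; split => //; rewrite EZ !(h1 _).2 mul0e.
Qed.

Lemma gvec_coord w i : gvec A Z w i 0 = \sum_j A i j * Z j w.
Proof. by rewrite mxE; apply: eq_bigr => j _; rewrite mxE. Qed.

Lemma gvec_mean i : has_mean P (fun w => gvec A Z w i 0) 0.
Proof.
have [i1 E1] := std_normal_moment1 R.
under eq_fun do rewrite gvec_coord.
rewrite [X in has_mean _ _ X](_ : 0 = \sum_j A i j * 0).
  apply: has_mean_sum => j; apply: has_meanZ.
  by apply: (has_mean_std (g := id)) => //; split.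
by rewrite big1// => j _; rewrite mulr0.
Qed.

Lemma gvec_cov i j : has_mean P (fun w => gvec A Z w i 0 * gvec A Z w j 0)
  ((A *m A^T) i j).
Proof.
rewrite (_ : (fun w => _) = (fun w => \sum_a \sum_b (A i a * A j b) * (Z a w * Z b w))); last first.
  apply/funext => w; rewrite !gvec_coord big_distrlr/=.
  by apply: eq_bigr => a _; apply: eq_bigr => b _; ring.
rewrite (_ : _ i j = \sum_a \sum_b (A i a * A j b) * (a == b)%:R); last first.
  rewrite mxE; apply: eq_bigr => a _; rewrite (bigD1 a)//= big1 ?addr0.
    by rewrite eqxx mulr1 mxE.
  by move=> b /negPf ba; rewrite eq_sym ba mulr0.
apply: has_mean_sum => a; apply: has_mean_sum => b; apply: has_meanZ.
exact: std_pair.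
Qed.

End gaussian_means.

(** * Central limit theorem and law of large numbers *)

Section limit_theorems.
Context (R : realType) (p : nat) d (T : measurableType d) (P : probability T R).
Context (X : nat -> {RV P >-> 'cV[R]_p}) (eps : nat -> {RV P >-> R}).
Context (C : 'M[R]_p) (sigma : R).
Hypothesis X_iid : iid X.
Hypothesis X_centered : forall i, centered_vec (X i).
Hypothesis X_cov : forall i, has_covmx (X i) C.
Hypothesis eps_iid : iid eps.
Hypothesis eps_centered : forall i, ('E_P[eps i] = 0)%E.
Hypothesis eps_var : forall i, ('V_P[eps i] = (sigma ^+ 2)%R%:E)%E.
Hypothesis X_eps_indep : independent_classes P (sigma_seq X) (sigma_seq eps).

Lemma centered_covariance (f g : T -> R) (c : R) : ('E_P[f] = 0)%E ->
  ('E_P[g] = 0)%E -> covariance P f g = c%:E ->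
  (\int[P]_w (f w * g w)%:E = c%:E)%E.
Proof.
move=> f0 g0; rewrite covariance.unlock f0 g0 /= expectation.unlock => <-.
apply: eq_integral => w _; congr EFin.
by rewrite -[RHS]/((f w - 0) * (g w - 0)) !subr0.
Qed.

(** A square is nonnegative, so the finiteness of its integral is already integrability; all moments
    below descend from this. *)
Lemma sqr_has_mean (f : T -> R) (c : R) : measurable_fun setT f ->
  (\int[P]_w (f w * f w)%:E = c%:E)%E -> has_mean P (fun w => f w * f w) c.
Proof.
move=> mf Ef; split => //; apply/integrableP; split.
  by apply/measurable_EFinP; exact: measurable_funM.
under eq_integral do rewrite /= ger0_norm -?expr2 ?sqr_ge0// expr2.
by rewrite Ef ltry.
Qed.

Let measurable_Xj i j : measurable_fun setT (fun w => X i w j 0).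
Proof. exact: (measurableT_comp (measurable_coord j)). Qed.

Lemma X_second_moment j k : has_mean P (fun w => X 0%N w j 0 * X 0%N w k 0) (C j k).
Proof.
have sq l : has_mean P (fun w => X 0%N w l 0 * X 0%N w l 0) (C l l).
  apply: sqr_has_mean => //.
  by apply: centered_covariance; [exact: X_centered|exact: X_centered|exact: X_cov].
split; last first.
  by apply: centered_covariance; [exact: X_centered|exact: X_centered|exact: X_cov].
by apply: sqr_integrableM => //; under eq_fun do rewrite expr2; exact: (sq _).1.
Qed.

Lemma X_mean j : has_mean P (fun w => X 0%N w j 0) 0.
Proof.
split; last by have := @X_centered 0%N j; rewrite expectation.unlock.
apply: sqr_integrable => //; under eq_fun do rewrite expr2.
exact: (X_second_moment j j).1.
Qed.

Lemma eps_second_moment : has_mean P (fun w => eps 0%N w * eps 0%N w) (sigma ^+ 2).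
Proof.
apply: sqr_has_mean => //; apply: centered_covariance => //.
exact: eps_var.
Qed.

Lemma eps_mean : has_mean P (eps 0%N) 0.
Proof.
split; last by have := eps_centered 0%N; rewrite expectation.unlock.
apply: sqr_integrable => //; under eq_fun do rewrite expr2.
exact: eps_second_moment.1.
Qed.

Lemma has_mean_indepM (g : R -> R) (h : 'cV[R]_p -> R) (a b : R) :
  measurable_fun setT g -> measurable_fun setT h ->
  has_mean P (fun w => g (eps 0%N w)) a -> has_mean P (fun w => h (X 0%N w)) b ->
  has_mean P (fun w => g (eps 0%N w) * h (X 0%N w)) (a * b).
Proof.
move=> mg mh [ig Eg] [ih Eh].
have mge : measurable_fun setT (fun w => g (eps 0%N w)) by exact: measurableT_comp.
have mhX : measurable_fun setT (fun w => h (X 0%N w)) by exact: measurableT_comp.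
pose U : {RV P >-> R} := mfun_Sub (mem_set mge).
pose V : {RV P >-> R} := mfun_Sub (mem_set mhX).
have [] := indep_integralM (U := U) (V := V) _ ig ih.
  move=> D F mD mF; rewrite setIC muleC.
  apply: (pair_rectangle X_eps_indep 0%N (A := h @^-1` F) (B := g @^-1` D)).
  - by rewrite -[X in measurable X]setTI; exact: mh.
  - by rewrite -[X in measurable X]setTI; exact: mg.
by move=> iM EM; split => //; rewrite EM Eg Eh.
Qed.

(** The summand of [X^T eps]; [gram j] below is the summand of column [j] of [X^T X]. Both are
    functions of the pair, so that one limit theorem covers them. *)
Let score (z : 'cV[R]_p * R) : 'cV[R]_p := z.2 *: z.1.

Let measurable_score : measurable_fun setT score.
Proof. by apply: measurable_cV_scale; [exact: measurable_snd|exact: measurable_fst]. Qed.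

Let gram j (z : 'cV[R]_p * R) : 'cV[R]_p := z.1 j 0 *: z.1.

Let measurable_gram j : measurable_fun setT (gram j).
Proof.
apply: measurable_cV_scale; last exact: measurable_fst.
exact: (measurableT_comp (measurable_coord j) measurable_fst).
Qed.

Let measurable_pair (Phi : 'cV[R]_p * R -> 'cV[R]_p) i : measurable_fun setT Phi ->
  measurable_fun setT (fun w => Phi (X i w, eps i w)).
Proof. by move=> mPhi; apply: (measurableT_comp mPhi); exact: measurable_fun_pair. Qed.

Let measurable_pair_sum (Phi : 'cV[R]_p * R -> 'cV[R]_p) (k : R) n : measurable_fun setT Phi ->
  measurable_fun setT (fun w => k *: \sum_(i < n) Phi (X i w, eps i w)).
Proof.
move=> mPhi; apply: measurable_cV_scale => //.
by apply: measurable_cV_sum => i _; exact: measurable_pair.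
Qed.

Lemma score_mean i : has_mean P (fun w => score (X 0%N w, eps 0%N w) i 0) 0.
Proof.
under eq_fun do rewrite mxE.
rewrite -(mul0r 0); apply: (has_mean_indepM (g := id) (h := fun x => x i 0)) => //.
- exact: measurable_coord.
- exact: eps_mean.
- exact: X_mean.
Qed.

Lemma score_cov i j : has_mean P (fun w => score (X 0%N w, eps 0%N w) i 0 *
  score (X 0%N w, eps 0%N w) j 0) ((sigma ^+ 2 *: C) i j).
Proof.
rewrite mxE (_ : (fun w => _) = (fun w => (eps 0%N w * eps 0%N w) *
   (X 0%N w i 0 * X 0%N w j 0))); last first.
  by apply/funext => w; rewrite !mxE /=; ring.
apply: (has_mean_indepM (g := fun e => e * e) (h := fun x => x i 0 * x j 0)).
- exact: measurable_funM.
- by apply: measurable_funM; exact: measurable_coord.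
- exact: eps_second_moment.
- exact: X_second_moment.
Qed.

(** [Z] is the replacing summand and [V] has the law of its scaled sums: a Gaussian vector at scale
    [1 / sqrt n], or a constant at scale [1 / n]. *)
Lemma sum_converges_open (Phi : 'cV[R]_p * R -> 'cV[R]_p) (r : nat)
    d' (T' : measurableType d') (Q : probability T' R) (Z V : T' -> 'cV[R]_p)
    (s : nat -> R) :
  (0 < r <= 2)%N -> measurable_fun setT Phi ->
  measurable_fun setT Z -> measurable_fun setT V ->
  P.-integrable setT (fun w => (`|Phi (X 0%N w, eps 0%N w)| ^+ r)%:E) ->
  Q.-integrable setT (fun w => (`|Z w| ^+ r)%:E) ->
  (forall D H, exists m, has_mean P (fun w => tpoly r D H (Phi (X 0%N w, eps 0%N w))) m /\
     has_mean Q (fun w => tpoly r D H (Z w)) m) ->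
  (forall n, 0 <= s n) -> s n @[n --> \oo] --> 0 ->
  (forall n, n%:R * s n ^+ r <= 1) ->
  (forall n f, (0 < n)%N -> measurable_fun setT f -> (forall x, (0 <= f x)%E) ->
     iter n (conve Q (fun w => s n *: Z w)) f 0 = (\int[Q]_w f (V w))%E) ->
  forall (U : set 'cV[R]_p) (c : R), open U -> (c%:E < Q (V @^-1` U))%E ->
  \forall n \near \oo,
    (c%:E < P [set w | U (s n *: \sum_(i < n) Phi (X i w, eps i w))%R])%E.
Proof.
move=> r12 mPhi mZ mV iY iZ mt s0 cs sr iterZ U c oU cU.
apply: (portmanteau_open oU _ mV _ cU) => [n|f tf mf f01].
  exact: measurable_pair_sum.
have f0 x : 0 <= f x by case/andP: (f01 x).
have mF : measurable_fun setT (EFin \o f) by exact/measurable_EFinP.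
have F0 x : (0 <= (EFin \o f) x)%E by rewrite lee_fin.
have ifV : Q.-integrable setT (fun w => (f (V w))%:E).
  have ic : Q.-integrable setT (fun=> 1%:E) by exact: finite_measure_integrable_cst.
  apply: (le_integrable measurableT _ _ ic).
    by apply/measurable_EFinP; exact: measurableT_comp.
  by move=> w _; rewrite /= lee_fin normr1 ger0_norm//; case/andP: (f01 (V w)).
have Vfin := integrable_fin_num measurableT ifV.
rewrite -(fineK Vfin).
have -> : (fun n => \int[P]_w (f (s n *: \sum_(i < n) Phi (X i w, eps i w)))%:E)%E =
    (fun n => iter n (conve P (fun w => s n *: Phi (X 0%N w, eps 0%N w))) (EFin \o f) 0).
  apply/funext => n.
  rewrite -(conve_pair_sum X_iid eps_iid X_eps_indep mPhi (s n) n mF F0).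
  by apply: eq_integral => w _; rewrite add0r.
apply: (lindeberg_cvg r12 (measurable_pair 0%N mPhi) mZ iY iZ _ s0 cs sr tf mf f0).
- by move=> D H; have [m [[i1 E1] [i2 E2]]] := mt D H; split => //; rewrite E1 E2.
- by move=> n n0; rewrite iterZ// fineK.
Qed.

Lemma cvg_invsqrt : (Num.sqrt n%:R)^-1 @[n --> \oo] --> (0 : R).
Proof.
apply/cvgrPdist_lt => e e0; near=> n.
rewrite sub0r normrN ger0_norm ?invr_ge0//.
have n0 : (0 < n)%N by near: n; exact: nbhs_infty_gt.
have ne : e ^- 2 < n%:R by near: n; exact: nbhs_infty_gtr.
rewrite invf_plt ?posrE ?sqrtr_gt0 ?ltr0n//.
by rewrite -(@ltr_pXn2r _ 2) ?nnegrE ?invr_ge0 ?(ltW e0)// sqr_sqrtr// exprVn.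
Unshelve. all: by end_near.
Qed.

Lemma cvg_invn : n%:R^-1 @[n --> \oo] --> (0 : R).
Proof.
apply/cvgrPdist_lt => e e0; near=> n.
rewrite sub0r normrN ger0_norm ?invr_ge0//.
have n0 : (0 < n)%N by near: n; exact: nbhs_infty_gt.
have ne : e^-1 < n%:R by near: n; exact: nbhs_infty_gtr.
by rewrite invf_plt ?posrE ?ltr0n.
Unshelve. all: by end_near.
Qed.

Lemma clt_open d' (T' : measurableType d') (Q : probability T' R)
    (W : {RV Q >-> 'cV[R]_p}) (U : set 'cV[R]_p) (c : R) :
  normal_vec W 0 (sigma ^+ 2 *: C) -> open U -> (c%:E < Q (W @^-1` U))%E ->
  \forall n \near \oo,
    (c%:E < P [set w | U ((Num.sqrt n%:R)^-1 *: \sum_(i < n) eps i w *: X i w)%R])%E.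
Proof.
move=> [k [A [Z [indZ lawZ AA WE]]]] oU cU.
have mg := measurable_gvec A Z.
(* [W] is the linear image of the standard normals only almost surely, so the event is transferred
   up to a null set. *)
have gU : (c%:E < Q (gvec A Z @^-1` U))%E.
  rewrite (lt_le_trans cU)//.
  have mU : measurable U := measurable_cV_open oU.
  have m1 : measurable (W @^-1` U) by rewrite -[X in measurable X]setTI; exact: measurable_funP.
  have m2 : measurable (gvec A Z @^-1` U) by rewrite -[X in measurable X]setTI; exact: mg.
  have [B [mB B0 BW]] := WE.
  rewrite (@le_trans _ _ (Q (gvec A Z @^-1` U `|` B)))//.
    rewrite le_measure ?inE//; first exact: measurableU.
    move=> w /= Uw; have [Bw|Bw] := pselect (B w); [by right|left].
    have := contra_not (BW w) Bw => /contrapT /=.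
    by rewrite [_ + 0]addr0 /gvec => <-.
  rewrite (le_trans (measureU2 Q m2 mB))// -[leRHS]adde0 leeD2l//.
  by rewrite le_eqVlt; apply/orP; left; apply/eqP; exact: B0.
have [mean2 int2] := tpoly2_mean (measurable_pair 0%N measurable_score) score_mean score_cov.
have [gm2 gi2] := tpoly2_mean mg (gvec_mean A lawZ) (gvec_cov A indZ lawZ).
have := sum_converges_open (r := 2) (s := fun n => (Num.sqrt n%:R)^-1) isT measurable_score
  mg mg int2 gi2 _ _ _ _ _ oU gU; apply.
- move=> D H; exists (\sum_i \sum_j H i j * (sigma ^+ 2 *: C) i j); split; first exact: mean2.
  by rewrite -AA; exact: gm2.
- by move=> n; rewrite invr_ge0.
- exact: cvg_invsqrt.
- move=> n; rewrite exprVn sqr_sqrtr//; have [->|n0] := eqVneq n 0%N.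
    by rewrite mul0r.
  by rewrite divff// pnatr_eq0.
- move=> n f n0 mf f0; rewrite (iter_conve_gvec A indZ lawZ mf f0 n0) /conve.
  by apply: eq_integral => w _; rewrite add0r.
Qed.

Lemma lln_open (j : 'I_p) (e c : R) : 0 < e -> c < 1 ->
  \forall n \near \oo,
    (c%:E < P [set w | (`|n%:R^-1 *: \sum_(i < n) X i w j 0 *: X i w - col j C| < e)%R])%E.
Proof.
move=> e0 c1.
pose U : set 'cV[R]_p := [set x | `|x - col j C| < e].
have oU : open U.
  rewrite (_ : U = ball (col j C) e); first exact: ball_open.
  by rewrite mx_norm_ball; apply/funext => x; rewrite /ball_ /= distrC.
have means : forall i, has_mean P (fun w => gram j (X 0%N w, eps 0%N w) i 0) (col j C i 0).
  move=> i; under eq_fun do rewrite mxE mulrC.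
  by rewrite mxE; exact: X_second_moment.
have [mean1 int1] := tpoly1_mean (measurable_pair 0%N (measurable_gram j)) means.
have mc : measurable_fun setT (fun _ : T => col j C) by exact: measurable_cst.
have [cm1 ci1] := tpoly1_mean (P := P) mc (fun i => has_mean_cst P (col j C i 0)).
have := sum_converges_open (r := 1) (s := fun n => n%:R^-1) isT (measurable_gram j)
  mc mc int1 ci1 _ _ _ _ _ oU; apply.
- by move=> D H; exists (lin D (col j C)); split; [exact: mean1|exact: cm1].
- by move=> n; rewrite invr_ge0.
- exact: cvg_invn.
- move=> n; rewrite expr1; have [->|n0] := eqVneq n 0%N; first by rewrite mul0r.
  by rewrite divff// pnatr_eq0.
- move=> n f n0 mf f0; rewrite integral_cst//= probability_setT mule1.
  (* Convolution with a constant vector is a translation, and n of them add up to [col j C]. *)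
  suff : forall m x, iter m (conve P (fun=> n%:R^-1 *: col j C)) f x =
      f (x + (m%:R / n%:R) *: col j C).
    by move=> ->; rewrite add0r divff ?scale1r// pnatr_eq0 -lt0n.
  elim=> [x|m ih x]; first by rewrite mul0r scale0r addr0.
  rewrite iterS /conve; under eq_integral do rewrite ih.
  rewrite integral_cst//= probability_setT mule1; congr f.
  by rewrite -addrA -scalerDl -natr1 addrC mulrDl mul1r [_ + n%:R^-1]addrC addrC.
- rewrite (_ : _ @^-1` U = setT) ?probability_setT ?lte_fin//.
  by apply/seteqP; split => // w _; rewrite /U /= subrr normr0.
Qed.

End limit_theorems.

(** * The SLOPE norm on the cells of the pattern arrangement *)

Section pattern_cells.
Context (R : realType) (p : nat).
Implicit Types (u v z : 'cV[R]_p).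

(* The hyperplanes [u_i = 0], [u_i = u_j] and [u_i = - u_j]: the pattern of [u]
   is determined by the cell of this arrangement that contains [u]. *)
Definition arr (t : 'I_p * 'I_p * 'I_3) u : R :=
  u t.1.1 0 + (t.2%:R - 1) * u t.1.2 0.

Definition same_cell u v := forall t, Num.sg (arr t u) = Num.sg (arr t v).

Lemma arrD t u v : arr t (u + v) = arr t u + arr t v.
Proof. by rewrite /arr !mxE; ring. Qed.

Lemma arrZ t k u : arr t (k *: u) = k * arr t u.
Proof. by rewrite /arr !mxE; ring. Qed.

Lemma arr_le t u : `|arr t u| <= 2 * `|u|.
Proof.
rewrite /arr (le_trans (ler_normD _ _))// normrM mulr_natl mulr2n lerD ?coord_le_norm//.
rewrite -[leRHS]mul1r ler_pM// ?coord_le_norm//.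
by case: t => [? [[|[|[]]] //= ?]]; rewrite ?mulr0n ?sub0r ?normrN ?normr1 ?subrr ?normr0//;
  rewrite (_ : 2%:R - 1 = 1) ?normr1//; ring.
Qed.

Lemma same_cellZ k u : 0 < k -> same_cell (k *: u) u.
Proof. by move=> k0 t; rewrite arrZ sgrM gtr0_sg// mul1r. Qed.

(** The three indices stand for the coefficients -1, 0 and 1 of the second coordinate in [arr]. *)
Let c0 : 'I_3 := inord 0.
Let c1 : 'I_3 := inord 1.
Let c2 : 'I_3 := inord 2.

Lemma same_cell_sg u v i : same_cell u v -> Num.sg (u i 0) = Num.sg (v i 0).
Proof.
by move=> /(_ (i, i, c1)); rewrite /arr /= inordK// subrr !mul0r !addr0.
Qed.

Lemma same_cell_sgB u v i j : same_cell u v ->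
  Num.sg (u i 0 - u j 0) = Num.sg (v i 0 - v j 0).
Proof.
by move=> /(_ (i, j, c0)); rewrite /arr /= inordK// mulr0n sub0r !mulN1r.
Qed.

Lemma same_cell_sgD u v i j : same_cell u v ->
  Num.sg (u i 0 + u j 0) = Num.sg (v i 0 + v j 0).
Proof.
move=> /(_ (i, j, c2)); rewrite /arr /= inordK//.
by rewrite (_ : 2%:R - 1 = 1 :> R) ?mul1r//; ring.
Qed.

Lemma le_sg_sub (a b : R) : (a <= b) = (0 <= Num.sg (b - a)).
Proof. by rewrite sgr_ge0 subr_ge0. Qed.

(** Squaring turns the comparison into the sign of [(u_j - u_i)(u_j + u_i)], a product of two signs
    fixed by the cell. *)
Lemma same_cell_abs u v i j : same_cell u v ->
  (`|u i 0| <= `|u j 0|) = (`|v i 0| <= `|v j 0|).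
Proof.
move=> uv.
have h (w : 'cV[R]_p) : (`|w i 0| <= `|w j 0|) =
    (0 <= Num.sg (w j 0 - w i 0) * Num.sg (w j 0 + w i 0)).
  rewrite -sgrM -subr_sqr -(@ler_pXn2r _ 2) ?nnegrE// !real_normK ?num_real//.
  by rewrite -le_sg_sub.
by rewrite !h (same_cell_sgB _ _ uv) (same_cell_sgD _ _ uv).
Qed.

Lemma sorted_index (s : seq R) x : sorted <%R s -> x \in s ->
  index x s = count (fun y => y < x) s.
Proof.
elim: s => //= y s ih ys; rewrite in_cons.
have ally : all (fun r => y < r) s by move: ys; rewrite (path_sortedE lt_trans) => /andP[].
case: eqVneq => [{ih}->{x} _|xy /= xs].
  rewrite ltxx add0n; apply/esym/eqP; rewrite -leqn0 leqNgt -has_count.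
  apply/hasPn => z zs; have /allP/(_ _ zs) yz := ally.
  by rewrite -leNgt ltW.
have /allP/(_ _ xs) -> := ally.
by rewrite add1n ih// (path_sorted ys).
Qed.

Lemma size_undup_map (I : eqType) (f g : I -> R) (s : seq I) :
  (forall i j, (f i == f j) = (g i == g j)) ->
  size (undup (map f s)) = size (undup (map g s)).
Proof.
move=> fg; elim: s => //= i s ih.
have -> : (f i \in map f s) = (g i \in map g s).
  by apply/mapP/mapP => -[j js /eqP ij]; exists j => //; apply/eqP; rewrite ?fg// -fg.
by case: ifP => // _; rewrite /= ih.
Qed.

(** Expressed as a count of distinct smaller values, the rank depends only on comparisons of
    absolute values, hence only on the cell. *)
Lemma abs_rankE u i : u i 0 != 0 -> abs_rank u i =
  (size (undup [seq `|u j 0| | j <- enum 'I_p & (u j 0 != 0) && (`|u j 0| < `|u i 0|)])).+1.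
Proof.
move=> ui0; rewrite /abs_rank (negbTE ui0); congr S.
rewrite /nonzero_abs_values; set s := undup _.
have perm_s : perm_eq (sort <=%R s) s by rewrite perm_sort.
rewrite sorted_index.
- rewrite (permP perm_s) -size_filter /s filter_undup filter_map -filter_predI.
  by congr (size (undup (map _ _))); apply: eq_filter => j; rewrite /= andbC.
- rewrite lt_sorted_uniq_le (perm_uniq perm_s) undup_uniq/=.
  exact: (sort_sorted le_total).
- rewrite (perm_mem perm_s) mem_undup; apply/mapP; exists i => //.
  by rewrite mem_filter ui0 mem_enum.
Qed.

Lemma same_cell_patt u v : same_cell u v -> patt u = patt v.
Proof.
move=> uv; apply/colP => i; rewrite !mxE.
have z0 j : (u j 0 == 0) = (v j 0 == 0).
  by rewrite -[LHS]sgr_eq0 -[RHS]sgr_eq0 (same_cell_sg _ uv).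
have sgzE : sgz (u i 0) = sgz (v i 0).
  have := same_cell_sg i uv; rewrite !sgrEz => /eqP.
  by rewrite eqr_int => /eqP.
rewrite sgzE; congr (_%:Z * _).
have [ui0|ui0] := eqVneq (u i 0) 0.
  by rewrite /abs_rank -z0 ui0 eqxx.
have vi0 : v i 0 != 0 by rewrite -z0.
rewrite !abs_rankE//.
congr _.+1.
rewrite (size_undup_map (g := fun j => `|v j 0|)); last first.
  by move=> j k; rewrite !eq_le !(same_cell_abs _ _ uv).
congr (size (undup (map _ _))); apply: eq_filter => j.
by rewrite z0 !ltNge (same_cell_abs _ _ uv).
Qed.

(** Names the cells by a finite type, which makes finite unions and finite minima over cells
    available. *)
Definition code u : {ffun 'I_p * 'I_p * 'I_3 -> bool * bool} :=
  [ffun t => (0 < arr t u, arr t u < 0)].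

Lemma codeP u v : code u = code v <-> same_cell u v.
Proof.
split=> [/ffunP uv t|uv].
  have := uv t; rewrite !ffunE => -[h1 h2].
  have [u0|u0|/esym u0] := ltgtP 0 (arr t u).
  - by rewrite !gtr0_sg// -h1.
  - by rewrite !ltr0_sg// -h2.
  - move: h1 h2; rewrite u0 ltxx; case: ltgtP => // <- _ _; by rewrite sgr0.
apply/ffunP => t; rewrite !ffunE; congr pair.
- by rewrite -[LHS]sgr_gt0 -[RHS]sgr_gt0 uv.
- by rewrite -[LHS]sgr_lt0 -[RHS]sgr_lt0 uv.
Qed.

End pattern_cells.

Lemma fin_pos_lb (R : realType) (I : finType) (g : I -> R) :
  (forall i, 0 < g i) -> exists2 e : R, 0 < e & forall i, e <= g i.
Proof.
move=> g0; exists (\big[Num.min/1]_i g i).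
  by apply: lt_bigmin => //.
by move=> i; exact: bigmin_le.
Qed.

(** * Linearity of the norm increment on small pieces of cells *)

Section slope_local.
Context (R : realType) (p : nat).
Implicit Types (l u v b : 'cV[R]_p).

(** Weights indexed by numbers and padded with 0: positions come from [index], and Abel summation
    reads one weight past the end. *)
Definition lnth l (k : nat) : R := nth 0 [seq l i 0 | i <- enum 'I_p] k.

Lemma lnth_ord l (k : 'I_p) : lnth l k = l k 0.
Proof. by rewrite /lnth (nth_map k) ?size_enum_ord// nth_ord_enum. Qed.

Lemma lnth_default l k : (p <= k)%N -> lnth l k = 0.
Proof. by move=> pk; rewrite /lnth nth_default// size_map size_enum_ord. Qed.

Lemma lnthB_le l l' k : `|lnth l k - lnth l' k| <= `|l - l'|.
Proof.
have [kp|pk] := ltnP k p; last by rewrite !lnth_default// subrr normr0.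
rewrite -[k]/(val (Ordinal kp)) !lnth_ord.
by have := coord_le_norm (l - l') (Ordinal kp); rewrite !mxE.
Qed.

Lemma lnthZ c l k : lnth (c *: l) k = c * lnth l k.
Proof.
have [kp|pk] := ltnP k p; last by rewrite !lnth_default// mulr0.
by rewrite -[k]/(val (Ordinal kp)) !lnth_ord mxE.
Qed.

Lemma sum_sort_reindex l (s : seq 'I_p) (h : 'I_p -> R) :
  perm_eq s (enum 'I_p) ->
  \sum_(k < p) l k 0 * nth 0 (map h s) k = \sum_i lnth l (index i s) * h i.
Proof.
move=> ps; rewrite -[RHS]big_enum -[RHS](perm_big _ ps)/=.
have us : uniq s by rewrite (perm_uniq ps) enum_uniq.
have ss : size s = p by rewrite (perm_size ps) size_enum_ord.
case: (pickP 'I_p) => [i0 _|no]; last first.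
  rewrite big1 => [|k _]; last by have := no k.
  by rewrite big_seq big1// => k; have := no k.
rewrite [RHS](big_nth i0) ss big_mkord; apply: eq_bigr => k _.
by rewrite index_uniq ?ss// lnth_ord (nth_map i0) ?ss.
Qed.

Variable b0 : 'cV[R]_p.

(* Signs and decreasing order of the entries of [b0 + t v] for all small
   [t > 0]. *)
Definition sgb v i : R := if b0 i 0 == 0 then Num.sg (v i 0) else Num.sg (b0 i 0).

Definition before v : rel 'I_p := fun i j =>
  (`|b0 j 0| < `|b0 i 0|) ||
  ((`|b0 j 0| == `|b0 i 0|) && (sgb v j * v j 0 <= sgb v i * v i 0)).

Definition ord v := sort (before v) (enum 'I_p).

(** [v] fixes only the signs and the order, so this is linear in [u]. Keeping the two arguments
    apart allows differentiation at [v] in directions [u] outside the cell. *)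
Definition slope_lin l v u : R :=
  \sum_i lnth l (index i (ord v)) * (sgb v i * u i 0).

Lemma before_total v : total (before v).
Proof.
move=> i j; rewrite /before; case: (ltgtP `|b0 j 0| `|b0 i 0|) => //= _.
exact: le_total.
Qed.

Lemma perm_ord v : perm_eq (ord v) (enum 'I_p).
Proof. by rewrite perm_sort. Qed.

Lemma slope_linD l v u u' : slope_lin l v (u + u') = slope_lin l v u + slope_lin l v u'.
Proof. by rewrite -big_split/=; apply: eq_bigr => i _; rewrite !mxE; ring. Qed.

Lemma slope_linZ l v k u : slope_lin l v (k *: u) = k * slope_lin l v u.
Proof. by rewrite mulr_sumr; apply: eq_bigr => i _; rewrite !mxE; ring. Qed.

Lemma slope_lin_scale c l v u : slope_lin (c *: l) v u = c * slope_lin l v u.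
Proof. by rewrite mulr_sumr; apply: eq_bigr => i _; rewrite lnthZ; ring. Qed.

Lemma sgb_le1 v i : `|sgb v i| <= 1.
Proof.
have h (x : R) : `|Num.sg x| <= 1 by rewrite normr_sg lern1 leq_b1.
by rewrite /sgb; case: ifP => _; exact: h.
Qed.

Lemma slope_linB_le l l' v u :
  `|slope_lin l v u - slope_lin l' v u| <= p%:R * `|l - l'| * `|u|.
Proof.
rewrite -sumrB (le_trans (ler_norm_sum _ _ _))//.
rewrite -mulrA mulr_natl -[X in _ *+ X]card_ord -sumr_const.
apply: ler_sum => i _; rewrite -mulrBl normrM ler_pM// ?lnthB_le//.
by rewrite normrM -[leRHS]mul1r ler_pM// ?sgb_le1 ?coord_le_norm.
Qed.

Lemma same_cell_sgb u v i : same_cell u v -> sgb u i = sgb v i.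
Proof. by move=> uv; rewrite /sgb (same_cell_sg _ uv). Qed.

(** Among ties of [b0], entries that vanish are compared by absolute value, the others through
    signed differences or sums; each comparison is a sign fixed by the cell. *)
Lemma same_cell_before u v : same_cell u v -> before u =2 before v.
Proof.
move=> uv i j; rewrite /before; case: eqP => //= bij; congr (_ || _).
rewrite !(same_cell_sgb _ uv) /sgb.
have [bi|bi] := eqVneq (b0 i 0) 0.
  have /eqP bj : b0 j 0 == 0 by rewrite -normr_eq0 bij bi normr0.
  have e w k : same_cell w v -> Num.sg (v k 0) * w k 0 = `|w k 0|.
    by move=> wv; rewrite -(same_cell_sg k wv) -normrEsg.
  rewrite bj eqxx !(e u)// !(e v)//.
  exact: (same_cell_abs _ _ uv).
have /negPf bj : b0 j 0 != 0 by rewrite -normr_eq0 bij normr_eq0.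
rewrite bj.
have sg1 (x : R) : x != 0 -> Num.sg x = 1 \/ Num.sg x = -1.
  by move=> x0; case: sgrP x0 => //; [left|right].
have [->|->] := sg1 _ bi; have [->|->] := sg1 _ (negbT bj); rewrite ?mul1r ?mulN1r.
- by rewrite [LHS]le_sg_sub [RHS]le_sg_sub (same_cell_sgB _ _ uv).
- by rewrite [LHS]le_sg_sub [RHS]le_sg_sub !opprK (same_cell_sgD _ _ uv).
- by rewrite [LHS]le_sg_sub [RHS]le_sg_sub -!opprD !sgrN (same_cell_sgD _ _ uv).
- by rewrite !lerN2 [LHS]le_sg_sub [RHS]le_sg_sub (same_cell_sgB _ _ uv).
Qed.

Lemma same_cell_slope_lin l u v z : same_cell u v -> slope_lin l u z = slope_lin l v z.
Proof.
move=> uv; rewrite /slope_lin /ord.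
have -> : before u = before v.
  by apply/funext => i; apply/funext => j; exact: same_cell_before.
by apply: eq_bigr => i _; rewrite (same_cell_sgb _ uv).
Qed.

(** Small perturbations keep the strict order and the nonzero signs of [b0], and the cell decides
    the ties. The alternative [u = 0] sorts [b0] itself in the order of [v], so that the two values
    of the norm can be subtracted term by term. *)
Lemma abs_sorted_local : exists2 e : R, 0 < e & forall u v,
  same_cell u v \/ u = 0 -> `|u| <= e ->
  abs_sorted (b0 + u) = [seq sgb v i * (b0 i 0 + u i 0) | i <- ord v].
Proof.
(* Half of every gap between distinct absolute values and half of every nonzero one; 1 is a neutral
   default. *)
pose g (ij : 'I_p * 'I_p) : R :=
  if `|b0 ij.2 0| < `|b0 ij.1 0| then (`|b0 ij.1 0| - `|b0 ij.2 0|) / 2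
  else if b0 ij.1 0 != 0 then `|b0 ij.1 0| / 2 else 1.
have [|e e0 eg] := @fin_pos_lb R _ g.
  move=> [i j]; rewrite /g /=; case: ifP => [bij|_]; first by rewrite divr_gt0 ?subr_gt0.
  by case: ifP => // bi; rewrite divr_gt0 ?normr_gt0.
exists e => // u v uv ue.
have ui i : `|u i 0| <= e by rewrite (le_trans (coord_le_norm _ _)).
have sE i : sgb v i * (b0 i 0 + u i 0) = `|b0 i 0 + u i 0|.
  rewrite /sgb; case: eqVneq => [->|bi].
    rewrite !add0r; case: uv => [uv|->]; last by rewrite mxE mulr0 normr0.
    by rewrite -(same_cell_sg i uv) -normrEsg.
  have := eg (i, i); rewrite /g /= ltxx bi => ebi.
  have {ebi}ub : `|u i 0| < `|b0 i 0|.
    by rewrite (le_lt_trans (ui i))// (le_lt_trans ebi)// ltr_pdivrMr// ltr_pMr ?normr_gt0// ltr1n.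
  case: (sgrP (b0 i 0)) bi ub => // b0i _; rewrite ltr_norml => /andP[h1 h2].
    by rewrite mul1r gtr0_norm// -ltrBlDl sub0r.
  by rewrite mulN1r ltr0_norm// addrC -ltrBrDr sub0r.
have sBE i j : before v i j -> `|b0 j 0 + u j 0| <= `|b0 i 0 + u i 0|.
  rewrite /before => /orP[bij|/andP[/eqP bij vij]].
    have := eg (i, j); rewrite /g /= bij => eij.
    rewrite (le_trans (ler_normD _ _))//.
    rewrite (@le_trans _ _ (`|b0 i 0| - `|u i 0|))//; last first.
      by have := lerB_normD (b0 i 0) (u i 0).
    by have := ui i; have := ui j; move: eij; lra.
  rewrite -!sE !mulrDr.
  have bE k : sgb v k * b0 k 0 = `|b0 k 0|.
    by rewrite /sgb normrEsg; case: eqP => // ->; rewrite !mulr0.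
  rewrite !bE bij lerD2l; case: uv => [uv|->]; last by rewrite !mxE !mulr0.
  have : before u i j.
    by rewrite (same_cell_before uv) /before bij eqxx vij orbT.
  rewrite /before bij ltxx eqxx /= !(same_cell_sgb _ uv)//.
rewrite /abs_sorted.
have -> : [seq sgb v i * (b0 i 0 + u i 0) | i <- ord v] =
   [seq `|(b0 + u) i 0| | i <- ord v].
  by apply: eq_map => i; rewrite sE mxE.
apply: (sorted_eq (leT := >=%R)).
- by move=> x y z xy yz; exact: le_trans yz xy.
- by move=> x y /andP[xy yx]; apply/le_anti/andP.
- by apply: sort_sorted => x y; exact: le_total.
- rewrite sorted_map; apply: (sub_sorted (e := before v)); last first.
    by apply: sort_sorted; exact: before_total.
  by move=> i j /sBE; rewrite /relpre /= !mxE.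
- by rewrite perm_sort perm_map// perm_sym perm_ord.
Qed.

(** The radius is chosen before the weights, so it serves all [lam n] at once. *)
Lemma slope_norm_local : exists2 e : R, 0 < e & forall l u v,
  same_cell u v -> `|u| <= e ->
  slope_norm l (b0 + u) - slope_norm l b0 = slope_lin l v u.
Proof.
have [e e0 eP] := abs_sorted_local; exists e => // l u v uv ue.
have E w : same_cell w v \/ w = 0 -> `|w| <= e ->
    slope_norm l (b0 + w) = slope_lin l v (b0 + w).
  move=> wv we; rewrite /slope_norm (eP w v wv we) (sum_sort_reindex _ _ (perm_ord v)).
  by apply: eq_bigr => i _; rewrite mxE.
rewrite E//; last by left.
rewrite -[X in slope_norm l X](addr0 b0) E ?normr0 ?(ltW e0)//; last by right.
by rewrite addr0 slope_linD addrC addKr.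
Qed.

Lemma dirderiv_slope_norm l u : dirderiv (slope_norm l) b0 u = slope_lin l u u.
Proof.
have [e e0 eP] := slope_norm_local.
apply: cvg_lim => //; apply: cvg_near_cst.
near=> t.
have t0 : 0 < t by near: t; exact: nbhs_right_gt.
rewrite (eP l (t *: u) u).
- by rewrite slope_linZ mulrAC divff ?mul1r// gt_eqF.
- exact: same_cellZ.
rewrite mx_normZ gtr0_norm//.
have te : t <= e / (1 + `|u|).
  by near: t; apply: nbhs_right_le; rewrite divr_gt0// ltr_wpDr.
rewrite (@le_trans _ _ (e / (1 + `|u|) * (1 + `|u|)))//.
  by rewrite ler_pM// ?(ltW t0)// lerDr.
by rewrite divfK// gt_eqF// ltr_wpDr.
Unshelve. all: by end_near.
Qed.

End slope_local.

(** * Convexity of the SLOPE norm *)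

Section slope_convex.
Context (R : realType) (p : nat).
Implicit Types (l a b : 'cV[R]_p).

Let topk (k : nat) b : R := \sum_(i < k) (abs_sorted b)`_i.

Let pos (x : R) : R := Num.max 0 x.

Let size_abs_sorted b : size (abs_sorted b) = p.
Proof. by rewrite size_sort size_map size_enum_ord. Qed.

Let abs_sorted_le b i j : (i <= j)%N -> (j < p)%N ->
  (abs_sorted b)`_j <= (abs_sorted b)`_i.
Proof.
move=> ij jp.
have : sorted >=%R (abs_sorted b) by apply: sort_sorted => x y; exact: le_total.
have tr : transitive (>=%R : rel R) by move=> x y z xy yz; exact: le_trans yz xy.
move=> /(sorted_leq_nth tr (fun x => lexx x) 0); apply => //.
- by rewrite inE size_abs_sorted (leq_ltn_trans ij).
- by rewrite inE size_abs_sorted.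
Qed.

Let sum_pos b (r : R) : \sum_i pos (`|b i 0| - r) = \sum_(i < p) pos ((abs_sorted b)`_i - r).
Proof.
rewrite -(big_mkord xpredT (fun i => pos ((abs_sorted b)`_i - r))).
rewrite -[X in index_iota 0 X](size_abs_sorted b) -(big_nth 0 xpredT (fun x => pos (x - r))).
by rewrite (perm_big _ (permEl (perm_sort _ _))) big_map big_enum.
Qed.

(** Together with [topk_eq] this is the variational formula for the sum of the largest entries, a
    minimum over [r] attained at the last entry counted. Joint convexity of the right side in [b]
    and [r] makes [topk] convex. *)
Let topk_le k b (r : R) : (k <= p)%N -> topk k b <= k%:R * r + \sum_i pos (`|b i 0| - r).
Proof.
move=> kp; rewrite sum_pos -lerBlDl mulr_natl -[X in _ *+ X]card_ord -sumr_const -sumrB.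
rewrite -!(big_mkord xpredT (fun i => (abs_sorted b)`_i - r)) -(big_mkord xpredT (fun i => pos ((abs_sorted b)`_i - r))).
rewrite [leRHS](big_cat_nat (n := k))//= -[leLHS]addr0 lerD//.
  by apply: ler_sum => i _; rewrite le_max lexx orbT.
by apply: sumr_ge0 => i _; rewrite le_max lexx.
Qed.

Let topk_eq k b : (k < p)%N -> exists r : R,
  topk k.+1 b = k.+1%:R * r + \sum_i pos (`|b i 0| - r).
Proof.
move=> kp; exists (abs_sorted b)`_k; set r := (abs_sorted b)`_k.
have -> : \sum_i pos (`|b i 0| - r) = \sum_(i < k.+1) ((abs_sorted b)`_i - r).
  rewrite sum_pos -(big_mkord xpredT (fun i => pos ((abs_sorted b)`_i - r))).
  rewrite -(big_mkord xpredT (fun i => (abs_sorted b)`_i - r)).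
  rewrite (@big_cat_nat _ _ _ k.+1)//= [X in _ + X]big_nat [X in _ + X]big1 ?addr0.
    rewrite !big_nat; apply: eq_bigr => i /andP[_ ik].
    by rewrite /pos max_r// subr_ge0 abs_sorted_le.
  move=> i /andP[ki ip]; rewrite /pos max_l// subr_le0 abs_sorted_le//.
  exact: ltnW.
by rewrite sumrB sumr_const card_ord mulr_natl addrC subrK.
Qed.

Let topk_convex k a b (t : R) : (k < p)%N -> 0 <= t <= 1 ->
  topk k.+1 ((1 - t) *: a + t *: b) <= (1 - t) * topk k.+1 a + t * topk k.+1 b.
Proof.
move=> kp /andP[t0 t1].
have [ra ->] := topk_eq a kp; have [rb ->] := topk_eq b kp.
have s0 : 0 <= 1 - t by rewrite subr_ge0.
rewrite (le_trans (topk_le _ ((1 - t) * ra + t * rb) kp))//.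
rewrite [leRHS](_ : _ = k.+1%:R * ((1 - t) * ra + t * rb) +
  ((1 - t) * (\sum_i pos (`|a i 0| - ra)) + t * (\sum_i pos (`|b i 0| - rb)))); last by ring.
rewrite lerD2l !mulr_sumr -big_split/=; apply: ler_sum => i _.
have pge (x : R) : 0 <= pos x by rewrite le_max lexx.
have ple (x : R) : x <= pos x by rewrite le_max lexx orbT.
rewrite ge_max addr_ge0 ?mulr_ge0//= !mxE.
rewrite (@le_trans _ _ ((1 - t) * (`|a i 0| - ra) + t * (`|b i 0| - rb)))//; last first.
  by rewrite lerD// ler_wpM2l.
have : `|(1 - t) * a i 0 + t * b i 0| <= (1 - t) * `|a i 0| + t * `|b i 0|.
  by rewrite (le_trans (ler_normD _ _))// !normrM (ger0_norm t0) (ger0_norm s0).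
move: `|_ + _| => x; lra.
Qed.

Let abel (L x : nat -> R) n : \sum_(i < n) L i * x i =
  \sum_(k < n) (L k - L k.+1) * (\sum_(i < k.+1) x i) + L n * \sum_(i < n) x i.
Proof.
elim: n => [|n ih]; first by rewrite !big_ord0 mulr0 addr0.
rewrite big_ord_recr/= ih [in X in _ = X + _]big_ord_recr/=.
by rewrite ![\sum_(i < n.+1) x i]big_ord_recr/=; ring.
Qed.

(** Abel summation writes the norm as a combination of the convex functions [topk], with the
    successive decreases of the padded weights as nonnegative coefficients. *)
Lemma slope_norm_convex l a b (t : R) : slope_weights l -> 0 <= t <= 1 ->
  slope_norm l ((1 - t) *: a + t *: b) <= (1 - t) * slope_norm l a + t * slope_norm l b.
Proof.
move=> [ldec l0] t01.
have E c : slope_norm l c = \sum_(k < p) (lnth l k - lnth l k.+1) * topk k.+1 c.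
  rewrite /slope_norm; under eq_bigr do rewrite -lnth_ord.
  by rewrite (abel (lnth l) (fun i => (abs_sorted c)`_i)) lnth_default// mul0r addr0.
rewrite !E !mulr_sumr -big_split/=; apply: ler_sum => k _.
rewrite (mulrCA (1 - t)) (mulrCA t) -mulrDr ler_wpM2l ?topk_convex// subr_ge0.
have [kp|pk] := ltnP k.+1 p; last by rewrite lnth_default// lnth_ord.
by rewrite -[k.+1]/(val (Ordinal kp)) !lnth_ord; apply: ldec => /=.
Qed.

End slope_convex.

(** * Positive definite forms *)

Section quadratic_form.
Context (R : realType) (p : nat).
Implicit Types (C : 'M[R]_p) (u v w x z : 'cV[R]_p).

Definition qf C u v : R := (u^T *m C *m v) 0 0.
Definition dot u v : R := (u^T *m v) 0 0.

Lemma qfDl C u v w : qf C (u + v) w = qf C u w + qf C v w.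
Proof. by rewrite /qf linearD/= !mulmxDl mxE. Qed.
Lemma qfDr C u v w : qf C w (u + v) = qf C w u + qf C w v.
Proof. by rewrite /qf mulmxDr mxE. Qed.
Lemma qfZl C k u v : qf C (k *: u) v = k * qf C u v.
Proof. by rewrite /qf linearZ/= -!scalemxAl mxE. Qed.
Lemma qfZr C k u v : qf C u (k *: v) = k * qf C u v.
Proof. by rewrite /qf -scalemxAr mxE. Qed.
Lemma qfBl C u v w : qf C (u - v) w = qf C u w - qf C v w.
Proof. by rewrite -[- v]scaleN1r qfDl qfZl mulN1r. Qed.
Lemma qfBr C u v w : qf C w (u - v) = qf C w u - qf C w v.
Proof. by rewrite -[- v]scaleN1r qfDr qfZr mulN1r. Qed.
Lemma qfC C u v : C^T = C -> qf C u v = qf C v u.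
Proof.
move=> CT; rewrite /qf; transitivity ((u^T *m C *m v)^T 0 0); first by rewrite [RHS]mxE.
by rewrite !trmx_mul trmxK CT mulmxA.
Qed.
Lemma dotDl u v w : dot (u + v) w = dot u w + dot v w.
Proof. by rewrite /dot linearD/= mulmxDl mxE. Qed.
Lemma dotBr u v w : dot w (u - v) = dot w u - dot w v.
Proof. by rewrite /dot mulmxBr mxE [X in _ + X]mxE. Qed.
Lemma dotBl u v w : dot (u - v) w = dot u w - dot v w.
Proof. by rewrite /dot linearB/= mulmxBl mxE [X in _ + X]mxE. Qed.
Lemma dotZl k u v : dot (k *: u) v = k * dot u v.
Proof. by rewrite /dot linearZ/= -scalemxAl mxE. Qed.

Lemma qfE C u v : qf C u v = \sum_i \sum_j C i j * (u i 0 * v j 0).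
Proof.
rewrite /qf mxE exchange_big/=; apply: eq_bigr => j _; rewrite mxE mulr_suml.
by apply: eq_bigr => i _; rewrite mxE; ring.
Qed.

Lemma dotE u v : dot u v = \sum_i u i 0 * v i 0.
Proof. by rewrite /dot mxE; apply: eq_bigr => i _; rewrite mxE. Qed.

Lemma dot_le u v : `|dot u v| <= p%:R * `|u| * `|v|.
Proof.
rewrite dotE (le_trans (ler_norm_sum _ _ _))//.
rewrite -mulrA mulr_natl -[X in _ *+ X]card_ord -sumr_const.
by apply: ler_sum => i _; rewrite normrM ler_pM// coord_le_norm.
Qed.

Lemma qfB_le C C' u v (e : R) : 0 <= e -> (forall i j, `|C' i j - C i j| <= e) ->
  `|qf C' u v - qf C u v| <= p%:R * p%:R * e * (`|u| * `|v|).
Proof.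
move=> e0 CC; rewrite !qfE -sumrB (le_trans (ler_norm_sum _ _ _))//.
rewrite -!mulrA mulr_natl -[X in _ *+ X]card_ord -sumr_const.
apply: ler_sum => i _; rewrite -sumrB (le_trans (ler_norm_sum _ _ _))//.
rewrite mulr_natl -[X in _ *+ X]card_ord -sumr_const.
apply: ler_sum => j _; rewrite -mulrBl !normrM ler_pM// ?mulr_ge0//.
by rewrite ler_pM// coord_le_norm.
Qed.

Section posdef.
Variable C : 'M[R]_p.
Hypothesis C_pos : posdefmx C.

Lemma qf_gt0 u : u != 0 -> 0 < qf C u u.
Proof. exact: C_pos.2. Qed.

Lemma qf_ge0 u : 0 <= qf C u u.
Proof.
have [->|/qf_gt0/ltW//] := eqVneq u 0.
by rewrite /qf mulmx0 mxE.
Qed.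

Lemma qf_cauchy_schwarz u v : qf C u v ^+ 2 <= qf C u u * qf C v v.
Proof.
have [->|u0] := eqVneq u 0.
  by rewrite /qf trmx0 !mul0mx !mxE expr0n/= mul0r.
have q0 := qf_gt0 u0; set B := qf C u v; set Q := qf C u u in q0 *.
have := qf_ge0 (v + (- (B / Q)) *: u).
rewrite !(qfDl, qfDr, qfZl, qfZr) (qfC v u C_pos.1) -/B -/Q.
rewrite [leRHS](_ : _ = qf C v v - B ^+ 2 / Q); last by field; rewrite gt_eqF.
by rewrite subr_ge0 ler_pdivrMr// mulrC.
Qed.

Lemma posdef_unit : C \in unitmx.
Proof.
rewrite -row_free_unit -kermx_eq0; apply/eqP/row_matrixP => i; rewrite row0.
have : row i (kermx C) *m C = 0 by apply/sub_kermxP; exact: row_sub.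
set r := row i _ => rC; apply/eqP; apply/negPn/negP => r0.
have : 0 < qf C r^T r^T by apply: qf_gt0; rewrite trmx_eq0.
by rewrite /qf trmxK rC mul0mx mxE ltxx.
Qed.

(** Each coordinate of [v] is the [C]-product of [v] with a column of the inverse of [C], so
    Cauchy-Schwarz bounds it; neither compactness nor eigenvalues are involved. *)
Lemma qf_coercive : exists2 c : R, 0 < c & forall v, c * `|v| ^+ 2 <= qf C v v.
Proof.
pose w i : 'cV[R]_p := invmx C *m delta_mx i 0.
have vE v i : v i 0 = qf C (w i) v.
  rewrite qfC; last exact: C_pos.1.
  rewrite /qf /w mulmxA mulmxK ?posdef_unit// mxE (bigD1 i)//= big1 ?addr0.
    by rewrite !mxE !eqxx mulr1.
  by move=> j /negPf ji; rewrite !mxE ji mulr0.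
pose K : R := 1 + \sum_i qf C (w i) (w i).
have s0 : 0 <= \sum_i qf C (w i) (w i) by apply: sumr_ge0 => i _; exact: qf_ge0.
have K0 : 0 < K by rewrite ltr_wpDr.
exists K^-1; first by rewrite invr_gt0.
move=> v; rewrite mulrC ler_pdivrMr//.
have [->|Yw] := eqVneq v 0; first by rewrite normr0 expr0n mulr_ge0 ?qf_ge0// ltW.
have [] := @mx_norm_neq0 _ _ _ v; first by rewrite -[mx_norm _]/(`|v|) normr_eq0.
move=> [i j] /= vij; rewrite -[`|v|]/(mx_norm v) vij (ord1 j) real_normK ?num_real//.
rewrite vE (le_trans (qf_cauchy_schwarz _ _))// mulrC ler_wpM2l ?qf_ge0//.
rewrite /K (bigD1 i)//= addrCA lerDl addr_ge0// sumr_ge0// => l _.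
exact: qf_ge0.
Qed.

(* Riesz representation on the range of [B]. *)
Lemma qf_riesz (B : 'M[R]_p) (a : 'cV[R]_p) : exists c : 'cV[R]_p,
  forall y, qf C (B *m c) (B *m y) = dot a (B *m y).
Proof.
pose G := B^T *m C *m B.
(* [B] and the Gram matrix [G] have the same row space: a row [r] killed by [G] gives [r B^T] zero
   energy under [C], so [r B^T = 0] and the ranks agree. *)
have GB : (B <= G)%MS.
  have sub : (G <= B)%MS by exact: submxMl.
  have rk : \rank B = \rank G.
    apply/eqP; rewrite eqn_leq (mxrankS sub) andbT.
    rewrite -[\rank B]mxrank_tr -[X in (X <= _)%N]subn0.
    have kk : (kermx G <= kermx B^T)%MS.
      apply/sub_kermxP; apply/row_matrixP => i; rewrite row0 row_mul.
      have : row i (kermx G) *m G = 0 by apply/sub_kermxP; exact: row_sub.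
      set r := row i _ => rG.
      have : qf C (r *m B^T)^T (r *m B^T)^T = 0.
        rewrite /qf trmxK [(r *m B^T)^T]trmx_mul trmxK.
        have -> : r *m B^T *m C *m (B *m r^T) = (r *m G) *m r^T by rewrite !mulmxA.
        by rewrite rG mul0mx mxE.
      move=> q0; apply/eqP; rewrite -trmx_eq0; apply/negPn/negP => /qf_gt0.
      by rewrite q0 ltxx.
    have := mxrankS kk; rewrite !mxrank_ker.
    by rewrite subn0 -(leq_sub2lE _ (rank_leq_row B^T)).
  have /eqmxP GE : (G == B)%MS by rewrite -(mxrank_leqif_eq sub) rk.
  by rewrite GE.
have /submxP[D aD] : (a^T *m B <= G)%MS by rewrite (submx_trans _ GB)// submxMl.
exists D^T => y; rewrite /qf /dot trmx_mul trmxK.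
by rewrite (mulmxA a^T) aD /G !mulmxA.
Qed.

End posdef.
End quadratic_form.

(** * Stability of the pattern of the minimiser *)

Section cell_riesz.
Context (R : realType) (p : nat).
Implicit Types (u v w x z : 'cV[R]_p) (t s : 'I_p * 'I_p * 'I_3).

Lemma dot_delta i z : dot (delta_mx i 0) z = z i 0.
Proof. by rewrite /dot trmx_delta -rowE mxE. Qed.

Lemma dotC u v : dot u v = dot v u.
Proof. by rewrite !dotE; apply: eq_bigr => i _; rewrite mulrC. Qed.

Definition arrv t : 'cV[R]_p := delta_mx t.1.1 0 + (t.2%:R - 1) *: delta_mx t.1.2 0.

Lemma dot_arrv t z : dot (arrv t) z = arr t z.
Proof. by rewrite dotDl dotZl !dot_delta. Qed.

(** The linear span of the cell of [v]: the directions in which [v] can move both ways without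
    leaving its cell. *)
Definition in_span v z := forall s, arr s v = 0 -> arr s z = 0.

Lemma cell_riesz (C : 'M[R]_p) v t : posdefmx C ->
  exists2 w, in_span v w & forall z, in_span v z -> qf C w z = arr t z.
Proof.
move=> Cpos.
(* The columns are the normals of the hyperplanes through [v], padded by zeros, so the left kernel
   of [N] parametrises the span. *)
pose N : 'M[R]_(p, #|{: 'I_p * 'I_p * 'I_3}|) :=
  \matrix_(i, k) if arr (enum_val k) v == 0 then arrv (enum_val k) i 0 else 0.
pose B := (kermx N)^T.
have NE z k : (z^T *m N) 0 k = if arr (enum_val k) v == 0 then arr (enum_val k) z else 0.
  rewrite mxE; case: ifPn => vk.
    by rewrite -dot_arrv dotC dotE; apply: eq_bigr => i _; rewrite !mxE vk.
  by rewrite big1// => i _; rewrite !mxE (negbTE vk) mulr0.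
have spanP z : in_span v z <-> exists y, z = B *m y.
  split=> [vz|[y ->] s vs].
    have : z^T *m N = 0.
      by apply/rowP => k; rewrite NE [RHS]mxE; case: eqP => // /vz.
    move=> /sub_kermxP/submxP[y zy]; exists y^T.
    by rewrite -[LHS]trmxK zy trmx_mul.
  have /rowP/(_ (enum_rank s)) : (B *m y)^T *m N = 0.
    by rewrite trmx_mul trmxK -mulmxA mulmx_ker mulmx0.
  by rewrite NE enum_rankK vs eqxx => ->; rewrite mxE.
have [c cP] := qf_riesz Cpos B (arrv t).
exists (B *m c); first by apply/spanP; exists c.
by move=> z /spanP[y ->]; rewrite cP dot_arrv.
Qed.

End cell_riesz.

(** * Strong convexity of the limit objective and small perturbations *)

Section stability.
Context (R : realType) (p : nat) (b0 : 'cV[R]_p).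
Implicit Types (C : 'M[R]_p) (l u v w x z : 'cV[R]_p).

(** The function is homogeneous and near 0 equals an increment of the convex norm; a common factor
    [k] shrinks all three points into that neighbourhood. *)
Lemma slope_lin_convex l u v (t : R) : slope_weights l -> 0 <= t <= 1 ->
  let z := (1 - t) *: u + t *: v in
  slope_lin b0 l z z <= (1 - t) * slope_lin b0 l u u + t * slope_lin b0 l v v.
Proof.
move=> lw t01 /=; set z := _ *: u + _; have [e e0 eP] := slope_norm_local b0.
pose k := e / (1 + `|u| + `|v| + `|z|).
have d0 : 0 < 1 + `|u| + `|v| + `|z| by rewrite -!addrA ltr_pwDl// !addr_ge0.
have k0 : 0 < k by rewrite divr_gt0.
have kE w : `|w| <= 1 + `|u| + `|v| + `|z| ->
    k * slope_lin b0 l w w = slope_norm l (b0 + k *: w) - slope_norm l b0.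
  move=> wle; rewrite (eP l (k *: w) w) ?slope_linZ//; first exact: same_cellZ.
  by rewrite mx_normZ gtr0_norm// /k mulrAC ler_pdivrMr// ler_pM2l.
rewrite -(ler_pM2l k0) mulrDr (mulrCA k) (mulrCA k t).
have [u0 v0 z0] : [/\ 0 <= `|u|, 0 <= `|v| & 0 <= `|z|] by [].
rewrite !kE; [|lra|lra|lra].
have -> : b0 + k *: z = (1 - t) *: (b0 + k *: u) + t *: (b0 + k *: v).
  by apply/colP => i; rewrite !mxE; ring.
have := slope_norm_convex (b0 + k *: u) (b0 + k *: v) lw t01.
lra.
Qed.

Definition quad_obj C l x v u := 2^-1 * qf C u u - dot u x + slope_lin b0 l v u.

Lemma limit_objectiveE C l x u : limit_objective C l b0 x u = quad_obj C l x u u.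
Proof. by rewrite /limit_objective dirderiv_slope_norm. Qed.

Section strong_convexity.
Variables (C : 'M[R]_p) (l : 'cV[R]_p).
Hypotheses (C_pos : posdefmx C) (lw : slope_weights l).

Let V x u := quad_obj C l x u u.

(** Compare [u] with the midpoint of [u] and [z], where the quadratic part saves one eighth of
    [qf C (z - u) (z - u)]; doubling gives the constant. *)
Lemma quad_obj_strong x u z : is_argmin (V x) u ->
  V x u + 4^-1 * qf C (z - u) (z - u) <= V x z.
Proof.
move=> uP; have := uP ((1 - 2^-1) *: u + 2^-1 *: z).
have h2 : 0 <= (2^-1 : R) <= 1.
  by apply/andP; split; lra.
have := @slope_lin_convex l u z _ lw h2; rewrite /V /quad_obj.
set m := _ *: u + _ => hm.
have -> : qf C m m = (qf C u u + qf C z z) / 2 - qf C (z - u) (z - u) / 4.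
  rewrite /m !(qfBl, qfBr, qfDl, qfDr, qfZl, qfZr) (qfC z u C_pos.1); by field.
have -> : dot m x = (dot u x + dot z x) / 2 by rewrite /m dotDl !dotZl; field.
move: hm; lra.
Qed.

(** Adding the two strong convexity inequalities leaves [dot (u' - u) (x' - x)]. The bound supplies
    the measurability of pattern events of the minimiser. *)
Lemma argmin_lipschitz : exists2 K : R, 0 <= K & forall x x' u u',
  is_argmin (V x) u -> is_argmin (V x') u' -> `|u' - u| <= K * `|x' - x|.
Proof.
have [c c0 cP] := qf_coercive C_pos.
exists (2 * p%:R / c); first by rewrite divr_ge0// ?mulr_ge0// ltW.
move=> x x' u u' uP u'P.
have h1 := quad_obj_strong u' uP.
have := quad_obj_strong u u'P.
have -> : qf C (u - u') (u - u') = qf C (u' - u) (u' - u).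
  by rewrite !(qfBl, qfBr); ring.
have := cP (u' - u); have := dot_le (u' - u) (x' - x).
have -> : dot (u' - u) (x' - x) = dot u' x' - dot u' x - (dot u x' - dot u x).
  by rewrite dotBl !dotBr; ring.
move=> /(le_trans (ler_norm _)) + + h2; move: h1 h2; rewrite /V /quad_obj.
move=> h1 h2 h3 h4.
have h : c * `|u' - u| ^+ 2 <= 2 * (p%:R * `|u' - u| * `|x' - x|) by lra.
have [->|d0] := eqVneq (u' - u) 0; first by rewrite normr0 !mulr_ge0// invr_ge0 ltW.
have {}d0 : 0 < `|u' - u| by rewrite normr_gt0.
rewrite mulrAC ler_pdivlMr// -(ler_pM2r d0).
move: h; rewrite expr2; lra.
Qed.

End strong_convexity.

Lemma quad_obj_err C C' l l' x x' v z (e M : R) : 0 <= e -> `|z| <= M ->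
  (forall i j, `|C' i j - C i j| <= e) -> `|x' - x| <= e -> `|l' - l| <= e ->
  `|quad_obj C' l' x' v z - quad_obj C l x v z| <= e * (p%:R * p%:R * (M * M) + 2 * p%:R * M).
Proof.
move=> e0 zM Ce xe le.
have M0 : 0 <= M by exact: le_trans zM.
have h1 := qfB_le z z e0 Ce.
have h2 := dot_le z (x' - x).
have h3 := slope_linB_le b0 l' l v z.
have zz : `|z| * `|z| <= M * M by rewrite ler_pM.
have p0 : 0 <= p%:R :> R by [].
have {}h1 : `|qf C' z z - qf C z z| <= e * (p%:R * p%:R * (M * M)).
  rewrite (le_trans h1)// [leLHS](_ : _ = e * (p%:R * p%:R * (`|z| * `|z|))); last by ring.
  by rewrite ler_wpM2l// ler_wpM2l// mulr_ge0.
have {}h2 : `|dot z (x' - x)| <= e * (p%:R * M).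
  by rewrite (le_trans h2)// mulrC ler_pM// ?mulr_ge0// ler_wpM2l.
have {}h3 : `|slope_lin b0 l' v z - slope_lin b0 l v z| <= e * (p%:R * M).
  by rewrite (le_trans h3)// [e * _]mulrCA -mulrA ler_wpM2l// ler_pM.
rewrite dotBr in h2; rewrite /quad_obj ler_norml.
have q0 : 0 <= e * (p%:R * p%:R * (M * M)) by rewrite !mulr_ge0.
by move: h1 h2 h3; rewrite !ler_norml => /andP[? ?] /andP[? ?] /andP[? ?]; lra.
Qed.

Lemma cell_perturb v z : in_span v z -> exists2 e : R, 0 < e &
  forall k, `|k| <= e -> same_cell (v + k *: z) v.
Proof.
move=> vz.
have [|e e0 eP] := @fin_pos_lb R _ (fun t => if arr t v == 0 then 1 else `|arr t v| / (1 + `|arr t z|)).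
  by move=> t; case: ifPn => // v0; rewrite divr_gt0 ?normr_gt0// ltr_pwDl.
exists (e / 2); first by rewrite divr_gt0.
move=> k ke t; rewrite arrD arrZ.
have [v0|v0] := eqVneq (arr t v) 0; first by rewrite (vz t v0) mulr0 addr0.
have := eP t; rewrite (negbTE v0) ler_pdivlMr ?ltr_pwDl// => h.
have : `|k * arr t z| < `|arr t v|.
  rewrite normrM (lt_le_trans _ h)// (@le_lt_trans _ _ (e / 2 * `|arr t z|)) ?ler_wpM2r//.
  by have : 0 <= `|arr t z| by []; have := mulr_ge0 (ltW e0) (normr_ge0 (arr t z)); lra.
have [a0|a0|/eqP] := ltgtP 0 (arr t v); last by rewrite eq_sym (negbTE v0).
  by rewrite (gtr0_norm a0) ltr_norml => /andP[? ?]; rewrite !gtr0_sg//; lra.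
by rewrite (ltr0_norm a0) ltr_norml => /andP[? ?]; rewrite !ltr0_sg//; lra.
Qed.

End stability.

(** * Stationarity and preservation of the cell *)

Section pattern_stability.
Context (R : realType) (p : nat) (b0 : 'cV[R]_p) (C : 'M[R]_p) (l : 'cV[R]_p).
Hypotheses (C_pos : posdefmx C) (lw : slope_weights l).
Implicit Types (u v w x z : 'cV[R]_p).

Let V x u := quad_obj b0 C l x u u.

(* Outside the ball of radius [e^-1] only convexity is known: there the SLOPE
   norm of [b0 + s *: z] is no longer linear on the cells of [z]. *)
Definition near_obj (e : R) x (phi : 'cV[R]_p -> R) :=
  (forall u v (t : R), 0 <= t <= 1 ->
     phi ((1 - t) *: u + t *: v) <= (1 - t) * phi u + t * phi v) /\
  exists (C' : 'M[R]_p) x' l', [/\ forall i j, `|C' i j - C i j| <= e, C'^T = C',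
    `|x' - x| <= e, `|l' - l| <= e &
    exists k, forall z, `|z| <= e^-1 -> phi z = quad_obj b0 C' l' x' z z + k].

(** If [v] were farther away, convexity of [phi] would give a point at distance exactly [eta] on the
    segment with [phi z <= phi u], while strong convexity puts [V] there above its minimum by
    [c eta^2 / 4], more than twice the approximation error. Only the ball of radius [|u| + 1]
    enters. *)
Lemma near_argmin x u (eta : R) : is_argmin (V x) u -> 0 < eta <= 1 ->
  exists2 e : R, 0 < e & forall e' phi v, 0 < e' <= e -> near_obj e' x phi ->
    is_argmin phi v -> `|v - u| <= eta.
Proof.
move=> uP /andP[eta0 eta1]; have [c c0 cP] := qf_coercive C_pos.
pose M := `|u| + 1; have M0 : 0 < M by rewrite ltr_wpDl.
pose B := p%:R * p%:R * (M * M) + 2 * p%:R * M.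
have B0 : 0 <= B by rewrite addr_ge0// !mulr_ge0// ltW.
pose e := Num.min (M^-1) (c * eta ^+ 2 / (16 * (1 + B))).
have d0 : 0 < 16 * (1 + B) by rewrite mulr_gt0// ltr_pwDl.
exists e; first by rewrite lt_min invr_gt0 M0 divr_gt0// mulr_gt0// exprn_gt0.
move=> e' phi v /andP[e'0 /le_trans e'e] [cvx [C' [x' [l' [CC Csym xx ll [k phiE]]]]]] vP.
have {}e'M : M <= e'^-1.
  by rewrite -[M]invrK lef_pV2 ?posrE ?invr_gt0// e'e// ge_min lexx.
have e'B : e' * (16 * (1 + B)) <= c * eta ^+ 2.
  by rewrite -ler_pdivlMr// e'e// ge_min lexx orbT.
have err z : `|z| <= M -> `|phi z - k - V x z| <= e' * B.
  move=> zM; rewrite phiE ?(le_trans zM)// addrK.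
  exact: quad_obj_err (ltW e'0) zM CC xx ll.
rewrite leNgt; apply/negP => etav.
pose N := `|v - u|; have N0 : 0 < N by exact: lt_trans etav.
pose t := eta / N.
have t01 : 0 <= t <= 1 by rewrite /t divr_ge0 ?(ltW eta0) ?(ltW N0)//= ler_pdivrMr// mul1r ltW.
pose z := (1 - t) *: u + t *: v.
have zu : `|z - u| = eta.
  have -> : z - u = t *: (v - u) by apply/colP => i; rewrite !mxE; ring.
  by rewrite mx_normZ ger0_norm; [rewrite divfK// gt_eqF|case/andP: t01].
have uM : `|u| <= M by rewrite lerDl.
have zM : `|z| <= M.
  have -> : z = u + (z - u) by rewrite addrC subrK.
  by rewrite (le_trans (ler_normD _ _))// zu lerD2l.
have phizu : phi z <= phi u.
  apply: (le_trans (cvx u v t t01)).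
  have := vP u; case/andP: t01 => t0 _ /(ler_wpM2l t0); lra.
have := quad_obj_strong C_pos lw z uP.
have := cP (z - u); rewrite zu.
have := err z zM; have := err u uM; rewrite !ler_norml /V => /andP[? ?] /andP[? ?].
have := mulr_gt0 c0 (exprn_gt0 2 eta0); lra.
Qed.

(** Along the span of its cell the objective is a genuine quadratic polynomial in a short step of
    either sign, so its first-order coefficient vanishes at a minimiser. *)
Lemma argmin_stationary (C' : 'M[R]_p) x' l' phi v z k (M : R) : C'^T = C' ->
  (forall z, `|z| <= M -> phi z = quad_obj b0 C' l' x' z z + k) ->
  is_argmin phi v -> `|v| < M -> in_span v z ->
  qf C' z v - dot z x' + slope_lin b0 l' v z = 0.
Proof.
move=> C'T phiE vP vM vz; set s := _ + _.
have [e e0 eP] := cell_perturb vz.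
pose h := Num.min e ((M - `|v|) / (1 + `|z|)).
have h0 : 0 < h by rewrite lt_min e0 divr_gt0 ?subr_gt0// ltr_pwDl.
have main a : `|a| <= h -> 0 <= a * s + a ^+ 2 * (2^-1 * qf C' z z).
  move=> ah; have ae : `|a| <= e by rewrite (le_trans ah)// ge_min lexx.
  have aM : `|v + a *: z| <= M.
    rewrite (le_trans (ler_normD _ _))// mx_normZ -lerBrDl.
    have : `|a| <= (M - `|v|) / (1 + `|z|) by rewrite (le_trans ah)// ge_min lexx orbT.
    rewrite ler_pdivlMr ?ltr_pwDl// => h'; apply: (le_trans _ h').
    by rewrite ler_wpM2l// lerDr.
  have := vP (v + a *: z); rewrite !phiE ?(ltW vM)// lerD2r /quad_obj.
  rewrite (same_cell_slope_lin _ _ _ (eP _ ae)) slope_linD slope_linZ dotDl dotZl.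
  rewrite !(qfDl, qfDr, qfZl, qfZr) (qfC v z C'T) /s; lra.
pose Q := `|2^-1 * qf C' z z|.
apply/eqP; rewrite -normr_le0 leNgt; apply/negP => s0.
(* A step of size [a] against the sign of [s] gains [a |s|] and costs at most [a^2 Q], less than
   half of the gain. *)
pose a := Num.min h (`|s| / (2 * (1 + Q))).
have Q0 : 0 <= Q by exact: normr_ge0.
have a0 : 0 < a by rewrite lt_min h0 divr_gt0// mulr_gt0// ltr_pwDl.
have aQ : a * (2 * (1 + Q)) <= `|s|.
  by rewrite -ler_pdivlMr ?mulr_gt0 ?ltr_pwDl// ge_min lexx orbT.
have ah : `| - a * Num.sg s| <= h.
  by rewrite normrM normrN normr_sg -normr_gt0 s0 mulr1 gtr0_norm// ge_min lexx.
have sE : Num.sg s * s = `|s| by rewrite normrEsg.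
have := main _ ah.
have -> : - a * Num.sg s * s = - (a * `|s|) by rewrite -sE; ring.
have -> : (- a * Num.sg s) ^+ 2 = a ^+ 2.
  by rewrite exprMn sqrrN sqr_sg -normr_gt0 s0 mulr1.
have : 2^-1 * qf C' z z <= Q by exact: ler_norm.
move=> /(ler_wpM2l (exprn_ge0 2 (ltW a0))).
move=> h1 h2.
have : a * `|s| <= a * (a * Q) by rewrite mulrA -expr2; lra.
rewrite ler_pM2l// => h3.
have := mulr_ge0 (ltW a0) Q0; lra.
Qed.

(** One representative per cell, 0 for codes of no cell; the exceptional hyperplanes are thereby
    indexed by a finite type, independently of [x] and [u]. *)
Let rep D : 'cV[R]_p := xget 0 [set v | code v = D].

Let repP v : same_cell (rep (code v)) v.
Proof.
apply/codeP; rewrite /rep.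
by have := @xgetPex _ 0 [set z | code z = code v] (ex_intro _ v erefl).
Qed.

(* If [u] minimises [V x] and the minimiser [v] of a nearby objective lies on
   strictly fewer of the hyperplanes [arr t] than [u], stationarity of [v] along
   its cell, tested on the Riesz representative of such an [arr t], forces [x]
   close to one of finitely many affine hyperplanes. *)
Lemma pattern_stable : exists (I : finType) (w : I -> 'cV[R]_p) (k : I -> R),
  forall x u, (forall i, w i != 0 -> dot (w i) x != k i) -> is_argmin (V x) u ->
  exists2 e : R, 0 < e & forall e' phi v, 0 < e' <= e -> near_obj e' x phi ->
    is_argmin phi v -> same_cell v u.
Proof.
pose I := ({ffun 'I_p * 'I_p * 'I_3 -> bool * bool} * ('I_p * 'I_p * 'I_3))%type.
(* Tested on such a [w], stationarity at [v] reads [arr t v = dot w x - slope_lin w] up to the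
   perturbation, so a small [arr t v] places [x] near the hyperplane where the right side
   vanishes. *)
have ex (i : I) : exists w, in_span (rep i.1) w /\
    forall z, in_span (rep i.1) z -> qf C w z = arr i.2 z.
  by have [w w1 w2] := cell_riesz (rep i.1) i.2 C_pos; exists w.
have [w wP] := choice ex.
exists I, w, (fun i => slope_lin b0 l (rep i.1) (w i)) => x u xP uP.
pose kap i := `|dot (w i) x - slope_lin b0 l (rep i.1) (w i)|.
(* A minimiser within 1 of [u] then lies strictly inside the ball, as stationarity requires. *)
pose M := `|u| + 2; have M0 : 0 < M by rewrite ltr_wpDl.
pose S := p%:R * p%:R * M + 2 * p%:R.
have S0 : 0 <= S by rewrite addr_ge0// !mulr_ge0// ltW.
have den0 i : 0 < 4 * (1 + `|w i| * S).
  by rewrite mulr_gt0// ltr_pwDl// mulr_ge0.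
have [|e1 e10 e1P] := @fin_pos_lb R _ (fun i => if w i == 0 then 1 else kap i / (4 * (1 + `|w i| * S))).
  by move=> i; case: ifPn => // wi; rewrite divr_gt0// normr_gt0 subr_eq0 xP.
have [|e2 e20 e2P] := @fin_pos_lb R _ (fun t => if arr t u == 0 then 1 else `|arr t u|).
  by move=> t; case: ifPn => // wi; rewrite normr_gt0.
(* Since [arr t] moves by at most [2 eta], the bound [e2 / 4] preserves nonzero signs, and [e1]
   keeps [arr t v] small where [arr t u = 0]. *)
pose eta := Num.min (Num.min 1 e1) (e2 / 4).
have eta01 : 0 < eta <= 1.
  by rewrite !lt_min ltr01 e10 divr_gt0//= !ge_min lexx.
have etae1 : eta <= e1 by rewrite !ge_min lexx orbT.
have etae2 : eta <= e2 / 4 by rewrite !ge_min lexx !orbT.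
have [e3 e30 e3P] := near_argmin uP eta01.
exists (Num.min (Num.min e3 e1) (M^-1)); first by rewrite !lt_min e30 e10 invr_gt0.
move=> e phi v /andP[e0]; rewrite !le_min => /andP[/andP[ee3 ee1] eM] phiP vP.
have vu : `|v - u| <= eta by apply: (e3P e phi) => //; rewrite e0.
case/andP: eta01 => eta0 eta1.
have e'M : M <= e^-1 by rewrite -[M]invrK lef_pV2 ?posrE ?invr_gt0.
have vM : `|v| < M.
  have -> : v = u + (v - u) by rewrite addrC subrK.
  by rewrite (le_lt_trans (ler_normD _ _))// ltrD2l (le_lt_trans vu)// (le_lt_trans eta1)// ltr1n.
have arr_vu t : `|arr t v - arr t u| <= 2 * eta.
  have -> : arr t v - arr t u = arr t (v - u) by rewrite -[in RHS]scaleN1r arrD arrZ mulN1r.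
  by rewrite (le_trans (arr_le _ _))// ler_wpM2l.
case: phiP => _ [C' [x' [l' [CC C'T xx ll [k phiE]]]]].
move=> t; have [u0|u0] := eqVneq (arr t u) 0; last first.
  have := e2P t; rewrite (negbTE u0) => h; have := arr_vu t.
  have [a0|a0|/eqP] := ltgtP 0 (arr t u); last by rewrite eq_sym (negbTE u0).
    by move: h; rewrite (gtr0_norm a0) ler_norml => ? /andP[? ?]; rewrite !gtr0_sg//; lra.
  by move: h; rewrite (ltr0_norm a0) ler_norml => ? /andP[? ?]; rewrite !ltr0_sg//; lra.
suff -> : arr t v = 0 by rewrite u0.
apply/eqP/negPn/negP => v0.
have rv := repP v; pose i : I := (code v, t).
have spanE z : in_span (rep (code v)) z <-> in_span v z.
  split=> h s /eqP; rewrite -sgr_eq0 => vs; apply: h; apply/eqP; rewrite -sgr_eq0.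
    by rewrite rv.
  by rewrite -rv.
have [wspan wE] := wP i.
have wv : qf C (w i) v = arr t v by apply: wE; apply/spanE.
have wi0 : w i != 0.
  by apply/eqP => w0; move: v0; rewrite -wv w0 /qf trmx0 !mul0mx mxE eqxx.
have st := argmin_stationary C'T (fun z (zM : `|z| <= M) => phiE z (le_trans zM e'M)) vP vM
  ((spanE _).1 wspan).
have := e1P i; rewrite (negbTE wi0) ler_pdivlMr// /kap /= => h1.
have h2 := qfB_le (w i) v (ltW e0) CC.
have h3 := dot_le (w i) (x' - x); rewrite dotBr in h3.
have h4 := slope_linB_le b0 l' l v (w i).
rewrite (same_cell_slope_lin _ _ _ rv) in h1.
have := arr_vu t; rewrite u0 subr0 -wv => h5.
have p0 : 0 <= p%:R :> R by [].
have W0 : 0 <= `|w i| by [].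
have {}h2 : `|qf C' (w i) v - qf C (w i) v| <= e1 * (p%:R * p%:R * (`|w i| * M)).
  rewrite (le_trans h2)// [leLHS](_ : _ = e * (p%:R * p%:R * (`|w i| * `|v|))); last by ring.
  by rewrite ler_pM ?mulr_ge0 ?(ltW e0)// ler_wpM2l ?mulr_ge0// ler_wpM2l// ltW.
have {}h3 : `|dot (w i) x' - dot (w i) x| <= e1 * (p%:R * `|w i|).
  by rewrite (le_trans h3)// mulrC ler_pM ?mulr_ge0// (le_trans xx).
have {}h4 : `|slope_lin b0 l' v (w i) - slope_lin b0 l v (w i)| <= e1 * (p%:R * `|w i|).
  by rewrite (le_trans h4)// mulrAC mulrC ler_pM ?mulr_ge0// (le_trans ll).
(* [2 * e1] comes from [arr t v], the rest from perturbing the matrix, the vector and the weights;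
   the choice of [e1] demanded at least [4 * e1 * (1 + |w i| * S)]. *)
have : `|dot (w i) x - slope_lin b0 l v (w i)| <= 2 * e1 + e1 * (`|w i| * S).
  rewrite /S mulrDr; move: h2 h3 h4 h5; rewrite !ler_norml.
  by move=> /andP[? ?] /andP[? ?] /andP[? ?] /andP[? ?]; apply/andP; split; lra.
move=> /(le_trans h1).
have := mulr_ge0 (ltW e10) (mulr_ge0 W0 S0); lra.
Qed.

End pattern_stability.

(** * Convergence of the pattern *)

Section rescaled_slope.
Context (R : realType) (p : nat) (b0 : 'cV[R]_p).
Implicit Types (u v x z l : 'cV[R]_p).

Lemma slope_weights_lim (s : nat -> R) (lam : nat -> 'cV[R]_p) l :
  (forall n, 0 <= s n) -> (forall n, slope_weights (lam n)) ->
  (s n *: lam n @[n --> \oo] --> l) -> (forall i, 0 <= l i 0) -> slope_weights l.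
Proof.
move=> s0 lamw lcvg l0; split=> // i j ij; rewrite leNgt; apply/negP => lij.
have e0 : 0 < (l j 0 - l i 0) / 2 by rewrite divr_gt0// subr_gt0.
have /cvgrPdist_lt/(_ _ e0)/filter_ex[n nP] := lcvg.
have h k : `|l k 0 - s n * lam n k 0| < (l j 0 - l i 0) / 2.
  by rewrite (le_lt_trans _ nP)//; have := coord_le_norm (l - s n *: lam n) k; rewrite !mxE.
have := ler_wpM2l (s0 n) ((lamw n).1 _ _ ij).
have := h i; have := h j; rewrite !ltr_norml => /andP[? ?] /andP[? ?]; lra.
Qed.

Lemma sqnorm2E n (v : 'cV[R]_n) : sqnorm2 v = dot v v.
Proof. by rewrite dotE; apply: eq_bigr => i _; rewrite expr2. Qed.

Section objective.
Variables (n : nat) (X : 'M[R]_(n, p)) (r : 'cV[R]_n) (lam : 'cV[R]_p) (s : R).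
Hypothesis s_gt0 : 0 < s.

Let phi z := slope_objective (X *m b0 + r) X lam (b0 + s *: z).
Let C' : 'M[R]_p := s ^+ 2 *: (X^T *m X).
Let x' : 'cV[R]_p := s *: (X^T *m r).

Let phiE z : phi z = 2^-1 * qf C' z z - dot z x' + slope_norm lam (b0 + s *: z)
  + 2^-1 * sqnorm2 r.
Proof.
rewrite /phi /slope_objective !sqnorm2E mulmxDr -scalemxAr opprD addrA.
rewrite [X *m b0 + r]addrC addrK.
have -> : qf C' z z = s ^+ 2 * dot (X *m z) (X *m z).
  by rewrite /qf /dot /C' -scalemxAr -scalemxAl mxE trmx_mul !mulmxA.
have -> : dot z x' = s * dot (X *m z) r.
  by rewrite /dot /x' -scalemxAr mxE trmx_mul !mulmxA.
by rewrite dotBl !dotBr !dotZl (dotC r (s *: _)) (dotC _ (s *: _)) !dotZl; field.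
Qed.

Let phi_convex u v (t : R) : slope_weights lam -> 0 <= t <= 1 ->
  phi ((1 - t) *: u + t *: v) <= (1 - t) * phi u + t * phi v.
Proof.
move=> lamw /[dup] t01 /andP[t0 t1]; rewrite !phiE.
have -> : b0 + s *: ((1 - t) *: u + t *: v) =
    (1 - t) *: (b0 + s *: u) + t *: (b0 + s *: v).
  by apply/colP => i; rewrite !mxE; ring.
have hs := slope_norm_convex (b0 + s *: u) (b0 + s *: v) lamw t01.
have C'T : C'^T = C' by rewrite /C' linearZ/= trmx_mul trmxK.
have q0 : 0 <= qf C' (u - v) (u - v).
  rewrite (_ : qf _ _ _ = s ^+ 2 * sqnorm2 (X *m (u - v))).
    by rewrite mulr_ge0 ?exprn_ge0 ?(ltW s_gt0)// sumr_ge0// => i _; rewrite sqr_ge0.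
  by rewrite sqnorm2E /qf /dot /C' -scalemxAr -scalemxAl mxE trmx_mul !mulmxA.
have := mulr_ge0 (mulr_ge0 t0 (_ : 0 <= 1 - t)) q0; rewrite subr_ge0 => /(_ t1).
rewrite !(qfBl, qfBr, qfDl, qfDr, qfZl, qfZr) dotDl !dotZl (qfC v u C'T); lra.
Qed.

(** A ball of radius [e^-1] in the rescaled variable has radius [s / e] around [b0], within the
    range where the norm increment is linear on cells. *)
Lemma slope_near_obj (C : 'M[R]_p) l e x (del : R) : slope_weights lam ->
  (forall l' u v, same_cell u v -> `|u| <= del ->
     slope_norm l' (b0 + u) - slope_norm l' b0 = slope_lin b0 l' v u) ->
  s * e^-1 <= del -> (forall i j, `|C' i j - C i j| <= e) -> `|x' - x| <= e ->
  `|s *: lam - l| <= e -> near_obj b0 C l e x phi.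
Proof.
move=> lamw delP sdel CC xx ll; split=> [u v t|]; first exact: phi_convex.
exists C', x', (s *: lam); split=> //.
  by rewrite /C' linearZ/= trmx_mul trmxK.
exists (slope_norm lam b0 + 2^-1 * sqnorm2 r) => z ze.
have := delP lam (s *: z) z; rewrite slope_linZ => /(_ (same_cellZ _ s_gt0)).
rewrite mx_normZ (gtr0_norm s_gt0) => h.
rewrite phiE /quad_obj slope_lin_scale -h; first by ring.
by rewrite (le_trans _ sdel)// ler_wpM2l// ltW.
Qed.

End objective.
End rescaled_slope.

(** * Measurability of pattern events *)

Section pattern_measurable.
Context (R : realType) (p : nat) d (T : measurableType d).
Implicit Types (U W : T -> 'cV[R]_p).

Lemma measurable_patt U (A : set 'cV[int]_p) :
  (forall t, measurable [set w | 0 < arr t (U w)]) ->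
  (forall t, measurable [set w | arr t (U w) < 0]) ->
  measurable [set w | A (patt (U w))].
Proof.
move=> mpos mneg.
have -> : [set w | A (patt (U w))] =
    \bigcup_(D in [set D | exists2 u : 'cV[R]_p, code u = D & A (patt u)]) [set w | code (U w) = D].
  apply/seteqP; split => [w Aw|w [D [u uD Au] /= wD]]; first by exists (code (U w)) => //; exists (U w).
  by rewrite (@same_cell_patt _ _ _ u)//; apply/codeP; rewrite uD.
apply: fin_bigcup_measurable => [|D _]; first exact: finite_finset.
have -> : [set w | code (U w) = D] =
    [set w | forall t, ([set w | (0 < arr t (U w)) = (D t).1] `&`
                       [set w | (arr t (U w) < 0) = (D t).2]) w].
  apply/seteqP; split => [w <- t|w wD]; first by rewrite /= ffunE.
  by apply/ffunP => t; rewrite ffunE; have [/= -> ->] := wD t; case: (D t).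
have meq (f : T -> bool) b : measurable [set w | f w] -> measurable [set w | f w = b].
  move=> mf; case: b => //; rewrite (_ : [set w | _] = ~` [set w | f w]).
    exact: measurableC.
  by apply/seteqP; split => w /=; case: (f w).
by apply: measurable_forall => t; apply: measurableI; exact: meq.
Qed.

(** Around each value [W w] with [g w > 0], positivity persists on a ball of radius [g w / L]; the
    union of these balls is open and its preimage is the event. *)
Lemma lipschitz_measurable W (g : T -> R) (K : R) : measurable_fun setT W ->
  (forall w w', `|g w - g w'| <= K * `|W w - W w'|) -> measurable [set w | 0 < g w].
Proof.
move=> mW gW; pose L := 1 + `|K|; have L0 : 0 < L by rewrite ltr_pwDl.
pose O : set 'cV[R]_p := \bigcup_(w in [set w | 0 < g w]) ball (W w) (g w / L).
have oO : open O by apply: bigcup_open => w /= gw; apply: ball_open; rewrite divr_gt0.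
have -> : [set w | 0 < g w] = setT `&` W @^-1` O.
  rewrite setTI; apply/seteqP; split => w.
    by move=> /= gw; exists w => //; apply: ballxx; rewrite divr_gt0.
  move=> [w' /= gw']; rewrite mx_norm_ball /ball_/= ltr_pdivlMr// => h.
  have := gW w' w; have : K * `|W w' - W w| <= `|W w' - W w| * L.
    by rewrite mulrC ler_wpM2l// (le_trans (ler_norm K))// /L lerDr.
  by rewrite ler_norml => h1 /andP[h2 h3]; lra.
by apply: mW => //; exact: measurable_cV_open.
Qed.

Lemma measurable_arr U t : measurable_fun setT U ->
  measurable_fun setT (fun w => arr t (U w)).
Proof.
move=> mU; have mc i : measurable_fun setT (fun w => U w i 0).
  exact: measurableT_comp (@measurable_coord R p i) mU.
by apply: measurable_funD => //; apply: measurable_funM => //.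
Qed.

Lemma measurable_patt_rv U (A : set 'cV[int]_p) : measurable_fun setT U ->
  measurable [set w | A (patt (U w))].
Proof.
move=> mU; apply: measurable_patt => t.
- rewrite (_ : [set w | _] = [set w | arr t (-1 *: U w) < 0]).
    by apply/measurable_fun_ltr/measurable_arr/measurable_cV_scale.
  by apply/seteqP; split => w /=; rewrite arrZ mulN1r oppr_lt0.
- exact/measurable_fun_ltr/measurable_arr.
Qed.

End pattern_measurable.

(** * Union bounds and null hyperplanes *)

Section probability_bounds.
Context d (T : measurableType d) (R : realType) (P : probability T R).
Implicit Types (A B : set T).

Lemma probability_fine A : measurable A -> P A = (fine (P A))%:E.
Proof. by move=> mA; rewrite fineK// fin_num_measure. Qed.

Lemma probabilityI_gt A B (a b : R) : measurable A -> measurable B ->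
  (a%:E < P A)%E -> (b%:E < P B)%E -> ((a + b - 1)%:E < P (A `&` B))%E.
Proof.
move=> mA mB; have mAB := measurableI _ _ mA mB.
have : (P A <= P (A `&` B) + (1 - P B))%E.
  rewrite -probability_setC// (@le_trans _ _ (P ((A `&` B) `|` ~` B)))//.
    rewrite le_measure ?inE//; first by apply: measurableU => //; exact: measurableC.
    by move=> w Aw; have [Bw|Bw] := pselect (B w); [left|right].
  by apply: measureU2 => //; exact: measurableC.
rewrite (probability_fine mA) (probability_fine mB) (probability_fine mAB).
rewrite -EFinB -EFinD !lee_fin !lte_fin; lra.
Qed.

Lemma probability_forall_gt (I : finType) A (B : I -> set T) (a del : R) :
  measurable A -> (forall i, measurable (B i)) -> (a%:E < P A)%E ->
  (forall i, ((1 - del)%:E < P (B i))%E) ->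
  ((a - #|I|%:R * del)%:E < P [set w | A w /\ forall i, B i w])%E.
Proof.
move=> mA mB aA delB.
have mBs (s : seq I) : measurable [set w | A w /\ forall i, i \in s -> B i w].
  have -> : [set w | A w /\ forall i, i \in s -> B i w] =
      A `&` [set w | forall i, (if i \in s then B i else setT) w].
    apply/seteqP; split => w [Aw h]; split => // i; first by case: ifP => // /h.
    by move=> si; have := h i; rewrite si.
  by apply: measurableI => //; apply: measurable_forall => i; case: ifP.
suff : forall s : seq I,
    ((a - (size s)%:R * del)%:E < P [set w | A w /\ forall i, i \in s -> B i w])%E.
  move=> /(_ (enum I)); rewrite -cardE; congr (_ < P _)%E.
  apply/seteqP; split => w [Aw h]; split => // i.
  by apply: h; rewrite mem_enum.
elim=> [|i s ih].
  rewrite mul0r subr0 (_ : [set w | _] = A)//.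
  by apply/seteqP; split => w // [].
have := probabilityI_gt (mBs s) (mB i) ih (delB i).
rewrite (_ : _ + _ - 1 = a - (size (i :: s))%:R * del); last by rewrite /= -natr1; ring.
congr (_ < P _)%E; apply/seteqP; split => w.
  by move=> [[Aw h] Bw]; split => // j; rewrite in_cons => /orP[/eqP->|/h].
move=> [Aw h]; split; last by apply: h; rewrite mem_head.
by split => // j js; apply: h; rewrite in_cons js orbT.
Qed.

End probability_bounds.

(** The squared Euclidean norm of [A^T v] is [sigma^2] times [v^T C v], positive by definiteness, so
    the null-set lemma for [gvec] applies. *)
Lemma normal_vec_hyperplane d (T : measurableType d) (R : realType)
    (P : probability T R) p (W : {RV P >-> 'cV[R]_p}) (C : 'M[R]_p) (sigma : R)
    (v : 'cV[R]_p) (k : R) : 0 < sigma -> posdefmx C ->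
  normal_vec W 0 (sigma ^+ 2 *: C) -> v != 0 ->
  {ae P, forall w, dot v (W w) != k}.
Proof.
move=> s0 Cpos [n [A [Z [indZ lawZ AA WE]]]] v0.
have Av : A^T *m v != 0.
  apply/eqP => Av; have : 0 < sigma ^+ 2 * qf C v v.
    by rewrite mulr_gt0 ?exprn_gt0//; exact: qf_gt0.
  rewrite (_ : _ * _ = qf (sigma ^+ 2 *: C) v v); last first.
    by rewrite /qf -scalemxAr -scalemxAl [RHS]mxE.
  by rewrite -AA /qf -!mulmxA Av !mulmx0 mxE ltxx.
have null : {ae P, forall w, dot v (gvec A Z w) <> k}.
  exists [set w | dot v (gvec A Z w) = k]; split; [|exact: (gvec_hyperplane indZ lawZ k Av)|by move=> w /= /contrapT].
  have mf : measurable_fun setT (fun w => dot v (gvec A Z w)).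
    under eq_fun do rewrite dotE.
    apply: measurable_sum => i; apply: measurable_funM => //.
    exact: measurableT_comp (@measurable_coord R p i) (measurable_gvec A Z).
  rewrite -[X in measurable X]setTI.
  by apply: (mf _ [set k]) => //; exact: measurable_set1.
apply: filterS2 null WE => w gk Ww; apply/eqP => Wk; apply: gk.
by rewrite -Wk Ww addr0.
Qed.

(** * From stability and the limit theorems to pattern probabilities *)

Section pattern_limit.
Context (R : realType) (p : nat)
  (d : measure_display) (T : measurableType d) (P : probability T R)
  (d' : measure_display) (T' : measurableType d') (P' : probability T' R)
  (b0 : 'cV[R]_p) (C : 'M[R]_p) (sigma : R)
  (X : nat -> {RV P >-> 'cV[R]_p}) (eps : nat -> {RV P >-> R})
  (lam : nat -> 'cV[R]_p) (l : 'cV[R]_p)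
  (bhat : nat -> {RV P >-> 'cV[R]_p})
  (W : {RV P' >-> 'cV[R]_p}) (uhat : T' -> 'cV[R]_p).
Hypotheses (X_iid : iid X)
  (X_centered : forall i, centered_vec (X i))
  (X_cov : forall i, has_covmx (X i) C)
  (eps_iid : iid eps)
  (eps_centered : forall i, ('E_P[eps i] = 0)%E)
  (sigma_gt0 : 0 < sigma)
  (eps_var : forall i, ('V_P[eps i] = (sigma ^+ 2)%R%:E)%E)
  (X_eps_indep : independent_classes P (sigma_seq X) (sigma_seq eps))
  (lam_weights : forall n, slope_weights (lam n))
  (bhat_argmin : forall n w,
     is_argmin (slope_objective (response X eps b0 n w) (design X n w) (lam n))
       (bhat n w))
  (lam_cvg : (Num.sqrt n%:R)^-1 *: lam n @[n --> \oo] --> l)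
  (l_ge0 : forall i : 'I_p, 0 <= l i 0)
  (C_posdef : posdefmx C)
  (W_normal : normal_vec W 0 (sigma ^+ 2 *: C))
  (uhat_argmin : forall w, is_argmin (limit_objective C l b0 (W w)) (uhat w)).

Let lw : slope_weights l.
Proof.
by apply: slope_weights_lim lam_weights lam_cvg l_ge0 => n; rewrite invr_ge0.
Qed.

Let s n : R := (Num.sqrt n%:R)^-1.
Let score n w : 'cV[R]_p := s n *: \sum_(i < n) eps i w *: X i w.
Let gram n j w : 'cV[R]_p := n%:R^-1 *: \sum_(i < n) X i w j 0 *: X i w.
Let un n w : 'cV[R]_p := Num.sqrt n%:R *: (bhat n w - b0).
Let phi n w z := slope_objective (response X eps b0 n w) (design X n w) (lam n)
  (b0 + s n *: z).

Let sqrt_gt0 n : (0 < n)%N -> 0 < Num.sqrt n%:R :> R.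
Proof. by move=> n0; rewrite sqrtr_gt0 ltr0n. Qed.

Let un_argmin n w : (0 < n)%N -> is_argmin (phi n w) (un n w).
Proof.
move=> n0 z; rewrite /phi /un /s scalerA mulVf ?gt_eqF ?sqrt_gt0// scale1r addrC subrK.
exact: bhat_argmin.
Qed.

Let uhat_quad w : is_argmin (fun u => quad_obj b0 C l (W w) u u) (uhat w).
Proof. by move=> z; rewrite -!limit_objectiveE; exact: uhat_argmin. Qed.

(** [uhat] is an arbitrary function of the sample point; measurability is recovered from the
    Lipschitz dependence of the minimiser on [W]. *)
Lemma measurable_uhat_patt (A : set 'cV[int]_p) :
  measurable [set w | A (patt (uhat w))].
Proof.
have [K K0 KP] := argmin_lipschitz b0 C_posdef lw.
have arr_lip t w w' : `|arr t (uhat w) - arr t (uhat w')| <= 2 * K * `|W w - W w'|.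
  have -> : arr t (uhat w) - arr t (uhat w') = arr t (uhat w - uhat w').
    by rewrite -[in RHS]scaleN1r arrD arrZ mulN1r.
  rewrite (le_trans (arr_le _ _))// -mulrA ler_wpM2l//.
  exact: KP.
have mW : measurable_fun setT W by [].
apply: measurable_patt => t; first exact: lipschitz_measurable mW (arr_lip t).
under eq_set do rewrite -oppr_gt0.
apply: (lipschitz_measurable (K := 2 * K) mW) => w w'.
by rewrite -opprD normrN.
Qed.

(** Stated for an arbitrary set of patterns so that it applies both to a pattern and to its
    complement. *)
Lemma patt_lower (A : set 'cV[int]_p) (c : R) :
  (c%:E < P' [set w | A (patt (uhat w))])%E ->
  \forall n \near \oo, (c%:E < P [set w | A (patt (un n w))])%E.
Proof.
have [I [v [k vP]]] := pattern_stable b0 C_posdef lw.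
pose stab e x := exists w0, [/\ W w0 = x, A (patt (uhat w0)) &
  forall phi z, near_obj b0 C l e x phi -> is_argmin phi z -> same_cell z (uhat w0)].
(* Balls around the values of [W] whose radius is an admissible tolerance. A union of balls is open
   whatever the choice of radii, and the lower bound on the radii makes the requirements on n
   uniform. *)
pose O (m : nat) : set 'cV[R]_p :=
  \bigcup_(xr in [set xr : 'cV[R]_p * R | m.+1%:R^-1 <= xr.2 /\ stab xr.2 xr.1])
    ball xr.1 xr.2.
have oO m : open (O m).
  by apply: bigcup_open => -[x r] _; exact: ball_open.
pose F m := W @^-1` O m.
have mF m : measurable (F m).
  rewrite -[X in measurable X]setTI; apply: (measurable_funP W) => //.
  exact: measurable_cV_open.
have mUF : measurable (\bigcup_m F m) by exact: bigcupT_measurable.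
have [N [mN N0 NP]] : {ae P', forall w, forall i, v i != 0 -> dot (v i) (W w) != k i}.
  apply: filter_forall => i; have [v0|v0] := eqVneq (v i) 0.
    by apply: filterE.
  have := normal_vec_hyperplane (k i) sigma_gt0 C_posdef W_normal v0.
  by apply: filterS => w + _.
move=> cA.
(* Off the null set [N], each point of the event has a positive tolerance and so lies in some
   [F m]. *)
have {cA}cF : (c%:E < P' (\bigcup_m F m))%E.
  rewrite (lt_le_trans cA)// (@le_trans _ _ (P' ((\bigcup_m F m) `|` N)))//.
    rewrite le_measure ?inE//; [exact: measurable_uhat_patt|exact: measurableU|].
    move=> w Aw; have [|nN] := pselect (N w); [by right|left].
    have {}nN := contrapT (contra_not (@NP w) nN).
    have [e e0 eP] := vP _ _ nN (uhat_quad w).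
    have [m me] : exists m : nat, m.+1%:R^-1 <= e.
      by have [m] := ltr_add_invr (y := 0) e0; rewrite add0r => /ltW; exists m.
    exists m => //; exists (W w, e) => /=; last exact: ballxx.
    split=> //; exists w; split=> // phi0 z.
    by apply: eP; rewrite e0 lexx.
  by rewrite (le_trans (measureU2 P' mUF mN))// [X in (_ + X)%E]N0 adde0.
have [m cFm] : exists m, (c%:E < P' (F m))%E.
  apply: contrapT => /forallNP cF'.
  have ndF : nondecreasing_seq F.
    move=> i j ij; apply/subsetPset => w [[x r] /= [ir sx] xr]; exists (x, r) => //=.
    split=> //; rewrite (le_trans _ ir)// lef_pV2 ?posrE// ler_nat ltnS.
    exact: ij.
  have FE := cvg_lim (@ereal_hausdorff R) (nondecreasing_cvg_mu (mu := P') mF mUF ndF).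
  move: cF; rewrite -FE ltNge lime_le//.
    by apply: ereal_nondecreasing_is_cvgn => i j ij; rewrite le_measure ?inE//; apply/subsetPset/ndF.
  by apply: nearW => i; rewrite leNgt; exact/negP/cF'.
have {cFm}[a ca aF] : exists2 a, c < a & (a%:E < P' (F m))%E.
  move: cFm; rewrite (probability_fine P' (mF m)) lte_fin => cm.
  by exists ((c + fine (P' (F m))) / 2); rewrite ?lte_fin; lra.
pose r : R := m.+1%:R^-1; have r0 : 0 < r by rewrite invr_gt0.
(* The slack between [c] and [a] pays for the exceptional events of the [p] columns of the Gram
   matrix, each of probability below [del]. *)
pose del := (a - c) / (1 + p%:R).
have del0 : 0 < del by rewrite divr_gt0 ?subr_gt0// ltr_pwDl.
have [b b0' bP] := slope_norm_local b0.
have lln j : \forall n \near \oo,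
    ((1 - del)%:E < P [set w | (`|gram n j w - col j C| < r)%R])%E.
  by apply: (lln_open X_iid X_centered X_cov eps_iid X_eps_indep) => //; rewrite gtrBl.
have clt := clt_open X_iid X_centered X_cov eps_iid eps_centered eps_var X_eps_indep
  W_normal (oO m) aF.
near=> n.
have n0 : (0 < n)%N by near: n; exact: nbhs_infty_gt.
have ln : `|s n *: lam n - l| <= r.
  rewrite distrC ltW//; near: n.
  by have /cvgrPdist_lt := lam_cvg; exact.
(* Every tolerance [e] in play is at least [r], so this covers the ball of radius [e^-1] for all of
   them at once. *)
have sn : s n * r^-1 <= b.
  rewrite -ler_pdivlMr ?invr_gt0// invrK ltW//.
  near: n; have /cvgr0Pnorm_lt := @cvg_invsqrt R.
  by move=> /(_ (b * r) (mulr_gt0 b0' r0)); apply: filterS => n; apply: le_lt_trans; exact: ler_norm.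
have lln_n : forall j, ((1 - del)%:E < P [set w | (`|gram n j w - col j C| < r)%R])%E.
  by near: n; exact: filter_forall.
have clt_n : (a%:E < P [set w | O m (score n w)])%E by near: n; exact: clt.
have mscore : measurable_fun setT (score n).
  apply: measurable_cV_scale => //; apply: measurable_cV_sum => i _.
  exact: measurable_cV_scale.
have mgram j : measurable_fun setT (gram n j).
  apply: measurable_cV_scale => //; apply: measurable_cV_sum => i _.
  by apply: measurable_cV_scale => //; exact: measurableT_comp (@measurable_coord R p j) _.
have msO : measurable [set w | O m (score n w)].
  rewrite -[X in measurable X]setTI; apply: mscore => //; exact: measurable_cV_open.
have mg j : measurable [set w | `|gram n j w - col j C| < r].
  rewrite -[X in measurable X]setTI.
  apply: (mgram j _ [set x | `|x - col j C| < r]) => //; apply: measurable_cV_open.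
  rewrite (_ : [set x | _] = ball (col j C) r); first exact: ball_open.
  by rewrite mx_norm_ball; apply/funext => x; rewrite /ball_ /= distrC.
have := probability_forall_gt msO mg clt_n lln_n; rewrite card_ord => main.
have ca' : c <= a - p%:R * del.
  rewrite /del lerBrDl -lerBrDr mulrA ler_pdivrMr ?ltr_pwDl// mulrC.
  rewrite ler_wpM2l ?subr_ge0 ?(ltW ca)// lerDr.
  by [].
rewrite (@le_lt_trans _ _ ((a - p%:R * del)%:E))//; apply: (lt_le_trans main).
have mun : measurable_fun setT (un n).
  apply: measurable_cV_scale => //; apply: measurable_cV_add => //.
rewrite le_measure ?inE//.
- apply: measurableI => //; apply: measurable_forall; exact: mg.
- exact: measurable_patt_rv.
move=> w [[[x e] /= [re [w0 [_ Aw0 stabP]]] xe] gw].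
suff : near_obj b0 C l e x (phi n w).
  by move=> /stabP/(_ (un_argmin w n0))/same_cell_patt ->.
have e0 : 0 < e by exact: lt_le_trans re.
apply: (@slope_near_obj _ _ b0 _ (design X n w) (\col_(i < n) eps i w) _ (s n) _ C l e x b) => //.
- by rewrite invr_gt0 sqrt_gt0.
- by rewrite (le_trans _ sn)// ler_wpM2l ?invr_ge0// lef_pV2.
- move=> i j; rewrite (le_trans _ re)// ltW//.
  rewrite (le_lt_trans _ (gw j))//.
  have := coord_le_norm (gram n j w - col j C) i.
  rewrite !mxE summxE.
  have -> : s n ^+ 2 = n%:R^-1 by rewrite exprVn sqr_sqrtr.
  congr (`| _ * _ - _| <= _); apply: eq_bigr => h _; rewrite !mxE; exact: mulrC.
- have -> : s n *: ((design X n w)^T *m \col_(i < n) eps i w) = score n w.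
    congr (_ *: _); apply/colP => j; rewrite mxE summxE.
    by apply: eq_bigr => i _; rewrite !mxE mulrC.
  by move: xe; rewrite mx_norm_ball /ball_/= distrC => /ltW.
- by rewrite (le_trans ln).
Unshelve. all: by end_near.
Qed.

End pattern_limit.

Theorem theorem4p1 (R : realType) (p : nat)
  (d : measure_display) (T : measurableType d) (P : probability T R)
  (d' : measure_display) (T' : measurableType d') (P' : probability T' R)
  (b0 : 'cV[R]_p) (C : 'M[R]_p) (sigma : R)
  (X : nat -> {RV P >-> 'cV[R]_p}) (eps : nat -> {RV P >-> R})
  (lam : nat -> 'cV[R]_p) (l : 'cV[R]_p)
  (bhat : nat -> {RV P >-> 'cV[R]_p})
  (W : {RV P' >-> 'cV[R]_p}) (uhat : T' -> 'cV[R]_p)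
  (X_iid : iid X)
  (X_centered : forall i, centered_vec (X i))
  (X_cov : forall i, has_covmx (X i) C)
  (eps_iid : iid eps)
  (eps_centered : forall i, ('E_P[eps i] = 0)%E)
  (sigma_gt0 : 0 < sigma)
  (eps_var : forall i, ('V_P[eps i] = (sigma ^+ 2)%R%:E)%E)
  (X_eps_indep : independent_classes P (sigma_seq X) (sigma_seq eps))
  (lam_weights : forall n, slope_weights (lam n))
  (bhat_argmin : forall n w,
     is_argmin (slope_objective (response X eps b0 n w) (design X n w) (lam n))
       (bhat n w))
  (lam_cvg : (Num.sqrt n%:R)^-1 *: lam n @[n --> \oo] --> l)
  (l_ge0 : forall i : 'I_p, 0 <= l i 0)
  (C_posdef : posdefmx C)
  (W_normal : normal_vec W 0 (sigma ^+ 2 *: C))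
  (uhat_argmin : forall w, is_argmin (limit_objective C l b0 (W w)) (uhat w))
  (q : 'cV[int]_p) (q_pattern : patterns R q) :
  P [set w | patt (Num.sqrt n%:R *: (bhat n w - b0)) = q] @[n --> \oo]
    --> P' [set w | patt (uhat w) = q].
Proof.
have lower := patt_lower X_iid X_centered X_cov eps_iid eps_centered sigma_gt0
  eps_var X_eps_indep lam_weights bhat_argmin lam_cvg l_ge0 C_posdef W_normal uhat_argmin.
have mE (A : set 'cV[int]_p) := measurable_uhat_patt lam_weights lam_cvg l_ge0 C_posdef uhat_argmin A.
have mEn (A : set 'cV[int]_p) n :
    measurable [set w | A (patt (Num.sqrt n%:R *: (bhat n w - b0)))].
  by apply/measurable_patt_rv/measurable_cV_scale => //; exact: measurable_cV_add.
have [a aE] : exists a, P' [set w | patt (uhat w) = q] = a%:E.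
  by eexists; exact: (probability_fine P' (mE [set q])).
rewrite aE; apply: cvg_EFin.
  by apply: nearW => n; rewrite fin_num_measure//; exact: (mEn [set q]).
apply/cvgrPdist_lt => e e0.
have h1 : \forall n \near \oo,
    ((a - e)%:E < P [set w | patt (Num.sqrt n%:R *: (bhat n w - b0)) = q])%E.
  by apply: (lower [set q]); rewrite aE lte_fin gtrBl.
have h2 : \forall n \near \oo,
    ((1 - a - e)%:E < P (~` [set w | patt (Num.sqrt n%:R *: (bhat n w - b0)) = q]))%E.
  apply: (lower (~` [set q])).
  rewrite (_ : [set w | _] = ~` [set w | patt (uhat w) = q])// probability_setC.
    by rewrite aE -EFinB lte_fin gtrBl.
  exact: (mE [set q]).
near=> n; have mn := mEn [set q] n.
have : ((a - e)%:E < P [set w | patt (Num.sqrt n%:R *: (bhat n w - b0)) = q])%E.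
  by near: n.
have : ((1 - a - e)%:E <
    P (~` [set w | patt (Num.sqrt n%:R *: (bhat n w - b0)) = q]))%E by near: n.
rewrite probability_setC// (probability_fine P mn) -EFinB !lte_fin /= => ? ?.
by rewrite ltr_norml; apply/andP; split; lra.
Unshelve. all: by end_near.
Qed.
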